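(* Let $f\in\mathbb H^{-s}(\Omega)$. The map $E:\mathcal Q\to\mathring H^1_L(y^\alpha,\mathcal C)$ is infinitely Fréchet differentiable on $\mathcal Q\subset L^\infty(\Omega)$. In addition, for $q\in\mathcal Q$ and $m\ge2$, the action of the $m$-th Fréchet derivative at $q$ in the direction $(h_1,\dots,h_m)\in L^\infty(\Omega)^m$, $\psi=E^{(m)}(q)(h_1,\dots,h_m)$, is the unique $\psi\in\mathring H^1_L(y^\alpha,\mathcal C)$ satisfying $$a_{\mathcal C}(\psi,\phi)(q)=-\sum_{i=1}^m\int_{\mathcal C}y^\alpha h_i\,\big[E^{(m-1)}(q)\xi_i\big]\,\phi\,dx\qquad\forall\phi\in\mathring H^1_L(y^\alpha,\mathcal C),$$ where $\xi_i=(h_1,\dots,h_{i-1},h_{i+1},\dots,h_m)$. Furthermore, $$\|\nabla\psi\|_{L^2(y^\alpha,\mathcal C)}\le C\,\|f\|_{\mathbb H^{-s}(\Omega)}\prod_{i=1}^m\|h_i\|_{L^\infty(\Omega)},$$ where $C$ is independent of $q$ and $h_1,\dots,h_m$ (it may depend on $m$).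
   Context: Setting: $d\in\{2,3\}$; $\Omega\subset\mathbb R^d$ is an open bounded convex polytope; $A\in C^{0,1}(\Omega;\mathrm{GL}(\mathbb R^d))$ is symmetric and uniformly positive definite; $\bar q>0$ and $\mathcal Q=\{q\in L^\infty(\Omega): 0\le q\le\bar q \text{ a.e.}\}$; $s\in(0,1)$, $\alpha=1-2s$, $d_s=2^{1-2s}\Gamma(1-s)/\Gamma(s)$. For $q\in\mathcal Q$ let $\mathcal L w=-\mathrm{div}_{x'}(A\nabla_{x'}w)+qw$ with homogeneous Dirichlet conditions, with eigenpairs $(\lambda_k,\varphi_k)_{k\ge1}$, $(\varphi_k)$ orthonormal in $L^2(\Omega)$. For $r\ge 0$, $\mathbb H^r(\Omega)=\{w=\sum_k w_k\varphi_k:\|w\|_{\mathbb H^r(\Omega)}^2=\sum_k\lambda_k^r w_k^2<\infty\}$, and $\mathbb H^{-r}(\Omega)$ is its dual, with pairing $\langle\cdot,\cdot\rangle$. For $r\in[0,1]$ different $q\in\mathcal Q$ give the same space with equivalent norms (constants uniform in $q\in\mathcal Q$). Extension: $\mathcal C=\Omega\times(0,\infty)$ with points $x=(x',y)$; $\mathbf A=\mathrm{diag}\{A,1\}$; $\mathring H^1_L(y^\alpha,\mathcal C)$ is the space of $w\in L^2(y^\alpha,\mathcal C)$ with $\nabla w\in L^2(y^\alpha,\mathcal C)$ and $w=0$ on $\partial\Omega\times(0,\infty)$, normed by $\|\nabla w\|_{L^2(y^\alpha,\mathcal C)}$, where $L^2(y^\alpha,\cdot)$ is the $L^2$ space for the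 measure $y^\alpha dx$; $\operatorname{tr}:\mathring H^1_L(y^\alpha,\mathcal C)\to\mathbb H^s(\Omega)$ is the bounded trace operator onto $\Omega\times\{0\}$. Let $a_{\mathcal C}(w,\phi)(q)=\int_{\mathcal C}y^\alpha(\mathbf A\nabla w\cdot\nabla\phi+qw\phi)\,dx$. $E(q)\in\mathring H^1_L(y^\alpha,\mathcal C)$ is the unique solution of $a_{\mathcal C}(E(q),\phi)(q)=d_s\langle f,\operatorname{tr}\phi\rangle$ for all $\phi\in\mathring H^1_L(y^\alpha,\mathcal C)$. Fréchet derivatives on $\mathcal Q$ are taken with respect to the $L^\infty(\Omega)$ norm, with increments $h$ restricted to $q+h\in\mathcal Q$; $E^{(1)}(q)=E'(q)\in\mathscr L(L^\infty(\Omega),\mathring H^1_L(y^\alpha,\mathcal C))$ is given by $a_{\mathcal C}(E'(q)h,\phi)(q)=-\int_{\mathcal C}y^\alpha hE(q)\phi\,dx$ for all $\phi$, and $E^{(m)}$ is the derivative of $E^{(m-1)}$, viewed as a bounded $m$-linear map $L^\infty(\Omega)^m\to\mathring H^1_L(y^\alpha,\mathcal C)$. *)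

(* Defs.v *)
From HB Require Import structures.
From mathcomp Require Import all_boot all_order all_algebra.
From mathcomp Require Import all_classical all_reals all_analysis.

Set Implicit Arguments.
Unset Strict Implicit.
Unset Printing Implicit Defensive.
Import Order.TTheory GRing.Theory Num.Theory.
Import numFieldNormedType.Exports.

Local Open Scope classical_set_scope.
Local Open Scope ring_scope.

Definition rV_display : measure_display. Proof. exact. Qed.

(* The sigma-algebra of 'rV[R]_n is the product one, generated by the
   coordinates. *)
Section measurable_rV.
Context {R : realType} (n : nat).

Let coors : 'I_n -> 'rV[R]_n -> R := fun i x => x ord0 i.

Let rV_set0 : g_sigma_preimage coors set0.
Proof. exact: sigma_algebra0. Qed.

Let rV_setC A : g_sigma_preimage coors A -> g_sigma_preimage coors (~` A).
Proof. exact: sigma_algebraC. Qed.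

Let rV_bigcup (F : (set 'rV[R]_n)^nat) : (forall i, g_sigma_preimage coors (F i)) ->
  g_sigma_preimage coors (\bigcup_i (F i)).
Proof. exact: sigma_algebra_bigcup. Qed.

HB.instance Definition _ := @isMeasurable.Build rV_display
  'rV[R]_n (g_sigma_preimage coors) rV_set0 rV_setC rV_bigcup.

End measurable_rV.

Section rV_measurability.
Context {R : realType}.

Lemma measurable_coord n (i : 'I_n) :
  measurable_fun [set: 'rV[R]_n] (fun x : 'rV[R]_n => x ord0 i).
Proof.
move=> _ Y mY; rewrite setTI; apply: sub_sigma_algebra => /=.
rewrite -bigcup_seq/=; exists i => /=; first by rewrite mem_index_enum.
by exists Y => //; rewrite setTI.
Qed.

Lemma measurable_fun_rV d (T : measurableType d) n (f : T -> 'rV[R]_n) :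
  (forall i, measurable_fun [set: T] (fun t => f t ord0 i)) ->
  measurable_fun [set: T] f.
Proof.
move=> mf; apply: (@measurability _ _ _ _ _ _
  (\big[setU/set0]_(i < n) preimage_set_system setT
     (fun x : 'rV[R]_n => x ord0 i) measurable)) => //.
move=> _ [B + <-]; rewrite -bigcup_seq/= => -[i _ [C mC <-]].
by rewrite !setTI; have := mf i measurableT C mC; rewrite setTI.
Qed.

Definition cons_rV n (p : R * 'rV[R]_n) : 'rV[R]_(1 + n) :=
  row_mx (scalar_mx p.1) p.2.

Definition uncons_rV n (x : 'rV[R]_(1 + n)) : R * 'rV[R]_n :=
  (lsubmx x 0 0, rsubmx x).

Lemma cons_rVK n : cancel (@cons_rV n) (@uncons_rV n).
Proof.
by move=> [t v]; rewrite /uncons_rV /cons_rV row_mxKl row_mxKr/= mxE eqxx.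
Qed.

Lemma uncons_rVK n : cancel (@uncons_rV n) (@cons_rV n).
Proof.
move=> x; rewrite /uncons_rV /cons_rV/= -mx11_scalar.
exact: (@hsubmxK _ 1 1 n x).
Qed.

Lemma measurable_cons_rV n : measurable_fun setT (@cons_rV n).
Proof.
apply: measurable_fun_rV => i; rewrite /cons_rV.
case: (@splitP 1 n i) => j ij.
  rewrite (_ : (fun _ => _) = fst); first exact: measurable_fst.
  apply/funext => -[t v]/=.
  have -> : i = lshift n j by apply/val_inj.
  by rewrite row_mxEl mxE !ord1 eqxx.
rewrite (_ : (fun _ => _) = (fun v : 'rV[R]_n => v ord0 j) \o snd).
  apply: measurableT_comp; last exact: measurable_snd.
  exact: measurable_coord.
apply/funext => -[t v]/=.
have -> : i = rshift 1 j by apply/val_inj.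
by rewrite row_mxEr.
Qed.

Lemma measurable_uncons_rV n : measurable_fun setT (@uncons_rV n).
Proof.
apply/measurable_fun_pairP; split.
  rewrite (_ : _ \o _ = fun x : 'rV[R]_n.+1 => x ord0 (lshift n (ord0 : 'I_1))).
    exact: measurable_coord.
  by apply/funext => x/=; rewrite mxE.
apply: measurable_fun_rV => i.
rewrite (_ : (fun _ => _) = fun x : 'rV[R]_n.+1 => x ord0 (rshift 1 i)).
  exact: measurable_coord.
by apply/funext => x/=; rewrite mxE.
Qed.

End rV_measurability.

Lemma sigma_finite_prod d1 d2 (T1 : measurableType d1) (T2 : measurableType d2)
    (R : realType) (m1 : {sigma_finite_measure set T1 -> \bar R})
    (m2 : {sigma_finite_measure set T2 -> \bar R}) :
  sigma_finite setT (m1 \x m2)%E.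
Proof.
have /sigma_finiteP[F [TF ndF Foo]] := sigma_finiteT m1.
have /sigma_finiteP[G [TG ndG Goo]] := sigma_finiteT m2.
exists (fun n => F n `*` G n).
  rewrite -setXTT TF TG predeqE => -[x y]; split.
    move=> [/= [n _ Fnx] [k _ Gky]]; exists (maxn n k) => //; split.
    - by move: x Fnx; exact/subsetPset/ndF/leq_maxl.
    - by move: y Gky; exact/subsetPset/ndG/leq_maxr.
  by move=> [n _ []/= ? ?]; split; exists n.
move=> k; have [? ?] := Foo k; have [? ?] := Goo k.
split; first exact: measurableX.
by rewrite product_measure1E// lte_mul_pinfty// ge0_fin_numE.
Qed.

Section lebesgue_rV.
Context {R : realType}.

Section step.
Context (n : nat) (mu : {sigma_finite_measure set 'rV[R]_n -> \bar R}).

Definition leb_step : set 'rV[R]_n.+1 -> \bar R :=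
  pushforward (@lebesgue_measure R \x mu)%E (@cons_rV R n).

Let leb_step0 : leb_step set0 = 0%E.
Proof. by rewrite /leb_step /pushforward preimage_set0 measure0. Qed.

Let leb_step_ge0 X : (0 <= leb_step X)%E.
Proof. by rewrite /leb_step /pushforward; exact: measure_ge0. Qed.

Let leb_step_semi_sigma_additive : semi_sigma_additive leb_step.
Proof.
move=> F mF tF mUF; rewrite /leb_step /pushforward preimage_bigcup.
apply: measure_semi_sigma_additive.
- by move=> i; rewrite -[X in measurable X]setTI; exact: measurable_cons_rV.
- apply/classical_sets.trivIsetP => i j _ _ ij; rewrite -preimage_setI.
  by move/classical_sets.trivIsetP : tF => /(_ i j I I ij) ->; rewrite preimage_set0.
- rewrite -preimage_bigcup -[X in measurable X]setTI.
  exact: measurable_cons_rV.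
Qed.

HB.instance Definition _ := isMeasure.Build _ _ _ leb_step
  leb_step0 leb_step_ge0 leb_step_semi_sigma_additive.

Let leb_step_sigma_finite : sigma_finite setT leb_step.
Proof.
have [F FT Foo] := sigma_finite_prod (@lebesgue_measure R) mu.
exists (fun k => @uncons_rV R n @^-1` F k).
  by rewrite -preimage_bigcup -FT preimage_setT.
move=> k; have [mF Fk] := Foo k; split.
  by rewrite -[X in measurable X]setTI; exact: measurable_uncons_rV.
rewrite /leb_step /pushforward -comp_preimage.
rewrite (_ : _ \o _ = id); first exact: Fk.
by apply/funext => p /=; rewrite cons_rVK.
Qed.

HB.instance Definition _ := Measure_isSigmaFinite.Build _ _ _ leb_step
  leb_step_sigma_finite.

End step.

Fixpoint leb n : {sigma_finite_measure set 'rV[R]_n -> \bar R} :=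
  match n with
  | 0%N => [the {sigma_finite_measure set _ -> \bar R} of \d_ (0 : 'rV[R]_0)]
  | n'.+1 => [the {sigma_finite_measure set _ -> \bar R} of leb_step (leb n')]
  end.

End lebesgue_rV.

(* Elements of function spaces are represented by functions on the whole of
  'rV[R]_n; their values outside the domain [D] play no role, and equality
  in a function space is equality almost everywhere on [D]. *)

Section sobolev.
Context {R : realType}.

Definition dotv n (u v : 'rV[R]_n) : R := (u *m v^T) 0 0.

Definition basis_vec n (i : 'I_n) : 'rV[R]_n := delta_mx 0 i.

Definition ae_eq_on n (D : set 'rV[R]_n) (f g : 'rV[R]_n -> R) : Prop :=
  {ae leb n, forall x, D x -> f x = g x}.

Fixpoint differentiable_upto k n (f : 'rV[R]_n -> R) : Prop :=
  continuous f /\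
  if k is k'.+1 then
    forall v, (forall x, derivable f x v) /\
              differentiable_upto k' (fun x => 'D_v f x)
  else True.

Definition smooth n (f : 'rV[R]_n -> R) : Prop :=
  forall k, differentiable_upto k f.

(* C_c^oo(U) *)
Definition test_function n (U : set 'rV[R]_n) (f : 'rV[R]_n -> R) : Prop :=
  smooth f /\
  exists K, [/\ compact K, K `<=` U & forall x, ~ K x -> f x = 0].

Variable n : nat.
Implicit Types (D U : set 'rV[R]_n) (w f : 'rV[R]_n -> R)
  (omega : 'rV[R]_n -> R) (G : 'rV[R]_n -> 'rV[R]_n).

(* L^2(omega, D), the L^2 space on D of the measure omega(x) dx *)
Definition weighted_L2 omega D f : Prop :=
  measurable_fun D f /\
  (\int[leb n]_(x in D) (omega x * f x ^+ 2)%:E < +oo)%E.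

Definition weak_gradient omega D w G : Prop :=
  forall i, weighted_L2 omega D (fun x => G x 0 i) /\
    forall f, test_function D f ->
      \int[leb n]_(x in D) (w x * 'D_(basis_vec i) f x) =
      - \int[leb n]_(x in D) (G x 0 i * f x).

Definition weighted_H1 omega D w : Prop :=
  weighted_L2 omega D w /\ exists G, weak_gradient omega D w G.

Definition grad omega D w : 'rV[R]_n -> 'rV[R]_n :=
  xget (cst 0) [set G | weak_gradient omega D w G].

(* The closure in the norm of H^1(omega, D) of the restrictions to D of
   C_c^oo(U). With U = D this is the usual H^1_0; if U is a larger open set,
   the functions vanish on the part of the boundary of D that is outside U and
   are free on the part that is inside U. *)
Definition weighted_H1_0 omega D U w : Prop :=
  weighted_H1 omega D w /\
  exists f_ : nat -> 'rV[R]_n -> R,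
    [/\ forall k, test_function U (f_ k),
        (fun k => \int[leb n]_(x in D) (omega x * (f_ k x - w x) ^+ 2)%:E)%E
          @ \oo --> 0%E
      & forall i,
        (fun k => \int[leb n]_(x in D) (omega x *
            ('D_(basis_vec i) (f_ k) x - grad omega D w x 0 i) ^+ 2)%:E)%E
          @ \oo --> 0%E].

Definition grad_norm omega D w : R :=
  Num.sqrt (\int[leb n]_(x in D)
    (omega x * dotv (grad omega D w x) (grad omega D w x))).

Definition Linf_enorm D f : \bar R :=
  Lnorm (leb n) +oo%E (fun x => (\1_D x * f x)%:E).

Definition Linf_norm D f : R := fine (Linf_enorm D f).

Definition Linf D f : Prop := measurable_fun D f /\ (Linf_enorm D f < +oo)%E.

End sobolev.

Definition Gamma {R : realType} (z : R) : R :=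
  \int[lebesgue_measure]_(t in `]0, +oo[) (t `^ (z - 1) * expR (- t)).

Section problem.
Context {R : realType} (d : nat).
Implicit Types (Omega : set 'rV[R]_d) (A : 'rV[R]_d -> 'M[R]_d)
  (q v w : 'rV[R]_d -> R).

Definition convex_polytope Omega : Prop :=
  [/\ Omega !=set0, bounded_set Omega &
      exists N (a : 'I_N -> 'rV[R]_d) (b : 'I_N -> R),
        Omega = [set x | forall i, dotv (a i) x < b i]].

Definition diffusion_coefficient Omega A : Prop :=
  [/\ [lipschitz A x | x in Omega],
      forall x, Omega x -> A x \in unitmx /\ (A x)^T = A x &
      exists2 a0 : R, 0 < a0 & forall x (xi : 'rV[R]_d), Omega x ->
        a0 * dotv xi xi <= dotv (xi *m (A x)^T) xi].

Definition admissible Omega (qbar : R) q : Prop :=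
  Linf Omega q /\ {ae leb d, forall x, Omega x -> 0 <= q x <= qbar}.

Definition H10 Omega : ('rV[R]_d -> R) -> Prop :=
  weighted_H1_0 (cst 1) Omega Omega.

Definition L2dot Omega v w : R := \int[leb d]_(x in Omega) (v x * w x).

Definition form_L Omega A q v w : R :=
  \int[leb d]_(x in Omega)
    (dotv (grad (cst 1) Omega v x *m (A x)^T) (grad (cst 1) Omega w x)
     + q x * v x * w x).

Definition eigensystem Omega A q (lam : nat -> R)
    (phi : nat -> 'rV[R]_d -> R) : Prop :=
  [/\ forall k, H10 Omega (phi k),
      forall j k, L2dot Omega (phi j) (phi k) = (j == k)%:R,
      forall k v, H10 Omega v ->
        form_L Omega A q (phi k) v = lam k * L2dot Omega (phi k) v &
      forall v, weighted_L2 (cst 1) Omega v ->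
        (forall k, L2dot Omega v (phi k) = 0) -> ae_eq_on Omega v (cst 0)].

Section spectral_space.
Variables (Omega : set 'rV[R]_d) (lam : nat -> R) (phi : nat -> 'rV[R]_d -> R).
Variable r : R.

Definition spectral_sum w : \bar R :=
  (\sum_(0 <= k <oo) (lam k `^ r * L2dot Omega w (phi k) ^+ 2)%:E)%E.

Definition Hr w : Prop :=
  weighted_L2 (cst 1) Omega w /\ (spectral_sum w < +oo)%E.

Definition Hr_norm w : R := Num.sqrt (fine (spectral_sum w)).

(* H^{-r}(Omega): the bounded linear functionals on H^r(Omega). *)
Definition Hr_dual (f : ('rV[R]_d -> R) -> R) : Prop :=
  (forall (a : R) v w, Hr v -> Hr w ->
     f (fun x => a * v x + w x) = a * f v + f w) /\
  exists M : R, forall w, Hr w -> `|f w| <= M * Hr_norm w.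

Definition Hr_dual_norm (f : ('rV[R]_d -> R) -> R) : R :=
  sup [set `|f w| | w in [set w | Hr w /\ Hr_norm w <= 1]].

End spectral_space.

(* H^r(Omega), 0 <= r <= 1, does not depend on the potential, and its norms for
   different potentials are equivalent with uniform constants. *)
Definition uniformly_equivalent_Hr Omega (qbar : R)
    (lam : ('rV[R]_d -> R) -> nat -> R)
    (phi : ('rV[R]_d -> R) -> nat -> 'rV[R]_d -> R) : Prop :=
  forall r : R, 0 <= r <= 1 -> exists M : R, forall q q',
    admissible Omega qbar q -> admissible Omega qbar q' ->
    forall w, Hr Omega (lam q) (phi q) r w ->
      Hr Omega (lam q') (phi q') r w /\
      Hr_norm Omega (lam q') (phi q') r w <=
        M * Hr_norm Omega (lam q) (phi q) r w.

(* A point x = (x', y) of R^d x R is a row vector of size d + 1. *)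
Definition xpart (x : 'rV[R]_(d + 1)) : 'rV[R]_d := lsubmx x.
Definition ypart (x : 'rV[R]_(d + 1)) : R := rsubmx x 0 0.

Definition cylinder Omega : set 'rV[R]_(d + 1) :=
  [set x | Omega (xpart x) /\ 0 < ypart x].

Definition full_cylinder Omega : set 'rV[R]_(d + 1) :=
  [set x | Omega (xpart x)].

Definition yweight (s : R) (x : 'rV[R]_(d + 1)) : R := ypart x `^ (1 - 2 * s).

(* The functions of C_c^oo(Omega x R) vanish near the lateral boundary of the
   cylinder, and are arbitrary at y = 0. *)
Definition HL Omega (s : R) : ('rV[R]_(d + 1) -> R) -> Prop :=
  weighted_H1_0 (yweight s) (cylinder Omega) (full_cylinder Omega).

Definition HL_grad Omega (s : R) :
    ('rV[R]_(d + 1) -> R) -> 'rV[R]_(d + 1) -> 'rV[R]_(d + 1) :=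
  grad (yweight s) (cylinder Omega).

Definition HL_norm Omega (s : R) : ('rV[R]_(d + 1) -> R) -> R :=
  grad_norm (yweight s) (cylinder Omega).

Definition form_C Omega A (s : R) q (w v : 'rV[R]_(d + 1) -> R) : R :=
  \int[leb (d + 1)]_(x in cylinder Omega)
    (yweight s x *
      (dotv (HL_grad Omega s w x *m (block_mx (A (xpart x)) 0 0 1%:M)^T)
            (HL_grad Omega s v x)
       + q (xpart x) * w x * v x)).

(* tr is the bounded linear operator from HL to H^s(Omega) that is the
   restriction to y = 0 on smooth functions; these are dense in HL. *)
Definition trace_operator Omega (qbar s : R)
    (lam : ('rV[R]_d -> R) -> nat -> R)
    (phi : ('rV[R]_d -> R) -> nat -> 'rV[R]_d -> R)
    (tr : ('rV[R]_(d + 1) -> R) -> 'rV[R]_d -> R) : Prop :=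
  [/\ forall (a : R) (w v : 'rV[R]_(d + 1) -> R), HL Omega s w -> HL Omega s v ->
        ae_eq_on Omega (tr (fun x => a * w x + v x))
                       (fun x' => a * tr w x' + tr v x'),
      forall q, admissible Omega qbar q ->
        exists M : R, forall w : 'rV[R]_(d + 1) -> R, HL Omega s w ->
          Hr Omega (lam q) (phi q) s (tr w) /\
          Hr_norm Omega (lam q) (phi q) s (tr w) <= M * HL_norm Omega s w &
      forall w : 'rV[R]_(d + 1) -> R, test_function (full_cylinder Omega) w ->
        ae_eq_on Omega (tr w) (fun x' => w (row_mx x' 0))].

Definition d_const (s : R) : R := 2 `^ (1 - 2 * s) * Gamma (1 - s) / Gamma s.

Definition solution_map Omega A (qbar s : R)
    (tr : ('rV[R]_(d + 1) -> R) -> 'rV[R]_d -> R)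
    (f : ('rV[R]_d -> R) -> R)
    (E : ('rV[R]_d -> R) -> 'rV[R]_(d + 1) -> R) : Prop :=
  forall q, admissible Omega qbar q ->
    HL Omega s (E q) /\
    forall v : 'rV[R]_(d + 1) -> R, HL Omega s v ->
      form_C Omega A s q (E q) v = d_const s * f (tr v).

Definition set_nth_dir m (h : 'I_m -> 'rV[R]_d -> R) (i : 'I_m) v :
    'I_m -> 'rV[R]_d -> R :=
  fun j => if j == i then v else h j.

Definition cons_dir m h0 (h : 'I_m -> 'rV[R]_d -> R) :
    'I_m.+1 -> 'rV[R]_d -> R :=
  fun i => if unlift ord0 i is Some j then h j else h0.

Definition drop_dir m (h : 'I_m -> 'rV[R]_d -> R) (i : 'I_m) :
    'I_m.-1 -> 'rV[R]_d -> R :=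
  fun j => h (lift i j).

Definition bounded_multilinear Omega (s : R) m
    (T : ('I_m -> 'rV[R]_d -> R) -> 'rV[R]_(d + 1) -> R) : Prop :=
  [/\ forall h, (forall i, Linf Omega (h i)) -> HL Omega s (T h),
      forall h i (a : R) v w, (forall j, Linf Omega (h j)) ->
        Linf Omega v -> Linf Omega w ->
        ae_eq_on (cylinder Omega)
          (T (set_nth_dir h i (fun x => a * v x + w x)))
          (fun x => a * T (set_nth_dir h i v) x + T (set_nth_dir h i w) x) &
      exists M : R, forall h, (forall i, Linf Omega (h i)) ->
        HL_norm Omega s (T h) <= M * \prod_(i < m) Linf_norm Omega (h i)].

(* D m is the m-th Fréchet derivative of E on the set of admissible potentials
   for every m; D m.+1 q (h, h_1, ..., h_m) is the derivative of D m at q in the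
   direction h, applied to (h_1, ..., h_m). The operator norm on multilinear
   maps is spelled out. *)
Definition frechet_derivatives Omega (qbar s : R)
    (E : ('rV[R]_d -> R) -> 'rV[R]_(d + 1) -> R)
    (D : forall m, ('rV[R]_d -> R) -> ('I_m -> 'rV[R]_d -> R) ->
         'rV[R]_(d + 1) -> R) : Prop :=
  [/\ forall q h, admissible Omega qbar q ->
        ae_eq_on (cylinder Omega) (D 0%N q h) (E q),
      forall m q, admissible Omega qbar q ->
        bounded_multilinear Omega s (D m q) &
      forall m q, admissible Omega qbar q ->
        forall e : R, 0 < e -> exists2 delta : R, 0 < delta &
        forall h, Linf Omega h -> admissible Omega qbar (q \+ h) ->
          Linf_norm Omega h <= delta ->
        forall k : 'I_m -> 'rV[R]_d -> R, (forall i, Linf Omega (k i)) ->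
          HL_norm Omega s (fun x => D m (q \+ h) k x - D m q k x
                                    - D m.+1 q (cons_dir h k) x)
          <= e * Linf_norm Omega h * \prod_(i < m) Linf_norm Omega (k i)].

Definition derivative_equation Omega A (s : R) m q
    (D' : ('I_m.-1 -> 'rV[R]_d -> R) -> 'rV[R]_(d + 1) -> R)
    (h : 'I_m -> 'rV[R]_d -> R) (psi : 'rV[R]_(d + 1) -> R) : Prop :=
  forall v : 'rV[R]_(d + 1) -> R, HL Omega s v ->
    form_C Omega A s q psi v =
    - \sum_(i < m) \int[leb (d + 1)]_(x in cylinder Omega)
        (yweight s x * h i (xpart x) * D' (drop_dir h i) x * v x).

End problem.

(* Main.v *)
Require Import Defs.
From mathcomp Require Import all_boot all_order all_algebra.
From mathcomp Require Import all_classical all_reals all_analysis.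
From mathcomp Require Import measurable_realfun ess_sup_inf ring lra.

Set Implicit Arguments.
Unset Strict Implicit.
Unset Printing Implicit Defensive.
Import Order.TTheory GRing.Theory Num.Theory.
Import numFieldNormedType.Exports.
Local Open Scope classical_set_scope.
Local Open Scope ring_scope.

(** The form a_C(q) is the sum of a principal part, coercive uniformly in q by
    ellipticity of A, and of a potential part b(q; w, v), nonnegative for q >= 0,
    linear in q, and bounded by a multiple of the norms of q, w and v thanks to
    Poincare's inequality in the first coordinate, along which y^alpha is constant.
    Riesz' theorem therefore defines E_{m+1}(q)(h) as the solution with right-hand
    side - sum_i b(h_i; E_m(q)(h without h_i), .). Subtracting the equations at q
    and at q + h gives, by induction on m, first
    E_m(q + h) - E_m(q) = O(|h|) and then
    E_m(q + h) - E_m(q) - E_{m+1}(q)(h, .) = O(|h|^2), so the E_m are derivatives.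
    Increments are confined to q + h in Q, so a derivative at q is at first only
    determined in the directions pointing from q into Q; these span L^oo, hence
    every family of derivatives agrees with the E_m. The constants do not depend on
    q0 because |f o tr| is estimated through the trace bound at the single potential
    q = 0 and the uniform equivalence of the norms of H^s. *)

(** Members of the function spaces are plain functions and [grad] is picked by a choice operator, so
    nothing about gradients is linear on the nose: linearity holds almost everywhere, and only
    because weak gradients are unique. Uniqueness is the fundamental lemma of the calculus of
    variations, which is why smooth bump functions and a Dynkin argument on boxes come before any
    Sobolev space. The weight [y^alpha] may vanish or blow up at [y = 0]; local arguments use only
    that it is bounded below on compact subsets of the cylinder, so that [f / y^alpha] lies in the
    weighted L^2 space for every test function [f]. Differentiation is carried out over abstract
    spaces in which equality almost everywhere means that the energy norm of the difference
    vanishes, an identification that rests on Poincare's inequality. The constant obtained is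
    [m! Cb^m / c^(m+1)] times a bound for the functional [v |-> d_s f(tr v)], with [Cb = (2 M)^2]
    from two uses of Poincare's inequality and [c] from ellipticity. *)

(** * Riesz representation for symmetric nonnegative forms *)

Section riesz.
Context {R : realType} (T : Type).
Variables (H : (T -> R) -> Prop) (B : (T -> R) -> (T -> R) -> R).
Hypotheses (H0 : H (fun=> 0))
  (Hlin : forall a w v, H w -> H v -> H (fun x => a * w x + v x))
  (Blin : forall a w v z, H w -> H v -> H z ->
    B (fun x => a * w x + v x) z = a * B w z + B v z)
  (Bsym : forall w v, H w -> H v -> B w v = B v w)
  (Bpos : forall w, H w -> 0 <= B w w).
Implicit Types w v : T -> R.

Lemma form_comb_sq a w v : H w -> H v ->
  B (fun x => a * w x + v x) (fun x => a * w x + v x) =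
  a ^+ 2 * B w w + 2 * a * B w v + B v v.
Proof.
move=> hw hv; have h := Hlin a hw hv.
rewrite Blin// (Bsym hw h) (Bsym hv h) !Blin// (Bsym hv hw); ring.
Qed.

Lemma form_CS w v : H w -> H v -> B w v ^+ 2 <= B w w * B v v.
Proof.
move=> hw hv.
have key t : 0 <= t ^+ 2 * B w w + 2 * t * B w v + B v v.
  by rewrite -form_comb_sq//; apply: Bpos; exact: Hlin.
have ww := Bpos hw; have vv := Bpos hv.
have [w0|w0] := eqVneq (B w w) 0.
  rewrite w0 mul0r; have [->|wv0] := eqVneq (B w v) 0; first by rewrite expr0n.
  (* With [B w w = 0] the expression in [key] is affine in [t]; at this [t] it equals -1. *)
  have := key (- (B v v + 1) / (2 * B w v)); rewrite w0.
  have -> : 2 * (- (B v v + 1) / (2 * B w v)) * B w v = - (B v v + 1) by field.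
  by rewrite mulr0; lra.
have wp : 0 < B w w by rewrite lt_def w0 ww.
have := key (- B w v / B w w).
have -> : (- B w v / B w w) ^+ 2 * B w w + 2 * (- B w v / B w w) * B w v + B v v =
  B v v - B w v ^+ 2 / B w w by field.
by rewrite subr_ge0 ler_pdivrMr// mulrC.
Qed.

Lemma form_CS_sqrt w v : H w -> H v ->
  `|B w v| <= Num.sqrt (B w w) * Num.sqrt (B v v).
Proof.
move=> hw hv; rewrite -sqrtrM ?Bpos// -sqrtr_sqr ler_wsqrtr//.
exact: form_CS.
Qed.

Lemma form_triangle a w v : H w -> H v ->
  Num.sqrt (B (fun x => a * w x + v x) (fun x => a * w x + v x)) <=
  `|a| * Num.sqrt (B w w) + Num.sqrt (B v v).
Proof.
move=> hw hv; have cs := form_CS_sqrt hw hv.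
rewrite -(@ler_pXn2r _ 2)// ?nnegrE ?addr_ge0 ?mulr_ge0 ?sqrtr_ge0//.
rewrite sqr_sqrtr; last by apply: Bpos; exact: Hlin.
rewrite form_comb_sq// sqrrD exprMn !sqr_sqrtr ?Bpos//.
have h : a * B w v <= `|a| * (Num.sqrt (B w w) * Num.sqrt (B v v)).
  by rewrite (le_trans (ler_norm _))// normrM ler_wpM2l.
by rewrite real_normK ?num_real// -mulr_natr; lra.
Qed.

Variable L : (T -> R) -> R.
Hypotheses (Llin : forall a w v, H w -> H v ->
    L (fun x => a * w x + v x) = a * L w + L v)
  (Lbd : exists C : R, forall v, H v -> `|L v| <= C * Num.sqrt (B v v)).
Hypothesis complete : forall w_ : nat -> T -> R, (forall k, H (w_ k)) ->
  (forall e : R, 0 < e -> exists N, forall j k, (N <= j)%N -> (N <= k)%N ->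
    B (fun x => w_ j x - w_ k x) (fun x => w_ j x - w_ k x) <= e) ->
  exists w, H w /\ forall e : R, 0 < e -> exists N, forall k, (N <= k)%N ->
    B (fun x => w_ k x - w x) (fun x => w_ k x - w x) <= e.

Let Hsub w v : H w -> H v -> H (fun x => w x - v x).
Proof.
move=> hw hv; rewrite (_ : (fun x => _) = fun x => -1 * v x + w x); first exact: Hlin.
by apply/funext => x; ring.
Qed.

Let BsubE w v : H w -> H v -> B (fun x => w x - v x) (fun x => w x - v x) =
  B w w - 2 * B w v + B v v.
Proof.
move=> hw hv; rewrite (_ : (fun x => _) = fun x => -1 * v x + w x).
  by rewrite form_comb_sq// (Bsym hv hw); ring.
by apply/funext => x; ring.
Qed.

(* The solution minimizes [v |-> B v v - 2 L v]; the parallelogram identity makes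
   minimizing sequences Cauchy. *)
Lemma riesz_representation : exists u, H u /\ forall v, H v -> B u v = L v.
Proof.
have [C Cb] := Lbd.
pose J v := B v v - 2 * L v.
have Jge v : H v -> - C ^+ 2 <= J v.
  move=> hv; have := Cb v hv; rewrite ler_norml => /andP[_ Lv].
  have := sqr_ge0 (Num.sqrt (B v v) - C); rewrite sqrrB sqr_sqrtr ?Bpos//.
  by rewrite -mulr_natr /J; lra.
pose S := [set J v | v in H].
have hS : has_inf S.
  split; first by exists (J (fun=> 0)); exists (fun=> 0).
  by exists (- C ^+ 2) => _ [v hv <-]; exact: Jge.
pose m := inf S.
have mJ v : H v -> m <= J v by move=> hv; apply: ge_inf; [case: hS|exists v].
have /choice[v_ vP] : forall k : nat, exists v, H v /\ J v <= m + k.+1%:R^-1.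
  move=> k; have k0 : 0 < k.+1%:R^-1 :> R by rewrite invr_gt0.
  have [_ [v hv <-] lt] := inf_adherent k0 hS.
  by exists v; split=> //; exact: ltW.
have hv_ k : H (v_ k) by case: (vP k).
have vm k : J (v_ k) <= m + k.+1%:R^-1 by case: (vP k).
have par v w : H v -> H w -> B (fun x => v x - w x) (fun x => v x - w x) <=
    2 * (J v - m) + 2 * (J w - m).
  move=> hv hw; have hm : H (fun x => 2^-1 * (v x + w x)).
    rewrite (_ : (fun x => _) = fun x => 2^-1 * v x + (2^-1 * w x + 0)).
      by apply: (Hlin _ hv); exact: (Hlin _ hw).
    by apply/funext => x; ring.
  have := mJ _ hm; rewrite BsubE//.
  have -> : J (fun x => 2^-1 * (v x + w x)) =
      4^-1 * (B v v + 2 * B v w + B w w) - (L v + L w).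
    have -> : (fun x => 2^-1 * (v x + w x)) = (fun x => 2^-1 * v x + (2^-1 * w x + 0)).
      by apply/funext => x; ring.
    have L0 : L (fun=> 0) = 0.
      have := @Llin 1 _ _ H0 H0; under eq_fun do rewrite mulr0 addr0.
      by lra.
    have hw2 : H (fun x => 2^-1 * w x + 0) by exact: Hlin.
    have B0 z : H z -> B (fun=> 0) z = 0.
      move=> hz; have := @Blin 1 _ _ _ H0 H0 hz; under eq_fun do rewrite mulr0 addr0.
      by lra.
    rewrite /J form_comb_sq// (Bsym hv hw2) Blin// form_comb_sq// !Llin//.
    by rewrite L0 (Bsym hw H0) !B0// (Bsym hw hv); field.
  by rewrite /J; lra.
have inv_small (e : R) : 0 < e -> exists N : nat, forall k, (N <= k)%N -> k.+1%:R^-1 <= e.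
  move=> e0; exists (Num.truncn e^-1) => k ek.
  rewrite -[leRHS]invrK lef_pV2 ?posrE ?invr_gt0//.
  by apply: ltW; apply: lt_le_trans (truncnS_gt _) _; rewrite ler_nat ltnS.
have [u [hu cvu]] : exists w, H w /\ forall e : R, 0 < e -> exists N, forall k,
    (N <= k)%N -> B (fun x => v_ k x - w x) (fun x => v_ k x - w x) <= e.
  apply: complete => // e e0; have [N NP] := inv_small (e / 4) (divr_gt0 e0 (ltr0Sn _ 3)).
  exists N => j k Nj Nk; apply: le_trans (par _ _ (hv_ j) (hv_ k)) _.
  have := vm j; have := vm k; have := NP j Nj; have := NP k Nk.
  by set x := _^-1; set y := j.+1%:R^-1; lra.
exists u; split=> // v hv.
(* The limit [u] is never shown to minimize [J]. Instead [J (v_ k) - 1/(k+1) <= m <= J (t v + v_ k)]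
   is expanded for a large [k], and [B (v_ k) v] is replaced by [B u v] up to [e / 2]. The summand 1
   in [c] keeps the division legitimate when [t] or the seminorm of [v] is 0. *)
have key t (e : R) : 0 < e -> 0 <= t ^+ 2 * B v v + 2 * t * (B u v - L v) + e.
  move=> e0; pose c := 2 * `|t| * Num.sqrt (B v v) + 1.
  have c0 : 0 < c by rewrite ltr_wpDl// !mulr_ge0// sqrtr_ge0.
  have [N NP] := inv_small (e / 2) (divr_gt0 e0 (ltr0Sn _ 1)).
  have d0 : 0 < (e / 2 / c) ^+ 2 by rewrite exprn_gt0// !divr_gt0.
  have [M MP] := cvu _ d0.
  pose k := maxn N M.
  have kN := NP k (leq_maxl _ _); have kM := MP k (leq_maxr _ _).
  have hvu := Hsub (hv_ k) hu.
  have cs := form_CS_sqrt hvu hv.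
  have s1 : Num.sqrt (B (fun x => v_ k x - u x) (fun x => v_ k x - u x)) <= e / 2 / c.
    by rewrite -(ger0_norm (ltW (divr_gt0 (divr_gt0 e0 (ltr0Sn _ 1)) c0))) -sqrtr_sqr ler_wsqrtr.
  have bd : `|2 * t * B (fun x => v_ k x - u x) v| <= e / 2.
    rewrite normrM; apply: (@le_trans _ _ (`|2 * t| * (e / 2 / c * Num.sqrt (B v v)))).
      by apply: ler_wpM2l => //; apply: le_trans cs _; rewrite ler_wpM2r ?sqrtr_ge0.
    rewrite normrM (ger0_norm (ler0n _ 2)).
    have -> : 2 * `|t| * (e / 2 / c * Num.sqrt (B v v)) =
        e / 2 * (2 * `|t| * Num.sqrt (B v v) / c) by field; rewrite gt_eqF.
    apply: ler_piMr; first by rewrite divr_ge0// ltW.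
    by rewrite ler_pdivrMr// mul1r /c lerDl.
  have := mJ _ (Hlin t hv (hv_ k)); rewrite /J form_comb_sq// Llin//.
  have := vm k; rewrite /J (Bsym hv (hv_ k)).
  have e1 : B (v_ k) v = B (fun x => v_ k x - u x) v + B u v.
    have -> : B (v_ k) v = B (fun x => 1 * (v_ k x - u x) + u x) v.
      by congr (B _ _); apply/funext => x; ring.
    by rewrite Blin// mul1r.
  rewrite e1; move: bd; rewrite ler_norml => /andP[_].
  move: kN; set r := _^-1; set b := B (fun x => v_ k x - u x) v; lra.
apply/eqP; rewrite -subr_eq0; apply/eqP.
set z := B u v - L v in key *.
have key2 t : 0 <= t ^+ 2 * B v v + 2 * t * z.
  by apply/ler_addgt0Pr => e e0; exact: key.
have [b0|b0] := eqVneq (B v v) 0.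
  have := key2 (- z); rewrite b0 mulr0 add0r mulrN mulNr oppr_ge0 -mulrA => h.
  by have := sqr_ge0 z => h2; apply/eqP; rewrite -sqrf_eq0; apply/eqP; move: h h2; rewrite -expr2; lra.
have bp : 0 < B v v by rewrite lt_def b0 Bpos.
have := key2 (- z / B v v).
have -> : (- z / B v v) ^+ 2 * B v v + 2 * (- z / B v v) * z = - (z ^+ 2 / B v v).
  by field.
rewrite oppr_ge0 pmulr_lle0 ?invr_gt0// => h; apply/eqP; rewrite -sqrf_eq0.
by rewrite eq_le h sqr_ge0.
Qed.

End riesz.

(** * Weighted L^2 spaces *)

Section wL2.
Context d (T : measurableType d) (R : realType).
Variables (mu : {measure set T -> \bar R}) (D : set T) (om : T -> R).
Hypotheses (mD : measurable D) (mom : measurable_fun D om)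
  (om_gt0 : forall x, D x -> 0 < om x).
Implicit Types f g h : T -> R.

(* Over [leb n] this is convertible to [weighted_L2 om D]. *)
Definition wL2 f : Prop :=
  measurable_fun D f /\ (\int[mu]_(x in D) (om x * f x ^+ 2)%:E < +oo)%E.

Definition ip f g : R := \int[mu]_(x in D) (om x * (f x * g x)).

Definition nrm f : R := Num.sqrt (ip f f).

Let om_ge0 x : D x -> 0 <= om x. Proof. by move/om_gt0/ltW. Qed.

Lemma measurable_wM f g : measurable_fun D f -> measurable_fun D g ->
  measurable_fun D (fun x => (om x * (f x * g x))%:E).
Proof.
move=> mf mg; apply/measurable_EFinP; apply: measurable_funM => //.
exact: measurable_funM.
Qed.

Lemma measurable_wX2 f : measurable_fun D f ->
  measurable_fun D (fun x => (om x * f x ^+ 2)%:E).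
Proof. by move=> mf; under eq_fun do rewrite expr2; exact: measurable_wM. Qed.

Lemma wL2_sq_integrable f : wL2 f ->
  mu.-integrable D (fun x => (om x * f x ^+ 2)%:E).
Proof.
move=> [mf foo]; apply/integrableP; split; first exact: measurable_wX2.
rewrite (eq_integral (fun x => (om x * f x ^+ 2)%:E))// => x /[!inE] Dx.
by rewrite gee0_abs// lee_fin mulr_ge0 ?sqr_ge0// om_ge0.
Qed.

Lemma ip_integrable f g : wL2 f -> wL2 g ->
  mu.-integrable D (EFin \o (fun x => om x * (f x * g x))).
Proof.
move=> Lf Lg.
have := integrableD mD (wL2_sq_integrable Lf) (wL2_sq_integrable Lg).
apply: le_integrable => //; first by apply: measurable_wM; [case: Lf|case: Lg].
move=> x Dx /=; rewrite lee_fin normrM ger0_norm ?om_ge0//.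
rewrite [leRHS]ger0_norm; last first.
  by rewrite addr_ge0// mulr_ge0 ?sqr_ge0// om_ge0.
rewrite -mulrDr ler_wpM2l ?om_ge0// ler_norml; apply/andP; split.
  have := sqr_ge0 (f x + g x); have := sqr_ge0 (f x); have := sqr_ge0 (g x).
  by rewrite sqrrD -mulr_natr; lra.
have := sqr_ge0 (f x - g x); have := sqr_ge0 (f x); have := sqr_ge0 (g x).
by rewrite sqrrB -mulr_natr; lra.
Qed.

Lemma wL2_lin (a : R) f g : wL2 f -> wL2 g -> wL2 (fun x => a * f x + g x).
Proof.
move=> Lf Lg; split.
  by apply: measurable_funD; [apply: measurable_funM => //; case: Lf|case: Lg].
have If := wL2_sq_integrable Lf; have Ig := wL2_sq_integrable Lg.
have Ifg := ip_integrable Lf Lg.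
have := integrableD mD (integrableD mD (integrableZl mD (a ^+ 2) If) Ig)
  (integrableZl mD (a *+ 2) Ifg).
move=> /(integrable_lty mD); apply: le_lt_trans.
rewrite le_eqVlt; apply/orP; left; apply/eqP; apply: eq_integral => x _ /=.
by rewrite -!EFinM -!EFinD; congr EFin; rewrite -mulr_natr; ring.
Qed.

Lemma wL2_0 : wL2 (fun=> 0).
Proof.
split=> //; under eq_integral do rewrite expr0n mulr0.
by rewrite integral0.
Qed.

Lemma wL2Z (a : R) f : wL2 f -> wL2 (fun x => a * f x).
Proof.
move=> Lf; have := wL2_lin a Lf wL2_0.
by under eq_fun do rewrite addr0.
Qed.

Lemma wL2D f g : wL2 f -> wL2 g -> wL2 (fun x => f x + g x).
Proof.
move=> Lf Lg; have := wL2_lin 1 Lf Lg.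
by under eq_fun do rewrite mul1r.
Qed.

Lemma wL2B f g : wL2 f -> wL2 g -> wL2 (fun x => f x - g x).
Proof.
move=> Lf Lg; have := wL2_lin (-1) Lg Lf.
by under eq_fun do rewrite mulN1r addrC.
Qed.

Lemma wL2_sum n (F : 'I_n -> T -> R) : (forall i, wL2 (F i)) ->
  wL2 (fun x => \sum_(i < n) F i x).
Proof.
elim: n F => [|n IH] F LF.
  by under eq_fun do rewrite big_ord0; exact: wL2_0.
by under eq_fun do rewrite big_ord_recl; apply: wL2D => //; exact: IH.
Qed.

Lemma ip_lin (a : R) f g h : wL2 f -> wL2 g -> wL2 h ->
  ip (fun x => a * f x + g x) h = a * ip f h + ip g h.
Proof.
move=> Lf Lg Lh; rewrite /ip.
rewrite -RintegralZl//; last exact: ip_integrable.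
rewrite -RintegralD//; [| |exact: ip_integrable].
  by apply: eq_Rintegral => x _; ring.
by have := integrableZl mD a (ip_integrable Lf Lh).
Qed.

Lemma ipC f g : ip f g = ip g f.
Proof. by apply: eq_Rintegral => x _; rewrite [f x * _]mulrC. Qed.

Lemma ip0l g : ip (fun=> 0) g = 0.
Proof.
rewrite /ip /Rintegral; under eq_integral do rewrite mul0r mulr0.
by rewrite integral0.
Qed.

Lemma ipZl (a : R) f h : wL2 f -> wL2 h ->
  ip (fun x => a * f x) h = a * ip f h.
Proof.
move=> Lf Lh; have := ip_lin a Lf wL2_0 Lh.
by under eq_fun do rewrite addr0; rewrite ip0l addr0.
Qed.

Lemma ipBl f g h : wL2 f -> wL2 g -> wL2 h ->
  ip (fun x => f x - g x) h = ip f h - ip g h.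
Proof.
move=> Lf Lg Lh; have := ip_lin (-1) Lg Lf Lh.
by under eq_fun do rewrite mulN1r addrC; rewrite mulN1r addrC.
Qed.

Lemma ip_ge0 f : 0 <= ip f f.
Proof. by apply: Rintegral_ge0 => x Dx; rewrite mulr_ge0 ?om_ge0// -expr2 sqr_ge0. Qed.

Lemma nrm_ge0 f : 0 <= nrm f. Proof. exact: sqrtr_ge0. Qed.

Lemma sqr_nrm f : nrm f ^+ 2 = ip f f.
Proof. by rewrite sqr_sqrtr// ip_ge0. Qed.

Lemma ip_CS f g : wL2 f -> wL2 g -> `|ip f g| <= nrm f * nrm g.
Proof.
exact: (form_CS_sqrt wL2_lin ip_lin (fun f g _ _ => ipC f g) (fun f _ => ip_ge0 f)).
Qed.

Lemma nrm_D f g : wL2 f -> wL2 g -> nrm (fun x => f x + g x) <= nrm f + nrm g.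
Proof.
move=> Lf Lg; have := form_triangle wL2_lin ip_lin (fun f g _ _ => ipC f g)
  (fun f _ => ip_ge0 f) 1 Lf Lg.
by rewrite normr1 mul1r; under eq_fun do rewrite mul1r.
Qed.

Lemma nrmZ (a : R) f : wL2 f -> nrm (fun x => a * f x) = `|a| * nrm f.
Proof.
move=> Lf; have La := wL2Z a Lf.
rewrite /nrm ipZl// ipC ipZl// mulrA -expr2 sqrtrM ?sqr_ge0// sqrtr_sqr//.
Qed.

Lemma nrm0 : nrm (fun=> 0) = 0.
Proof. by rewrite /nrm ip0l sqrtr0. Qed.

Lemma nrmB f g : nrm (fun x => f x - g x) = nrm (fun x => g x - f x).
Proof.
by rewrite /nrm; congr Num.sqrt; apply: eq_Rintegral => x _; ring.
Qed.

Lemma nrm_EFin f : wL2 f ->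
  (\int[mu]_(x in D) (om x * f x ^+ 2)%:E)%E = (nrm f ^+ 2)%:E.
Proof.
move=> Lf; rewrite sqr_nrm /ip /Rintegral fineK.
  by apply: eq_integral => x _; rewrite expr2.
exact: integrable_fin_num (ip_integrable Lf Lf).
Qed.

Lemma nrm_le_EFin f (c : R) : 0 <= c -> wL2 f ->
  (\int[mu]_(x in D) (om x * f x ^+ 2)%:E <= (c ^+ 2)%:E)%E -> nrm f <= c.
Proof.
move=> c0 Lf; rewrite nrm_EFin// lee_fin ler_pXn2r// nnegrE ?nrm_ge0//.
Qed.

Lemma nrm_eq0 f : wL2 f -> nrm f = 0 -> {ae mu, forall x, D x -> f x = 0}.
Proof.
move=> Lf n0; have := nrm_EFin Lf; rewrite n0 expr0n /= => i0.
have : ae_eq mu D (fun x => (om x * f x ^+ 2)%:E) (cst 0%E).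
  apply/ae_eq_integral_abs => //; first by apply: measurable_wX2; case: Lf.
  rewrite -[RHS]i0; apply: eq_integral => x /[!inE] Dx.
  by rewrite gee0_abs// lee_fin mulr_ge0 ?sqr_ge0 ?om_ge0.
apply: filterS => x /= + Dx => /(_ Dx) [] /eqP.
rewrite mulf_eq0 (gt_eqF (om_gt0 Dx))/= sqrf_eq0 => /eqP//.
Qed.

Definition aeD f g := {ae mu, forall x, D x -> f x = g x}.

Lemma aeD_wL2 f g : measurable_fun D g -> aeD f g -> wL2 f -> wL2 g.
Proof.
move=> mg fg [mf foo]; split=> //; rewrite -(@ge0_ae_eq_integral _ _ _ _ _
  (fun x => (om x * f x ^+ 2)%:E))//.
- exact: measurable_wX2.
- exact: measurable_wX2.
- by move=> x Dx; rewrite lee_fin mulr_ge0 ?sqr_ge0 ?om_ge0.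
- by move=> x Dx; rewrite lee_fin mulr_ge0 ?sqr_ge0 ?om_ge0.
- by apply: filterS fg => x /= + Dx => /(_ Dx) ->.
Qed.

Lemma eq_ip f f' g : measurable_fun D f -> measurable_fun D f' ->
  measurable_fun D g -> aeD f f' -> ip f g = ip f' g.
Proof.
move=> mf mf' mg ff'; rewrite /ip /Rintegral; congr fine.
apply: ae_eq_integral => //; [exact: measurable_wM|exact: measurable_wM|].
by apply: filterS ff' => x /= + Dx => /(_ Dx) ->.
Qed.

Lemma eq_nrm f g : measurable_fun D f -> measurable_fun D g ->
  aeD f g -> nrm f = nrm g.
Proof.
move=> mf mg fg; rewrite /nrm (@eq_ip f g)// ipC (@eq_ip f g) //.
Qed.

(** The absolute value on [M] covers a null [D], for which the almost everywhere bound holds with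
    any [M], even a negative one. *)
Lemma wL2_bdM (c : T -> R) (M : R) f : measurable_fun D c ->
  {ae mu, forall x, D x -> `|c x| <= M} -> wL2 f ->
  wL2 (fun x => c x * f x) /\ nrm (fun x => c x * f x) <= `|M| * nrm f.
Proof.
move=> mc cM Lf.
have mcf : measurable_fun D (fun x => c x * f x).
  by apply: measurable_funM => //; case: Lf.
have le : (\int[mu]_(x in D) (om x * (c x * f x) ^+ 2)%:E <=
           ((`|M| * nrm f) ^+ 2)%:E)%E.
  rewrite exprMn EFinM -nrm_EFin// -integralZl//; last exact: wL2_sq_integrable.
  apply: ae_ge0_le_integral => //.
  - by move=> x Dx; rewrite lee_fin mulr_ge0 ?sqr_ge0 ?om_ge0.
  - exact: measurable_wX2.
  - move=> x Dx; rewrite -EFinM lee_fin mulr_ge0 ?sqr_ge0//.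
    by rewrite mulr_ge0 ?sqr_ge0 ?om_ge0.
  - by apply: measurable_funeM; apply: measurable_wX2; case: Lf.
  - apply: filterS cM => x /= + Dx => /(_ Dx) cx.
    rewrite -EFinM lee_fin exprMn mulrCA ler_wpM2r//.
      by rewrite mulr_ge0 ?sqr_ge0 ?om_ge0.
    rewrite -[c x ^+ 2]real_normK ?num_real// lerXn2r ?nnegrE//.
    exact: (le_trans cx (ler_norm _)).
have Lcf : wL2 (fun x => c x * f x).
  by split=> //; apply: le_lt_trans le _; rewrite ltry.
by split=> //; apply: nrm_le_EFin => //; rewrite mulr_ge0// nrm_ge0.
Qed.

Lemma wsum_integrable n (P Q : 'I_n -> T -> R) : (forall i, wL2 (P i)) ->
  (forall i, wL2 (Q i)) ->
  mu.-integrable D (EFin \o (fun x => om x * \sum_(i < n) P i x * Q i x)).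
Proof.
move=> LP LQ.
rewrite (_ : _ \o _ = fun x => \sum_(i < n) (om x * (P i x * Q i x))%:E)%E; last first.
  by apply/funext => x /=; rewrite sumEFin big_distrr.
apply: integrable_sum => // i _.
exact: ip_integrable.
Qed.

Lemma Rintegral_wsum n (P Q : 'I_n -> T -> R) : (forall i, wL2 (P i)) ->
  (forall i, wL2 (Q i)) ->
  \int[mu]_(x in D) (om x * \sum_(i < n) P i x * Q i x) = \sum_(i < n) ip (P i) (Q i).
Proof.
elim: n P Q => [|n IH] P Q LP LQ.
  rewrite big_ord0 /Rintegral; under eq_integral do rewrite big_ord0 mulr0.
  by rewrite integral0.
rewrite big_ord_recl -IH// -RintegralD//.
- by apply: eq_Rintegral => x _; rewrite big_ord_recl mulrDr.
- exact: ip_integrable.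
- exact: wsum_integrable.
Qed.

Lemma ip_weight_ge0 (q f : T -> R) : measurable_fun D q -> wL2 f ->
  {ae mu, forall x, D x -> 0 <= q x} -> 0 <= ip (fun x => q x * f x) f.
Proof.
move=> mq [mf _] q0.
have mqf : measurable_fun D (fun x => q x * f x) by exact: measurable_funM.
have maqf : measurable_fun D (fun x => `|q x| * f x).
  by apply: measurable_funM => //; apply: measurableT_comp mq.
(* Passing to [|q|], equal to [q] almost everywhere on [D], makes the integrand nonnegative at every
   point. *)
rewrite (@eq_ip _ (fun x => `|q x| * f x))//.
  apply: Rintegral_ge0 => x Dx; rewrite mulr_ge0 ?(ltW (om_gt0 Dx))//.
  by rewrite -mulrA mulr_ge0// -expr2 sqr_ge0.
by apply: filterS q0 => x + Dx => /(_ Dx) qx; rewrite ger0_norm.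
Qed.

End wL2.

(** * Completeness of weighted L^2 spaces *)

Lemma quarter_series_le (R : realFieldType) n :
  \sum_(0 <= i < n) (4^-1 : R) ^+ i <= 2.
Proof.
suff -> : \sum_(0 <= i < n) (4^-1 : R) ^+ i = (4 - (4^-1 : R) ^+ n * 4) / 3.
  have : 0 <= (4^-1 : R) ^+ n by rewrite exprn_ge0.
  by lra.
elim: n => [|n IH]; first by rewrite big_nil expr0; field.
by rewrite big_nat_recr//= IH exprS; field.
Qed.

Lemma cvg_geometric_increments (R : realType) (g : nat -> R) (C : R) :
  (forall k, `|g k.+1 - g k| <= C * 2^-1 ^+ k) -> cvgn g.
Proof.
move=> gC; have C0 : 0 <= C.
  by have := gC 0%N; rewrite expr0 mulr1; apply: le_trans.
have cs : cvgn (series (telescope g)).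
  apply: normed_cvg; apply: (@series_le_cvg _ _ (geometric C 2^-1)).
  - by move=> n; exact: normr_ge0.
  - by move=> n; rewrite /= mulr_ge0// exprn_ge0.
  - by move=> n; exact: gC.
  - by apply: is_cvg_geometric_series; rewrite ger0_norm; lra.
have -> : g = (fun n => g 0%N + series (telescope g) n).
  by apply/funext => n; exact: eq_sum_telescope.
by apply: is_cvgD => //; exact: is_cvg_cst.
Qed.

Section complete.
Context d (T : measurableType d) (R : realType).
Variables (mu : {measure set T -> \bar R}) (D : set T) (om : T -> R).
Hypotheses (mD : measurable D) (mom : measurable_fun D om)
  (om_gt0 : forall x, D x -> 0 < om x).
Local Notation wL2 := (wL2 mu D om).
Local Notation nrm := (nrm mu D om).

Let om_ge0 x : D x -> 0 <= om x. Proof. by move/om_gt0/ltW. Qed.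

(** The series [S] of the functions [4^k om |g (k+1) - g k|^2] has integral at most the sum of
    [4^k 16^-k], so it is finite almost everywhere. Where it is finite, the increments are at most
    [sqrt (S / om) 2^-k], hence summable. *)
Lemma fast_cauchy_ae_cvg (g : nat -> T -> R) : (forall k, wL2 (g k)) ->
  (forall k, nrm (fun x => g k.+1 x - g k x) <= 4^-1 ^+ k) ->
  {ae mu, forall x, D x -> cvgn (g ^~ x)}.
Proof.
move=> Lg gk.
pose a k x := g k.+1 x - g k x.
have La k : wL2 (a k) by exact: wL2B.
pose u k x : \bar R := ((4 ^+ k)%:E * (om x * a k x ^+ 2)%:E)%E.
have u0 k x : D x -> (0 <= u k x)%E.
  by move=> Dx; rewrite /u -EFinM lee_fin mulr_ge0 ?exprn_ge0 ?ler0n// mulr_ge0 ?sqr_ge0 ?om_ge0.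
have mu_ k : measurable_fun D (u k).
  by apply: measurable_funeM; apply: measurable_wX2 => //; case: (La k).
pose S x := (\sum_(0 <= k <oo) u k x)%E.
have mS : measurable_fun D S.
  by apply: ge0_emeasurable_sum => [k x Dx _|k _]; [exact: u0|exact: mu_].
have intS : (\int[mu]_(x in D) S x <= 2%:E)%E.
  rewrite integral_nneseries//; apply: lime_le.
    by apply: is_cvg_nneseries => n _ _; apply: integral_ge0 => x Dx; exact: u0.
  apply: nearW => n; apply: (@le_trans _ _ (\sum_(0 <= i < n) (4^-1 ^+ i)%:E)%E).
    apply: lee_sum => k _; rewrite integralZl//; last exact: wL2_sq_integrable.
    rewrite nrm_EFin// -EFinM lee_fin.
    have h : nrm (a k) ^+ 2 <= 4^-1 ^+ k * 4^-1 ^+ k.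
      by rewrite expr2 ler_pM ?nrm_ge0//; exact: gk.
    apply: (@le_trans _ _ (4 ^+ k * (4^-1 ^+ k * 4^-1 ^+ k))).
      by rewrite ler_wpM2l// exprn_ge0.
    by rewrite mulrA -exprMn divff// expr1n mul1r.
  by rewrite sumEFin lee_fin quarter_series_le.
have iS : mu.-integrable D S.
  apply/integrableP; split=> //.
  under eq_integral => x /[!inE] Dx.
    rewrite gee0_abs; last by apply: nneseries_ge0 => k _ _; exact: u0.
    over.
  by apply: le_lt_trans intS _; rewrite ltry.
apply: filterS (integrable_ae mD iS) => x /= + Dx => /(_ Dx) Sfin.
have ox := om_gt0 Dx.
have uS k : (u k x <= S x)%E.
  apply: le_trans (@nneseries_lim_ge _ (u ^~ x) xpredT 0%N k.+1 _).
    rewrite big_nat_recr//= leeDr// sume_ge0// => i _; exact: u0.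
  by move=> n _ _; exact: u0.
pose c := fine (S x).
have c0 : 0 <= c by rewrite fine_ge0// nneseries_ge0// => n _ _; exact: u0.
apply: (@cvg_geometric_increments _ _ (Num.sqrt (c / om x))) => k.
rewrite -(@ler_pXn2r _ 2)// ?nnegrE ?mulr_ge0 ?sqrtr_ge0 ?exprn_ge0//.
rewrite real_normK ?num_real// exprMn sqr_sqrtr; last by rewrite divr_ge0// ltW.
rewrite -exprM mulnC exprM.
have -> : 2^-1 ^+ 2 = 4^-1 :> R by rewrite exprVn; congr (_^-1); ring.
have := uS k; rewrite -[S x]fineK// /u -EFinM lee_fin -/c => h.
have -> : c / om x * 4^-1 ^+ k = c / (om x * 4 ^+ k).
  by rewrite exprVn invfM mulrA.
rewrite ler_pdivlMr ?mulr_gt0 ?exprn_gt0//.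
by have -> : (g k.+1 x - g k x) ^+ 2 * (om x * 4 ^+ k) =
  4 ^+ k * (om x * a k x ^+ 2) by rewrite /a; ring.
Qed.

Lemma wL2_complete (f_ : nat -> T -> R) : (forall k, wL2 (f_ k)) ->
  (forall e : R, 0 < e -> exists N, forall j k, (N <= j)%N -> (N <= k)%N ->
    nrm (fun x => f_ j x - f_ k x) <= e) ->
  exists f, wL2 f /\ forall e : R, 0 < e -> exists N, forall k, (N <= k)%N ->
    nrm (fun x => f_ k x - f x) <= e.
Proof.
move=> Lf cauchy.
have /choice[N_ N_P] : forall i : nat, exists N, forall j k, (N <= j)%N ->
    (N <= k)%N -> nrm (fun x => f_ j x - f_ k x) <= 4^-1 ^+ i.
  by move=> i; apply: cauchy; rewrite exprn_gt0.
(* The maximum puts both [n_ k] and [n_ k.+1] beyond [N_ k], so consecutive terms of the subsequence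
   are [4^-k]-close; the summand [k] makes the indices unbounded. *)
pose n_ k := (k + \max_(i < k.+1) N_ i)%N.
have Nn i k : (i <= k)%N -> (N_ i <= n_ k)%N.
  move=> ik; apply: leq_trans (leq_addl _ _).
  by rewrite -ltnS in ik; exact: (@leq_bigmax _ (fun i : 'I_k.+1 => N_ i) (Ordinal ik)).
pose g k := f_ (n_ k).
have [B [mB B0 DB]] : {ae mu, forall x, D x -> cvgn (g ^~ x)}.
  apply: fast_cauchy_ae_cvg => [k|k]; first exact: Lf.
  by apply: N_P; exact: Nn.
(* Erasing the null set [B] makes the sequence converge at every point of [D], so that its limit is
   measurable without any completeness of the measure. *)
pose h k x := g k x * \1_(~` B) x.
have mh k : measurable_fun D (h k).
  apply: measurable_funM; first by case: (Lf (n_ k)).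
  by apply: measurable_funTS; apply: measurable_indic; exact: measurableC.
have cvgh x : D x -> cvgn (h ^~ x).
  move=> Dx; have [Bx|nBx] := pselect (B x).
    rewrite (_ : h ^~ x = fun=> 0); first exact: is_cvg_cst.
    by apply/funext => k; rewrite /h indicE memNset ?mulr0//= => /(_ Bx).
  rewrite (_ : h ^~ x = g ^~ x); last first.
    by apply/funext => k; rewrite /h indicE mem_set ?mulr1.
  by apply: contrapT => nc; apply: nBx; apply: DB => /= /(_ Dx).
pose f x := limn (h ^~ x).
have mf : measurable_fun D f by apply: (measurable_fun_cvg mh) => x /cvgh.
have hg k : aeD mu D (g k) (h k).
  exists B; split=> // x /= gh; apply: contrapT => nBx; apply: gh => _.
  by rewrite /h indicE mem_set ?mulr1.
have Lh k : wL2 (h k) by apply: aeD_wL2 (hg k) (Lf _).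
(* Fatou's lemma in [k] at fixed [j] turns the Cauchy bound into a bound on the distance to the
   limit. It is stated for the extended integral because [f] is not yet known to be in L^2; the case
   [e = 1] then shows that it is. *)
have key (e : R) : 0 < e -> exists N, forall j, (N <= j)%N ->
    (\int[mu]_(x in D) (om x * (f_ j x - f x) ^+ 2)%:E <= (e ^+ 2)%:E)%E.
  move=> e0; have [N NP] := cauchy e e0; exists N => j Nj.
  have mfj : measurable_fun D (f_ j) by case: (Lf j).
  pose F k x : \bar R := (om x * (f_ j x - h k x) ^+ 2)%:E.
  have mF k : measurable_fun D (F k).
    by apply: measurable_wX2 => //; apply: measurable_funB.
  have F0 k x : D x -> (0 <= F k x)%E.
    by move=> Dx; rewrite lee_fin mulr_ge0 ?sqr_ge0 ?om_ge0.
  have := fatou mu mD mF F0.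
  have -> : (\int[mu]_(x in D) limn_einf (F ^~ x) =
    \int[mu]_(x in D) (om x * (f_ j x - f x) ^+ 2)%:E)%E.
    apply: eq_integral => x /[!inE] Dx.
    apply: (cvg_limn_einf_sup _).1; apply: cvg_EFin; first exact: nearW.
    apply: cvgMl_tmp; rewrite /=.
    have c1 : (f_ j x - h k x) @[k --> \oo] --> f_ j x - f x.
      by apply: cvgB; [exact: cvg_cst|exact: cvgh].
    by under eq_fun do rewrite expr2; rewrite expr2; apply: cvgM.
  move=> /le_trans; apply.
  rewrite limn_einf_lim; apply: lime_le; first exact: is_cvg_einfs.
  apply: nearW => n; apply: (@le_trans _ _
      (\int[mu]_(x in D) F (maxn n N) x)%E).
    by apply: ereal_inf_lbound; exists (maxn n N) => //=; exact: leq_maxl.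
  rewrite nrm_EFin//; last exact: wL2B.
  rewrite lee_fin lerXn2r ?nnegrE ?nrm_ge0 ?(ltW e0)//.
  rewrite -(@eq_nrm _ _ _ _ _ _ mD _ (fun x => f_ j x - g (maxn n N) x)) //.
  - apply: NP => //; apply: leq_trans (leq_maxr n N) _; exact: leq_addr.
  - by apply: measurable_funB => //; case: (Lf (n_ (maxn n N))).
  - exact: measurable_funB.
  - by apply: filterS (hg (maxn n N)) => x /= + Dx => /(_ Dx) ->.
have Lff : wL2 f.
  have [N NP] := key 1 ltr01.
  have L : wL2 (fun x => f_ N x - f x).
    split; first by apply: measurable_funB => //; case: (Lf N).
    by apply: le_lt_trans (NP N (leqnn N)) _; rewrite ltry.
  rewrite (_ : f = fun x => f_ N x - (f_ N x - f x)); first exact: wL2B.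
  by apply/funext => x; ring.
exists f; split=> // e e0; have [N NP] := key e e0; exists N => k Nk.
by apply: nrm_le_EFin; [..|exact: NP] => //; [exact: ltW|exact: wL2B].
Qed.

End complete.

(** * Measurable sets and Lebesgue measure of row vectors *)

Section rV_measure.
Context {R : realType}.

Definition box n (a b : 'rV[R]_n) : set 'rV[R]_n :=
  [set x | forall i, a 0 i < x 0 i < b 0 i].

Definition cbox n (a b : 'rV[R]_n) : set 'rV[R]_n :=
  [set x | forall i, a 0 i <= x 0 i <= b 0 i].

Definition boxes n : set (set 'rV[R]_n) := [set A | exists a b, A = box a b].

Lemma measurable_all_coord n (P : 'I_n -> set R) :
  (forall i, measurable (P i)) -> measurable [set x : 'rV[R]_n | forall i, P i (x 0 i)].
Proof.
move=> mP; rewrite (_ : [set _ | _] =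
    \bigcap_(i in [set: 'I_n]) ((fun x : 'rV[R]_n => x 0 i) @^-1` P i)).
  apply: fin_bigcap_measurable => [|i _]; first exact: finite_finset.
  by rewrite -[X in measurable X]setTI; exact: measurable_coord.
by apply/seteqP; split => x /= h => [i _|i]; exact: h.
Qed.

Lemma measurable_box n (a b : 'rV[R]_n) : measurable (box a b).
Proof.
apply: (@measurable_all_coord n (fun i => `]a 0 i, b 0 i[%classic)) => i.
exact: measurable_itv.
Qed.

Lemma measurable_cbox n (a b : 'rV[R]_n) : measurable (cbox a b).
Proof.
apply: (@measurable_all_coord n (fun i => `[a 0 i, b 0 i]%classic)) => i.
exact: measurable_itv.
Qed.

Lemma boxI n (a b a' b' : 'rV[R]_n) : box a b `&` box a' b' =
  box (\row_i Num.max (a 0 i) (a' 0 i)) (\row_i Num.min (b 0 i) (b' 0 i)).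
Proof.
apply/seteqP; split => x.
  move=> [h h'] i; rewrite !mxE; move: (h i) (h' i) => /andP[? ?] /andP[? ?].
  by rewrite gt_max lt_min; apply/andP; split; apply/andP; split.
move=> h; split=> i; have := h i; rewrite !mxE gt_max lt_min.
  by move=> /andP[/andP[-> _] /andP[-> _]].
by move=> /andP[/andP[_ ->] /andP[_ ->]].
Qed.

Lemma boxes_setI_closed n : setI_closed (@boxes n).
Proof. by move=> _ _ [a [b ->]] [a' [b' ->]]; rewrite boxI; eexists; eexists. Qed.

Lemma bigcup_box n : \bigcup_k box (const_mx (- k%:R)) (const_mx k%:R) = [set: 'rV[R]_n].
Proof.
apply/seteqP; split=> // x _.
pose M := \sum_(i < n) `|x 0 i|.
exists (Num.truncn M).+1 => //= i; rewrite !mxE.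
rewrite -ltr_norml; apply: (@le_lt_trans _ _ M).
  by rewrite /M (bigD1 i)//= lerDl sumr_ge0.
by rewrite truncnS_gt.
Qed.

(** Open boxes are stable under intersection, so this description of the sigma-algebra is what a
    Dynkin induction over boxes requires. A half-space is a countable union of boxes, which gives
    the coordinates as measurable maps for the generated sigma-algebra. *)
Lemma rV_measurableE n : @measurable _ 'rV[R]_n = <<s @boxes n >>.
Proof.
apply/seteqP; split; last first.
  apply: smallest_sub; last by move=> _ [a [b ->]]; exact: measurable_box.
  split; first exact: measurable0.
    by move=> A mA; rewrite setTD; exact: measurableC.
  by move=> F mF; exact: bigcupT_measurable.
apply: smallest_sub; first exact: smallest_sigma_algebra.
rewrite -bigcup_seq/= => A [i _ [Y mY <-]].
have : @measurable_fun _ _ (g_sigma_algebraType (@boxes n)) R setT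
    (fun x : 'rV[R]_n => x 0 i).
  apply: (measurability _ (RGenOInfty.measurableE R)) => _ [_ [a ->] <-].
  rewrite setTI (_ : _ @^-1` _ = \bigcup_k (box (const_mx (- k%:R)) (const_mx k%:R)
    `&` box (\row_j if j == i then a else - k%:R) (const_mx k%:R))).
    apply: bigcupT_measurable => k; apply: sub_sigma_algebra.
    by rewrite boxI; eexists; eexists.
  apply/seteqP; split=> [x|x [k _ [_ /(_ i)]]] /=; last first.
    by rewrite !mxE eqxx in_itv/= andbT => /andP[].
  rewrite in_itv/= andbT => ax.
  have := bigcup_box n; move/seteqP => [_ /(_ x I) [k _ xk]].
  exists k => //; split=> // j; rewrite !mxE; case: eqP => [->|_].
    by rewrite ax; have := xk i; rewrite !mxE => /andP[].
  by have := xk j; rewrite !mxE.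
by move=> /(_ measurableT Y mY).
Qed.

Lemma box_ball n (x y : 'rV[R]_n) (e : R) : 0 < e ->
  (forall i, `|x 0 i - y 0 i| < e) -> ball x e y.
Proof. by move=> e0 h; split=> // i j; rewrite (ord1 i); exact: h. Qed.

(** The cubes form a countable family, so open sets are countable unions of them and an almost
    everywhere statement may be checked on each cube. The closed cube is required inside [D] because
    it carries the support of the bump functions. *)
Lemma open_rat_cubes n (D : set 'rV[R]_n) (x : 'rV[R]_n) : open D -> D x ->
  exists (p : 'rV[rat]_n) (k : nat),
    let a := \row_i (ratr (p 0 i) - k.+1%:R^-1) in
    let b := \row_i (ratr (p 0 i) + k.+1%:R^-1) in
    box a b x /\ cbox a b `<=` D.
Proof.
move=> oD Dx; have /nbhs_ballP[e /= e0 eD] := open_nbhs_nbhs (conj oD Dx).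
have [k ke] : exists k : nat, k.+1%:R^-1 < e / 2.
  exists (Num.truncn (e / 2)^-1); rewrite -[ltRHS]invrK ltf_pV2 ?posrE ?invr_gt0 ?divr_gt0//.
  by rewrite truncnS_gt.
have k0 : 0 < k.+1%:R^-1 :> R by rewrite invr_gt0.
have /choice[p pP] : forall i, exists q : rat,
    x 0 i - k.+1%:R^-1 < ratr q < x 0 i + k.+1%:R^-1.
  move=> i; have [|q] := @rat_in_itvoo R (x 0 i - k.+1%:R^-1) (x 0 i + k.+1%:R^-1).
    by move: k0; set r := _^-1; lra.
  by rewrite in_itv/= => h; exists q.
exists (\row_i p i), k; split => [i|y yab].
  by rewrite !mxE; have := pP i; move: k0; set r := _^-1; lra.
apply: eD; apply: box_ball => // i.
have := yab i; have := pP i; rewrite !mxE ltr_norml; move: k0 ke.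
by set r := _^-1; lra.
Qed.

Lemma open_measurable_rV n (D : set 'rV[R]_n) : open D -> measurable D.
Proof.
move=> oD.
pose B (q : 'rV[rat]_n * nat) : set 'rV[R]_n :=
  box (\row_i (ratr (q.1 0 i) - q.2.+1%:R^-1)) (\row_i (ratr (q.1 0 i) + q.2.+1%:R^-1)).
rewrite (_ : D = \bigcup_(q in [set q | B q `<=` D]) B q).
  rewrite bigcup_mkcond; apply: countable_bigcupT_measurable.
    exact: countableP.
  by move=> q; case: ifP => _; [exact: measurable_box|exact: measurable0].
apply/seteqP; split=> [x Dx|x [q /= qD]]; last exact: qD.
have [p [k [xp pD]]] := open_rat_cubes oD Dx; exists (p, k) => //=.
by move=> y yp; apply: pD => i; have := yp i; lra.
Qed.

Lemma continuous_measurable_rV n (f : 'rV[R]_n -> R) : continuous f ->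
  measurable_fun setT f.
Proof.
move=> cf; apply: (measurability _ (RGenOInfty.measurableE R)) => _ [_ [a ->] <-].
rewrite setTI; apply: open_measurable_rV.
by move/continuousP : cf; apply; exact: interval_open.
Qed.

Lemma cons_rV0 n (p : R * 'rV[R]_n) : cons_rV p 0 ord0 = p.1.
Proof.
rewrite /cons_rV (_ : ord0 = lshift n (ord0 : 'I_1)) ?row_mxEl ?mxE ?eqxx//.
exact/val_inj.
Qed.

Lemma cons_rVS n (p : R * 'rV[R]_n) i : cons_rV p 0 (lift ord0 i) = p.2 0 i.
Proof.
rewrite /cons_rV (_ : lift ord0 i = rshift 1 i) ?row_mxEr ?mxE//.
exact/val_inj.
Qed.

Lemma leb_pinfty_bounded n (M : R) :
  (leb n (cbox (const_mx (- M)%R) (const_mx M)) < +oo)%E.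
Proof.
elim: n => [|n IH]; first by rewrite /= diracE; case: (_ \in _); rewrite ltry.
rewrite /= /leb_step /pushforward.
rewrite (_ : _ @^-1` _ = `[- M, M]%classic `*` cbox (const_mx (- M)) (const_mx M)).
  rewrite product_measure1E//; last exact: measurable_cbox.
  apply: lte_mul_pinfty => //.
  have h : @lebesgue_measure R `[- M, M]%classic \is a fin_num.
    by rewrite lebesgue_measure_itv/=; case: ifP.
  exact: h.
apply/seteqP; split=> [[t v]/= h|[t v]/= [] + h i].
  split; first by have := h ord0; rewrite cons_rV0 !mxE in_itv.
  by move=> i; have := h (lift ord0 i); rewrite cons_rVS !mxE.
rewrite in_itv/= => tM; case: (unliftP ord0 i) => [j|] ->.
  by have := h j; rewrite cons_rVS !mxE.
by rewrite cons_rV0 !mxE.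
Qed.

Lemma leb_ge0_fubini n (F : 'rV[R]_n.+1 -> \bar R) : measurable_fun setT F ->
  (forall x, 0 <= F x)%E ->
  (\int[leb n.+1]_x F x =
   \int[leb n]_v \int[@lebesgue_measure R]_t F (cons_rV (t, v)))%E.
Proof.
move=> mF F0.
have mFc : measurable_fun setT (F \o @cons_rV R n).
  exact: measurableT_comp mF (@measurable_cons_rV R n).
rewrite -(@fubini_tonelli2 _ _ _ _ _ (@lebesgue_measure R) (leb n) _ mFc)//; last first.
  by move=> x; exact: F0.
have mc : @measurable_fun _ _ (measurableTypeR R * 'rV[R]_n)%type 'rV[R]_n.+1
  setT (@cons_rV R n) := @measurable_cons_rV R n.
have h := @ge0_integral_pushforward _ _ _ _ R _ mc
  [the {measure set (measurableTypeR R * 'rV[R]_n) -> \bar R} of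
   (@lebesgue_measure R \x leb n)%E] setT F measurableT mF (fun y _ => F0 y).
exact: h.
Qed.

Lemma xpartE n (x : 'rV[R]_(n + 1)) i : xpart x 0 i = x 0 (lshift 1 i).
Proof. by rewrite mxE. Qed.

Lemma xpart_cons_rV n (t : R) (v : 'rV[R]_(n + 1)) :
  @xpart R n.+1 (cons_rV (t, v)) = cons_rV (t, xpart v).
Proof.
apply/rowP => i; rewrite xpartE; case: (unliftP ord0 i) => [j|] ->.
  rewrite cons_rVS xpartE -(cons_rVS (t, v)); congr (_ _ _); exact/val_inj.
by rewrite cons_rV0 -[RHS](cons_rV0 (t, v)); congr (_ _ _); exact/val_inj.
Qed.

Lemma measurable_xpart n : measurable_fun setT (@xpart R n).
Proof.
apply: measurable_fun_rV => i.
rewrite (_ : (fun _ => _) = fun x : 'rV[R]_(n + 1) => x ord0 (lshift 1 i)).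
  exact: measurable_coord.
by apply/funext => x; rewrite /xpart mxE.
Qed.

(** [leb] is built by adding coordinates in front whereas [xpart] removes the last one, so the
    product structure is not directly visible. Induction on the first coordinate works: almost every
    section of a null set is null. In dimension 0 the measure is a Dirac mass at the only point, so
    a null set is empty. *)
Lemma leb_null_cylinder n (N : set 'rV[R]_n) : measurable N -> leb n N = 0%E ->
  leb (n + 1) (@xpart R n @^-1` N) = 0%E.
Proof.
elim: n N => [|n IH] N mN N0.
  suff -> : N = set0 by rewrite preimage_set0 measure0.
  apply/seteqP; split=> // x Nx; move: N0; rewrite /= diracE mem_set ?oner_eq0//.
    by move=> /eqP; rewrite eqe oner_eq0.
  by rewrite (_ : 0 = x)//; apply/rowP => -[].
pose B := @cons_rV R n @^-1` N.
have mB : measurable B by rewrite -[B]setTI; exact: measurable_cons_rV.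
have BE t : xsection (@cons_rV R (n + 1) @^-1` (@xpart R n.+1 @^-1` N)) t =
    @xpart R n @^-1` (xsection B t).
  by apply/seteqP; split=> v /=; rewrite /xsection/= !inE /B/= xpart_cons_rV.
have := N0; rewrite /= /leb_step /pushforward -/B /= /product_measure1 => i0.
have /ae_eq_integral_abs : (\int[@lebesgue_measure R]_x
    `|(leb n \o xsection B) x| = 0)%E.
  by rewrite -[RHS]i0; apply: eq_integral => x _; rewrite gee0_abs.
move=> /(_ measurableT (measurable_fun_xsection (leb n) mB)) ae0.
rewrite (@ae_eq_integral _ _ _ _ _ (cst 0%E))//.
- by rewrite integral0.
- apply: measurable_fun_xsection.
  rewrite -[X in measurable X]setTI; apply: measurable_cons_rV => //.
  have := @measurable_xpart n.+1 measurableT N mN; rewrite setTI; exact.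
- apply: filterS ae0 => t /= /(_ I) t0 _; rewrite BE IH//.
  exact: measurable_xsection.
Qed.

End rV_measure.

(** * Flat functions of one variable *)

Section flat.
Context {R : realType}.

(* With p = 1 this is the standard flat function exp (-1/t) extended by 0; the
   polynomial factor makes the family closed under differentiation. *)
Definition flat (p : {poly R}) (t : R) : R :=
  if 0 < t then p.[t^-1] * expR (- t^-1) else 0.

(** Induction peels a factor ['X] off the polynomial at the price of raising [N]; the constant
    coefficient is controlled by [1 + x^(N+1) / (N+1)! <= exp x]. *)
Lemma poly_expRN_bounded (p : {poly R}) (N : nat) :
  exists C : R, forall x : R, 0 < x -> `|p.[x]| * x ^+ N * expR (- x) <= C.
Proof.
elim/poly_ind: p N => [|p c IH] N.
  by exists 0 => x _; rewrite horner0 normr0 !mul0r.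
have [C CP] := IH N.+1.
exists (C + `|c| * N.+1`!%:R + `|c|) => x x0.
have e0 := expR_gt0 (- x).
have h : x ^+ N * expR (- x) <= N.+1`!%:R + 1.
  have xN : x ^+ N <= x ^+ N.+1 + 1.
    have [x1|x1] := leP 1 x.
      by rewrite (le_trans (ler_weXn2l x1 (leqnSn N)))// lerDl.
    by rewrite (le_trans (exprn_ile1 N (ltW x0) (ltW x1)))// lerDr exprn_ge0// ltW.
  have f0 : 0 < N.+1`!%:R :> R by rewrite ltr0n fact_gt0.
  have E := expR_ge1Dxn N (ltW x0).
  rewrite -(@ler_pM2r _ (expR x)) ?expR_gt0// -mulrA -expRD addNr expR0 mulr1.
  apply: le_trans xN _; apply: (@le_trans _ _ ((N.+1`!%:R + 1) * (1 + x ^+ N.+1 / N.+1`!%:R))).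
    have q0 : 0 <= x ^+ N.+1 / N.+1`!%:R by rewrite divr_ge0 ?exprn_ge0 ?ltW.
    have q1 : N.+1`!%:R * (x ^+ N.+1 / N.+1`!%:R) = x ^+ N.+1.
      by rewrite mulrC divfK// gt_eqF.
    by rewrite mulrDr mulr1 mulrDl mul1r q1; move: f0 q0; set u := _%:R; lra.
  by rewrite ler_wpM2l// addr_ge0// ltW.
rewrite hornerMXaddC.
apply: (@le_trans _ _ (`|p.[x]| * x ^+ N.+1 * expR (- x) + `|c| * (x ^+ N * expR (- x)))).
  apply: (@le_trans _ _ ((`|p.[x]| * x + `|c|) * x ^+ N * expR (- x))).
    rewrite ler_wpM2r ?(ltW e0)// ler_wpM2r ?exprn_ge0 ?(ltW x0)//.
    by rewrite (le_trans (ler_normD _ _))// normrM (gtr0_norm x0).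
  by rewrite le_eqVlt exprS; apply/orP; left; apply/eqP; ring.
rewrite -addrA lerD ?CP// -[X in _ + X]mulr1 -mulrDr ler_wpM2l//.
Qed.

(** A quadratic bound forces the difference quotient at 0, the one delicate point, to tend to 0. It
    is the preceding bound with [N = 2] at [1 / t]. *)
Lemma flat_le_sqr (p : {poly R}) : exists C : R, forall t, `|flat p t| <= C * t ^+ 2.
Proof.
have [C CP] := poly_expRN_bounded p 2.
have C0 : 0 <= C.
  by apply: le_trans (CP 1 ltr01); rewrite !mulr_ge0 ?expR_ge0.
exists C => t; rewrite /flat; case: ifP => t0; last by rewrite normr0 mulr_ge0 ?sqr_ge0.
have := CP t^-1; rewrite invr_gt0 => /(_ t0).
rewrite normrM (ger0_norm (expR_ge0 _)) exprVn mulrAC ler_pdivrMr//.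
by rewrite exprn_gt0.
Qed.

Lemma is_derive_flat (p : {poly R}) (t : R) :
  is_derive t (1 : R) (flat p) (flat ((p - p^`()) * 'X^2) t).
Proof.
have [t0|t0|<-] := ltgtP 0 t.
- have tn0 : t != 0 by rewrite gt_eqF.
  have dV : is_derive t (1 : R) (fun x : R => x^-1) (- t ^- 2 *: 1).
    exact: is_deriveV.
  have dp : is_derive t (1 : R) (horner p \o (fun x : R => x^-1))
      (p^`().[t^-1] * (- t ^- 2 *: 1)).
    exact: is_derive1_comp.
  have dN : is_derive t (1 : R) (fun x : R => - x^-1) (- (- t ^- 2 *: 1)).
    exact: is_deriveN.
  have de : is_derive t (1 : R) (expR \o (fun x : R => - x^-1))
      (expR (- t^-1) * - (- t ^- 2 *: 1)).
    exact: is_derive1_comp.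
  have E : {near t, (fun x => p.[x^-1] * expR (- x^-1)) =1 flat p}.
    near=> x; rewrite /flat ifT//; near: x; exact: lt_nbhsr.
  apply: (near_eq_is_derive E).
  apply: (is_derive_eq (is_deriveM dp de)).
  by rewrite /flat t0 !hornerE /GRing.scale/=; field.
- have -> : flat ((p - p^`()) * 'X^2) t = 0 by rewrite /flat ltNge ltW.
  have E : {near t, cst 0 =1 flat p}.
    near=> x; rewrite /flat /cst ltNge ltW//; near: x; exact: lt_nbhsl.
  apply: (near_eq_is_derive E); exact: is_derive_cst.
have -> : flat ((p - p^`()) * 'X^2) 0 = 0 by rewrite /flat ltxx.
have [C CP] := flat_le_sqr p.
have lim0 : h^-1 *: ((flat p \o shift 0) (h *: 1) - flat p 0) @[h --> 0^'] --> (0 : R).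
  apply/cvgr0Pnorm_le => e e0.
  have C1 : 0 < `|C| + 1 by rewrite ltr_pwDr.
  near=> h; rewrite /= addr0 [flat p 0]/flat ltxx subr0 /GRing.scale/= mulr1.
  have h0 : h != 0 by near: h; exact: nbhs_dnbhs_neq.
  rewrite normrM normfV ler_pdivrMl ?normr_gt0// (le_trans (CP h))//.
  rewrite -[h ^+ 2]real_normK ?num_real// expr2 mulrCA ler_wpM2l//.
  apply: (@le_trans _ _ ((`|C| + 1) * `|h|)).
    by rewrite ler_wpM2r// (le_trans (ler_norm _))// lerDl.
  rewrite -ler_pdivlMl//; near: h; apply: dnbhs0_le; rewrite mulr_gt0// invr_gt0//.
apply: DeriveDef; last exact: cvg_lim lim0.
by apply/cvg_ex; exists 0.
Unshelve. all: by end_near. Qed.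

End flat.

(** * Calculus of smooth functions of several variables *)

Section continuous_ops.
Context {R : realType} (T : topologicalType).
Implicit Types f g : T -> R.

Lemma continuous_fD f g : continuous f -> continuous g ->
  continuous (fun x => f x + g x).
Proof. by move=> cf cg x; exact: (continuousD (cf x) (cg x)). Qed.

Lemma continuous_fM f g : continuous f -> continuous g ->
  continuous (fun x => f x * g x).
Proof. by move=> cf cg x; exact: (continuousM (cf x) (cg x)). Qed.

Lemma continuous_fC (c : R) : continuous (fun _ : T => c).
Proof. by move=> x; exact: cvg_cst. Qed.

End continuous_ops.

Section smooth.
Context {R : realType} (n : nat).
Implicit Types f g : 'rV[R]_n -> R.

Lemma differentiable_upto_continuous k f : differentiable_upto k f -> continuous f.
Proof. by case: k => [|k] []. Qed.

Lemma differentiable_uptoW k f : differentiable_upto k.+1 f -> differentiable_upto k f.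
Proof.
elim: k f => [|k IH] f; first by case.
move=> [cf df]; split=> // v; have [dv df'] := df v; split=> //.
exact: IH.
Qed.

Lemma differentiable_upto_lin k (a : R) f g : differentiable_upto k f ->
  differentiable_upto k g -> differentiable_upto k (fun x => a * f x + g x).
Proof.
elim: k f g => [|k IH] f g.
  move=> [cf _] [cg _]; split=> //.
  by apply: continuous_fD => //; apply: continuous_fM => //; exact: continuous_fC.
move=> [cf df] [cg dg]; split.
  by apply: continuous_fD => //; apply: continuous_fM => //; exact: continuous_fC.
move=> v; have [dfv uf] := df v; have [dgv ug] := dg v.
have D x : is_derive x v (fun x => a * f x + g x) (a * 'D_v f x + 'D_v g x).
  by apply: is_deriveD; [apply: is_deriveZ|]; apply: derivableP.
split; first by move=> x; case: (D x).
rewrite (_ : (fun x => 'D_v _ x) = fun x => a * 'D_v f x + 'D_v g x).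
  exact: IH.
by apply/funext => x; case: (D x).
Qed.

Lemma differentiable_upto_cst k (c : R) : differentiable_upto k (fun _ : 'rV[R]_n => c).
Proof.
elim: k c => [|k IH] c; split=> //; try exact: continuous_fC.
move=> v; split; first by move=> x; exact: derivable_cst.
have -> : (fun x => 'D_v (fun _ : 'rV[R]_n => c) x) = fun=> 0.
  by apply/funext => x; exact: derive_cst.
exact: IH.
Qed.

Lemma differentiable_upto_mul k f g : differentiable_upto k f ->
  differentiable_upto k g -> differentiable_upto k (fun x => f x * g x).
Proof.
elim: k f g => [|k IH] f g.
  by move=> [cf _] [cg _]; split=> //; exact: continuous_fM.
move=> uf1 ug1; have uf0 := differentiable_uptoW uf1.
have ug0 := differentiable_uptoW ug1.
case: uf1 ug1 => [cf df] [cg dg]; split.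
  exact: continuous_fM.
move=> v; have [dfv uf] := df v; have [dgv ug] := dg v.
have D x : is_derive x v (fun x => f x * g x) (1 * (f x * 'D_v g x) + g x * 'D_v f x).
  by rewrite mul1r; apply: is_deriveM; apply: derivableP.
split; first by move=> x; case: (D x).
rewrite (_ : (fun x => 'D_v _ x) = fun x => 1 * (f x * 'D_v g x) + g x * 'D_v f x).
  by apply: differentiable_upto_lin; exact: IH.
by apply/funext => x; case: (D x).
Qed.

Lemma differentiable_upto_prod k (I : Type) (s : seq I) (F : I -> 'rV[R]_n -> R) :
  (forall i, differentiable_upto k (F i)) ->
  differentiable_upto k (fun x => \prod_(i <- s) F i x).
Proof.
move=> uF; elim: s => [|i s IH].
  by under eq_fun do rewrite big_nil; exact: differentiable_upto_cst.
by under eq_fun do rewrite big_cons; exact: differentiable_upto_mul.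
Qed.

(** Along the line [h |-> h v + x] a coordinate is affine in [h], so the chain rule of one variable
    applies. *)
Lemma is_derive_affine_coord (u u' : R -> R) (c b : R) i (x v : 'rV[R]_n) :
  (forall t, is_derive t (1 : R) u (u' t)) ->
  is_derive x v (fun x => u (c * x 0 i + b)) (c * v 0 i * u' (c * x 0 i + b)).
Proof.
move=> du; pose g (h : R) := c * (h * v 0 i + x 0 i) + b.
have dg : is_derive (0 : R) (1 : R) g (c * v 0 i).
  have hid : is_derive (0 : R) (1 : R) (id : R -> R) 1 by exact: is_derive_id.
  have hc (w : R) : is_derive (0 : R) (1 : R) (fun _ : R => w) 0.
    exact: is_derive_cst.
  have h := is_deriveD (is_deriveM (hc c) (is_deriveD (is_deriveM hid (hc (v 0 i)))
    (hc (x 0 i)))) (hc b).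
  by apply: (is_derive_eq h); rewrite /GRing.scale/=; ring.
have := @is_derive1_comp _ u g 0 _ _ (du (g 0)) dg.
rewrite {2}/g mul0r add0r => -[dr dE].
have E : (fun h : R => (u \o g) h) = (fun h : R => (fun x : 'rV[R]_n => u (c * x 0 i + b)) (h *: v + x)).
  by apply/funext => h /=; rewrite !mxE.
apply: DeriveDef; first by apply/derivable1P; rewrite -E.
rewrite [RHS]mulrC -dE /derive; congr (lim _).
rewrite (_ : (fun h => h^-1 *: (((u \o g) \o shift 0) (h *: 1) - _)) =
  (fun h => h^-1 *: (((fun x : 'rV[R]_n => u (c * x 0 i + b)) \o shift x) (h *: v) -
     u (c * x 0 i + b))))//.
apply/funext => h /=; congr (_ *: (_ - _)).
  by rewrite !mxE addr0 /g /GRing.scale/= mulr1.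
by rewrite /g mul0r add0r.
Qed.

Lemma differentiable_upto_flat k (p : {poly R}) (c b : R) i :
  differentiable_upto k (fun x : 'rV[R]_n => flat p (c * x 0 i + b)).
Proof.
have cflat q : continuous (fun x : 'rV[R]_n => flat q (c * x 0 i + b)).
  move=> x; apply: (@continuous_comp _ _ _ (fun x : 'rV[R]_n => c * x 0 i + b) (flat q)).
    apply: continuous_fD; last exact: continuous_fC.
    by apply: continuous_fM; [exact: continuous_fC|exact: coord_continuous].
  apply: differentiable_continuous; apply/derivable1_diffP.
  by case: (is_derive_flat q (c * x 0 i + b)).
elim: k p => [|k IH] p; split=> // v.
have D x := is_derive_affine_coord c b i x v (is_derive_flat p).
split; first by move=> x; case: (D x).
rewrite (_ : (fun x => 'D_v _ x) = fun x => (c * v 0 i) * flat ((p - p^`()) * 'X^2) (c * x 0 i + b) + 0).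
  by apply: differentiable_upto_lin; [exact: IH|exact: differentiable_upto_cst].
by apply/funext => x; rewrite addr0; case: (D x).
Qed.

End smooth.

(** * Bump functions on boxes *)

Section box_bump.
Context {R : realType} (n : nat).
Implicit Types a b : 'rV[R]_n.

(** The dilation by [k.+1] leaves the support in the closed box and drives each factor [exp (-1/t)]
    to 1 inside: a smooth approximation from below of the indicator of the open box. *)
Definition box_bump a b (k : nat) (x : 'rV[R]_n) : R :=
  \prod_(i < n) (flat 1 (k.+1%:R * x 0 i - k.+1%:R * a 0 i) *
                 flat 1 (- k.+1%:R * x 0 i + k.+1%:R * b 0 i)).

Lemma smooth_bump a b k : smooth (box_bump a b k).
Proof.
move=> m; apply: differentiable_upto_prod => i.
by apply: differentiable_upto_mul; exact: differentiable_upto_flat.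
Qed.

Lemma bump_out a b k x : ~ box a b x -> box_bump a b k x = 0.
Proof.
move=> /existsNP[i abi].
have k0 : 0 < k.+1%:R :> R by [].
have c1 : (0 < k.+1%:R * x 0 i - k.+1%:R * a 0 i) = (a 0 i < x 0 i).
  by rewrite -mulrBr pmulr_rgt0// subr_gt0.
have c2 : (0 < - k.+1%:R * x 0 i + k.+1%:R * b 0 i) = (x 0 i < b 0 i).
  by rewrite mulNr addrC -mulrBr pmulr_rgt0// subr_gt0.
rewrite /box_bump (bigD1 i)// /flat c1 c2.
have [ax|_] := ltP (a 0 i) (x 0 i); last by rewrite /= !mul0r.
have [xb|_] := ltP (x 0 i) (b 0 i); last by rewrite /= mulr0 mul0r.
by case: abi; rewrite ax xb.
Qed.

Lemma flat1_bound (t : R) : 0 <= flat 1 t <= 1.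
Proof.
rewrite /flat; case: ifP => t0; last by rewrite lexx ler01.
by rewrite hornerC mul1r expR_ge0 -expR0 ler_expR oppr_le0 invr_ge0 ltW.
Qed.

Lemma bump_bound a b k x : 0 <= box_bump a b k x <= 1.
Proof.
rewrite /box_bump; apply: (@big_ind _ (fun y : R => 0 <= y <= 1)) => //.
- by rewrite ler01 lexx.
- by move=> u v /andP[? ?] /andP[? ?]; rewrite mulr_ge0// mulr_ile1.
move=> i _; move: (flat1_bound (k.+1%:R * x 0 i - k.+1%:R * a 0 i)).
move: (flat1_bound (- k.+1%:R * x 0 i + k.+1%:R * b 0 i)).
by move=> /andP[? ?] /andP[? ?]; rewrite mulr_ge0// mulr_ile1.
Qed.

Lemma cvg_flat1 (t : R) : 0 < t -> flat 1 (k.+1%:R * t) @[k --> \oo] --> (1 : R).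
Proof.
move=> t0; rewrite (_ : (fun k => _) = fun k => expR (- (k.+1%:R^-1 * t^-1))).
  rewrite -[X in _ --> X]expR0; apply: continuous_cvg; first exact: continuous_expR.
  rewrite -[X in _ --> X]oppr0; apply: cvgN; rewrite -[X in _ --> X](mul0r t^-1).
  by apply: cvgM; [exact: cvg_harmonic|exact: cvg_cst].
by apply/funext => k; rewrite /flat pmulr_rgt0// t0 hornerC mul1r invfM.
Qed.

Lemma cvg_bump a b x : box_bump a b k x @[k --> \oo] --> (\1_(box a b) x : R).
Proof.
rewrite indicE; case: (asboolP (box a b x)) => [abx|nabx]; last first.
  rewrite memNset// (_ : (fun k => _) = fun=> 0); first exact: cvg_cst.
  by apply/funext => k; rewrite bump_out.
rewrite mem_set//= /box_bump (_ : 1%:R = \prod_(i < n) (1 * 1) :> R); last first.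
  by rewrite mulr1 big1.
elim: (index_enum _) => [|i s IH].
  by under eq_fun do rewrite big_nil; rewrite big_nil; exact: cvg_cst.
under eq_fun do rewrite big_cons; rewrite big_cons; apply: cvgM => //.
have /andP[ax xb] := abx i; apply: cvgM.
  by under eq_fun do rewrite -mulrBr; apply: cvg_flat1; rewrite subr_gt0.
under eq_fun do rewrite mulNr addrC -mulrBr.
by apply: cvg_flat1; rewrite subr_gt0.
Qed.

Lemma compact_cbox a b : compact (cbox a b).
Proof.
rewrite (_ : cbox a b = [set v : 'rV[R]_n | forall i, `[a 0 i, b 0 i]%classic (v ord0 i)]).
  apply: (@rV_compact R n (fun i => `[a 0 i, b 0 i]%classic)) => i.
  exact: segment_compact.
by apply/seteqP; split=> x h i; have := h i; rewrite /= in_itv.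
Qed.

Lemma test_bump (D : set 'rV[R]_n) a b k : cbox a b `<=` D ->
  test_function D (box_bump a b k).
Proof.
move=> abD; split; first exact: smooth_bump.
exists (cbox a b); split=> //; first exact: compact_cbox.
move=> x nx; apply: bump_out => h; apply: nx => i.
by have /andP[? ?] := h i; rewrite !ltW.
Qed.

End box_bump.

(** * Fundamental lemma of the calculus of variations *)

Lemma eq_integral_supp d (T : measurableType d) (R : realType)
    (mu : {measure set T -> \bar R}) (A B : set T) (f g : T -> \bar R) :
  A `<=` B -> (forall x, A x -> f x = g x) -> (forall x, B x -> ~ A x -> g x = 0%E) ->
  (\int[mu]_(x in A) f x = \int[mu]_(x in B) g x)%E.
Proof.
move=> AB fg g0; rewrite integral_mkcond (integral_mkcond B g).
congr (integral _ _ _); apply/funext => x; rewrite /patch.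
have [/set_mem Ax|nAx] := boolP (x \in A).
  by rewrite mem_set ?fg//; exact: AB.
case: ifPn => // /set_mem Bx; rewrite g0//.
by move=> Ax; move: nAx; rewrite mem_set.
Qed.

Section fundamental_lemma.
Context {R : realType} (n : nat).
Variables (D : set 'rV[R]_n) (g : 'rV[R]_n -> R).
Hypotheses (oD : open D) (mg : measurable_fun D g).
Hypothesis ig : forall a b, cbox a b `<=` D ->
  (leb n).-integrable (cbox a b) (EFin \o g).
Hypothesis g0 : forall f, test_function D f ->
  \int[leb n]_(x in D) (g x * f x) = 0.

Lemma box_sub_cbox (a b : 'rV[R]_n) : box a b `<=` cbox a b.
Proof. by move=> x h i; have /andP[? ?] := h i; rewrite !ltW. Qed.

(** The bump functions are test functions bounded by 1 that tend to the indicator of the box, so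
    dominated convergence applies with [|g|] as the bound, [g] being integrable on the closed
    box. *)
Lemma integral_box_eq0 (a b : 'rV[R]_n) : cbox a b `<=` D ->
  (\int[leb n]_(x in box a b) (g x)%:E = 0)%E.
Proof.
move=> abD; have mc := measurable_cbox a b; have mb := measurable_box a b.
have mgc : measurable_fun (cbox a b) g.
  by apply: measurable_funS abD mg; exact: open_measurable_rV.
have mbump k : measurable_fun (cbox a b) (box_bump a b k).
  apply: measurable_funTS; apply: continuous_measurable_rV.
  exact: differentiable_upto_continuous (smooth_bump a b k 0%N).
have igc := ig abD.
pose F k x := (g x * box_bump a b k x)%:E.
have mF k : measurable_fun (cbox a b) (F k).
  by apply/measurable_EFinP; exact: measurable_funM.
have F_le k x : cbox a b x -> (`|F k x| <= `|(g x)%:E|)%E.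
  move=> _; rewrite lee_fin normrM ler_piMr// ger0_norm.
    by have /andP[] := bump_bound a b k x.
  by have /andP[] := bump_bound a b k x.
(* [Rintegral] also returns 0 for an infinite integral, so finiteness must be known before the
   hypothesis [g0] gives anything about the extended integral. *)
have F0 k : (\int[leb n]_(x in cbox a b) F k x = 0)%E.
  have := g0 (test_bump k abD); rewrite /Rintegral => e.
  have fin : (\int[leb n]_(x in cbox a b) F k x)%E \is a fin_num.
    apply: integrable_fin_num => //.
    exact: (le_integrable mc (mF k) (F_le k) igc).
  rewrite -(fineK fin) -[RHS]/((0 : R)%:E) -e; congr (fine _)%:E.
  apply: eq_integral_supp => // x _ ncx; rewrite bump_out ?mulr0//.
  by move/box_sub_cbox.
have lim : (\int[leb n]_(x in cbox a b) F k x @[k --> \oo] -->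
    \int[leb n]_(x in cbox a b) (g x * \1_(box a b) x)%:E)%E.
  apply: (@dominated_cvg _ _ _ (leb n) _ mc F _ (fun x => `|(g x)%:E|%E) mF).
  - move=> x _; apply: cvg_EFin; first exact: nearW.
    by apply: cvgM; [exact: cvg_cst|exact: cvg_bump].
  - by [].
  - exact: integrable_abse.
  - exact: F_le.
have lim0 : (\int[leb n]_(x in cbox a b) F k x @[k --> \oo] --> 0)%E.
  by rewrite (_ : (fun _ => _) = fun=> 0%E) ?funeqE//; exact: cvg_cst.
have : (\int[leb n]_(x in cbox a b) (g x * \1_(box a b) x)%:E = 0)%E.
  exact: cvg_unique lim lim0.
move=> <-; apply: eq_integral_supp => [|x bx|x _ nbx].
- exact: box_sub_cbox.
- by rewrite indicE mem_set ?mulr1.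
- by rewrite indicE memNset ?mulr0.
Qed.

(** The sets [A] for which [g] has zero integral on [A] intersected with the box form a Dynkin
    system containing all boxes, hence all measurable sets; a function with zero integral on every
    measurable subset vanishes almost everywhere. *)
Lemma ae_eq0_on_box (a b : 'rV[R]_n) : cbox a b `<=` D ->
  {ae leb n, forall x, box a b x -> g x = 0}.
Proof.
move=> abD; have mb := measurable_box a b.
have igb : (leb n).-integrable (box a b) (EFin \o g).
  exact: integrableS (measurable_cbox a b) mb (@box_sub_cbox a b) (ig abD).
have key A : measurable A -> (\int[leb n]_(x in A `&` box a b) (g x)%:E = 0)%E.
  rewrite [X in X A -> _]rV_measurableE.
  pose P A := (\int[leb n]_(x in A `&` box a b) (g x)%:E = 0)%E.
  move: A; apply: (@dynkin_induction _ _ _ P (rV_measurableE n)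
    (@boxes_setI_closed _ n)); rewrite /P.
  - by rewrite setTI integral_box_eq0.
  - move=> _ [a' [b' ->]]; rewrite boxI integral_box_eq0// => x abx; apply: abD => i.
    have := abx i; rewrite !mxE ge_max le_min.
    by move=> /andP[/andP[_ ->] /andP[_ ->]].
  - move=> A mA A0.
    have mAb : measurable (A `&` box a b) by exact: measurableI.
    have mAb' : measurable (~` A `&` box a b).
      by apply: measurableI => //; exact: measurableC.
    have := integral_box_eq0 abD.
    have -> : box a b = (A `&` box a b) `|` (~` A `&` box a b).
      by rewrite -setIUl setUv setTI.
    rewrite integral_setU//.
    + by rewrite -setIUl setUv setTI A0 add0e.
    + rewrite -setIUl setUv setTI; exact: (measurable_int _ igb).
    + apply/disj_setPS => x [[Ax _] [nAx _]]; exact: nAx.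
  - move=> F mF tF F0; rewrite setI_bigcupl integral_bigcup.
    + by apply: eseries0 => k _ _; exact: F0.
    + exact: trivIset_setIr.
    + by move=> k; exact: measurableI.
    + apply: integrableS igb => //; last by move=> x [k _ []].
      by apply: bigcupT_measurable => k; exact: measurableI.
have : ae_eq (leb n) (box a b) (EFin \o g) (cst 0%E).
  apply: integral_ae_eq => // E Eb mE.
  by rewrite integral0 -(setIidl Eb) key.
by apply: filterS => x /= h bx; have [] := h bx.
Qed.

Lemma fundamental_lemma : {ae leb n, forall x, D x -> g x = 0}.
Proof.
(* Rational cubes are enumerated by [unpickle], so that the countably many exceptional null sets can
   be united. *)
pose P (m : nat) (x : 'rV[R]_n) := if unpickle m is Some (p, k) then
    let a := \row_i (ratr ((p : 'rV[rat]_n) 0 i) - (k : nat).+1%:R^-1) in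
    let b := \row_i (ratr (p 0 i) + k.+1%:R^-1) in
    cbox a b `<=` D -> box a b x -> g x = 0 else True.
have /ae_foralln : forall m, {ae leb n, forall x, P m x}.
  move=> m; rewrite /P; case: (unpickle m) => [[p k]|]; last exact: aeW.
  set a := \row_i _; set b := \row_i _.
  have [abD|nabD] := pselect (cbox a b `<=` D); last by apply: aeW => x /nabD.
  by apply: filterS (ae_eq0_on_box abD) => x h _.
apply: filterS => x h Dx; have [p [k [bx bD]]] := open_rat_cubes oD Dx.
by have := h (pickle (p, k)); rewrite /P pickleK; exact.
Qed.

End fundamental_lemma.

(** * Test functions and compact sets *)

Section test_functions.
Context {R : realType} (n : nat).
Implicit Types (D : set 'rV[R]_n) (f : 'rV[R]_n -> R).

Lemma test_lin D (a : R) f g : test_function D f -> test_function D g ->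
  test_function D (fun x => a * f x + g x).
Proof.
move=> [sf [K [cK KD Kf]]] [sg [L [cL LD Lg]]]; split.
  by move=> k; apply: differentiable_upto_lin.
exists (K `|` L); split; first exact: compactU.
  by move=> x [/KD|/LD].
by move=> x /not_orP[nK nL]; rewrite Kf// Lg// mulr0 addr0.
Qed.

Lemma test_is_derive D f v x : test_function D f -> is_derive x v f ('D_v f x).
Proof.
by move=> [sf _]; apply: derivableP; have [_ /(_ v)[+ _]] := sf 1%N; exact.
Qed.

Lemma test_derive_lin D (a : R) f g v x : test_function D f -> test_function D g ->
  'D_v (fun x => a * f x + g x) x = a * 'D_v f x + 'D_v g x.
Proof.
move=> tf tg; have df := test_is_derive v x tf; have dg := test_is_derive v x tg.
by case: (is_deriveD (is_deriveZ a df) dg).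
Qed.

Lemma compact_closed_rV (K : set 'rV[R]_n) : compact K -> closed K.
Proof. by apply: compact_closed; exact: norm_hausdorff. Qed.

Lemma test_derive D f v : test_function D f -> test_function D (fun x => 'D_v f x).
Proof.
move=> [sf [K [cK KD Kf]]]; split.
  by move=> k; have [_ /(_ v)[_]] := sf k.+1.
exists K; split=> // x nKx.
have oK : open (~` K) by apply: closed_openC; exact: compact_closed_rV.
have E : \near x, f x = (fun _ : 'rV[R]_n => 0 : R) x.
  have : \near x, (~` K) x by exact: open_nbhs_nbhs.
  by apply: filterS => y /Kf.
by rewrite (near_eq_derive _ E) derive_cst.
Qed.

Lemma test_continuous D f : test_function D f -> continuous f.
Proof. by move=> [sf _]; exact: differentiable_upto_continuous (sf 0%N). Qed.

Lemma test_measurable D f : test_function D f -> measurable_fun setT f.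
Proof. by move=> tf; apply: continuous_measurable_rV; exact: test_continuous tf. Qed.

Lemma test0 D : test_function D (fun=> 0).
Proof.
split; first by move=> k; exact: differentiable_upto_cst.
by exists set0; split=> //; exact: compact0.
Qed.

Lemma compact_continuous_bounded (K : set 'rV[R]_n) f : compact K ->
  {within K, continuous f} -> exists M : R, forall x, K x -> f x <= M.
Proof.
move=> cK cf; have [->|/set0P K0] := eqVneq K set0; first by exists 0.
have [c _ cP] := EVT_max_rV K0 cK cf.
by exists (f c) => x Kx; apply: cP; rewrite inE.
Qed.

Lemma test_bounded D f : test_function D f -> exists M : R, forall x, `|f x| <= M.
Proof.
move=> tf; have [_ [K [cK KD Kf]]] := tf.
have cf : {within K, continuous (fun x => `|f x|)}.
  apply: continuous_subspaceT => x.
  by apply: (@continuous_comp _ _ _ f); [exact: test_continuous tf _|exact: norm_continuous].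
have [M MP] := compact_continuous_bounded cK cf.
exists (Num.max M 0) => x; have [Kx|nKx] := pselect (K x).
  by rewrite le_max MP.
by rewrite Kf// normr0 le_max lexx orbT.
Qed.

Lemma leb_compact_fin (K : set 'rV[R]_n) : compact K ->
  measurable K /\ (leb n K < +oo)%E.
Proof.
move=> cK; have mK : measurable K.
  rewrite -[K]setCK; apply: measurableC; apply: open_measurable_rV.
  by apply: closed_openC; exact: compact_closed_rV.
split=> //; have [M [_ MP]] := compact_bounded cK.
have KM : K `<=` cbox (const_mx (- (M + 1))) (const_mx (M + 1)).
  move=> x Kx i; rewrite !mxE -ler_norml.
  have := MP (M + 1); rewrite ltrDl ltr01 => /(_ isT _ Kx); apply: le_trans.
  rewrite [X in _ <= X]mx_normrE.
  exact: (le_bigmax_cond 0 (fun j : 'I_1 * 'I_n => `|x j.1 j.2|) (j := (0, i))).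
apply: le_lt_trans (leb_pinfty_bounded n (M + 1)).
by apply: le_measure => //; rewrite inE//; exact: measurable_cbox.
Qed.

End test_functions.

(** * Weighted Sobolev spaces and weak gradients *)

Lemma ge0_cvge0P (R : realType) (u : nat -> \bar R) : (forall k, 0 <= u k)%E ->
  (u @ \oo --> 0%E) <-> (forall e : R, 0 < e -> \forall k \near \oo, (u k <= e%:E)%E).
Proof.
move=> u0; split=> [u_0 e e0|ue].
  have : nbhs (0%E : \bar R) [set y | (y < e%:E)%E].
    apply: open_nbhs_nbhs; split; first exact: open_ereal_lt_ereal.
    by rewrite /= lte_fin.
  move=> /u_0 [N _ NP]; exists N => // k /NP /= /ltW; exact.
apply/fine_cvgP; split.
  apply: filterS (ue 1 ltr01) => k uk.
  by rewrite ge0_fin_numE// (le_lt_trans uk)// ltry.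
apply/cvgr0Pnorm_le => e e0; apply: filterS (ue e e0) => k uk.
have fk : u k \is a fin_num by rewrite ge0_fin_numE// (le_lt_trans uk)// ltry.
by rewrite /= ger0_norm ?fine_ge0// -lee_fin fineK.
Qed.

Section sobolev.
Context {R : realType} (n : nat).
Variables (D U : set 'rV[R]_n) (om : 'rV[R]_n -> R).
Hypotheses (oD : open D) (mom : measurable_fun D om)
  (mVom : measurable_fun D (fun x => (om x)^-1))
  (om_gt0 : forall x, D x -> 0 < om x)
  (om_loc : forall K, compact K -> K `<=` D ->
    exists2 c : R, 0 < c & forall x, K x -> c <= om x).
Local Notation mu := (leb n).
Local Notation wL2 := (wL2 (leb n) D om).
Local Notation ip := (ip (leb n) D om).
Local Notation nrm := (nrm (leb n) D om).
Local Notation aeD := (aeD (leb n) D).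
Local Notation H1_0 := (weighted_H1_0 om D U).
Local Notation H1 := (weighted_H1 om D).
Local Notation grad := (grad om D).
Let mD : measurable D. Proof. exact: open_measurable_rV. Qed.
Implicit Types (w v f : 'rV[R]_n -> R) (G : 'rV[R]_n -> 'rV[R]_n).

(** Division by the weight turns the unweighted pairings in the definition of weak gradients into
    weighted inner products with [f / om]. This quotient is square integrable because
    [(f / om)^2 om = f^2 / om] and [om] is bounded below on the support. *)
Lemma compact_support_wL2 (K : set 'rV[R]_n) f (M : R) : compact K -> K `<=` D ->
  measurable_fun D f -> (forall x, `|f x| <= M) -> (forall x, ~ K x -> f x = 0) ->
  wL2 (fun x => f x / om x).
Proof.
move=> cK KD mf fM fK; have [c c0 cP] := om_loc cK KD.
have [mK Kfin] := leb_compact_fin cK.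
have mfo : measurable_fun D (fun x => f x / om x) by exact: measurable_funM.
split=> //.
have -> : (\int[mu]_(x in D) (om x * (f x / om x) ^+ 2)%:E =
           \int[mu]_(x in K) (om x * (f x / om x) ^+ 2)%:E)%E.
  apply/esym/eq_integral_supp => // x _ nKx.
  by rewrite fK// mul0r expr0n mulr0.
pose B := M ^+ 2 / c; have B0 : 0 <= B by rewrite divr_ge0 ?sqr_ge0 ?ltW.
apply: (@le_lt_trans _ _ (\int[mu]_(x in K) (cst B%:E x))%E).
  apply: ge0_le_integral => //.
  - by move=> x /KD Dx; rewrite lee_fin mulr_ge0 ?sqr_ge0 ?ltW ?om_gt0.
  - apply: measurable_funS mD KD _; exact: measurable_wX2.
  move=> x Kx; have ox := om_gt0 (KD _ Kx); rewrite /= lee_fin.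
  have -> : om x * (f x / om x) ^+ 2 = f x ^+ 2 / om x.
    by rewrite exprMn exprVn; field; rewrite gt_eqF.
  apply: ler_pM; rewrite ?sqr_ge0 ?invr_ge0 ?(ltW ox)//.
    rewrite -[f x ^+ 2]real_normK ?num_real// lerXn2r ?nnegrE//.
    exact: le_trans (fM x).
  by rewrite lef_pV2 ?posrE// cP.
by rewrite integral_cst// lte_mul_pinfty.
Qed.

Lemma Rintegral_ip f g : \int[mu]_(x in D) (f x * g x) = ip f (fun x => g x / om x).
Proof.
apply: eq_Rintegral => x /[!inE] Dx; have := om_gt0 Dx => ox.
by field; rewrite gt_eqF.
Qed.

Lemma test_wL2 f : test_function D f -> wL2 (fun x => f x / om x).
Proof.
move=> tf; have [_ [K [cK KD Kf]]] := tf; have [M MP] := test_bounded tf.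
apply: (@compact_support_wL2 K _ M) => //.
by apply: measurable_funTS; exact: test_measurable tf.
Qed.

(** Unweighted local integrability, as the fundamental lemma requires: on the box, [g] is the
    product [om * (g * (1 / om))] of two weighted L^2 functions. *)
Lemma wL2_cbox_integrable g a b : wL2 g -> cbox a b `<=` D ->
  mu.-integrable (cbox a b) (EFin \o g).
Proof.
move=> Lg abD; have mc := measurable_cbox a b.
have L1 : wL2 (fun x => \1_(cbox a b) x / om x).
  apply: (@compact_support_wL2 (cbox a b) _ 1) => //.
  - exact: compact_cbox.
  - by move=> x; rewrite indicE; case: (_ \in _); rewrite ?normr1// normr0.
  - by move=> x nx; rewrite indicE memNset.
have := ip_integrable mD mom om_gt0 Lg L1.
move=> /(integrableS mD mc abD); apply: eq_integrable => // x /[!inE] cx /=.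
rewrite indicE mem_set//; have ox := om_gt0 (abD _ cx); congr EFin.
by rewrite mul1r mulrCA divff ?mulr1// gt_eqF.
Qed.

Lemma test_sep g : wL2 g ->
  (forall f, test_function D f -> ip g (fun x => f x / om x) = 0) ->
  {ae mu, forall x, D x -> g x = 0}.
Proof.
move=> Lg g0; apply: fundamental_lemma => //; first by case: Lg.
  by move=> a b; exact: wL2_cbox_integrable.
by move=> f tf; rewrite Rintegral_ip g0.
Qed.

Lemma weak_gradientP w G : weak_gradient om D w G <-> forall i,
  wL2 (fun x => G x 0 i) /\ forall f, test_function D f ->
    ip w (fun x => 'D_(basis_vec i) f x / om x) =
    - ip (fun x => G x 0 i) (fun x => f x / om x).
Proof.
by split=> h i; have [? e] := h i; split=> // f /e; rewrite !Rintegral_ip.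
Qed.

(** Both gradients have the same pairing with every test function. This is what gives [grad], a
    value chosen among all weak gradients, any usable property beyond being one of them. *)
Lemma weak_gradient_unique w G G' : weak_gradient om D w G ->
  weak_gradient om D w G' -> forall i, aeD (fun x => G x 0 i) (fun x => G' x 0 i).
Proof.
move=> /weak_gradientP hG /weak_gradientP hG' i.
have [LG eG] := hG i; have [LG' eG'] := hG' i.
have : {ae mu, forall x, D x -> G x 0 i - G' x 0 i = 0}.
  apply: test_sep; first exact: wL2B.
  move=> f tf; rewrite ipBl//; last exact: test_wL2.
  by apply/eqP; rewrite subr_eq0 -eqr_opp -eG// -eG'.
by apply: filterS => x h Dx; apply/eqP; rewrite -subr_eq0 h.
Qed.

Lemma weak_gradient_lin (a : R) w v G G' : wL2 w -> wL2 v ->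
  weak_gradient om D w G -> weak_gradient om D v G' ->
  weak_gradient om D (fun x => a * w x + v x) (fun x => a *: G x + G' x).
Proof.
move=> Lw Lv /weak_gradientP hG /weak_gradientP hG'; apply/weak_gradientP => i.
have [LG eG] := hG i; have [LG' eG'] := hG' i.
have -> : (fun x => (a *: G x + G' x) 0 i) = (fun x => a * G x 0 i + G' x 0 i).
  by apply/funext => x; rewrite !mxE.
split; first exact: wL2_lin.
move=> f tf; rewrite !ip_lin//; [|exact: test_wL2|].
  by rewrite eG// eG'// mulrN opprD.
by apply: test_wL2; exact: test_derive.
Qed.

Lemma weak_gradient_congr w v G : measurable_fun D w -> measurable_fun D v ->
  aeD w v -> weak_gradient om D w G -> weak_gradient om D v G.
Proof.
move=> mw mv wv /weak_gradientP hG; apply/weak_gradientP => i.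
have [LG eG] := hG i; split=> // f tf; rewrite -eG//.
apply: eq_ip => //; first by case: (test_wL2 (test_derive (basis_vec i) tf)).
by apply: filterS wv => x + Dx => /(_ Dx).
Qed.

Lemma aeD_sym f g : aeD f g -> aeD g f.
Proof. by apply: filterS => x + Dx => /(_ Dx). Qed.

(** This is an equality of functions and not only almost everywhere: [w] and [v] have the same set
    of weak gradients, and the choice depends on that set alone. *)
Lemma grad_congr w v : measurable_fun D w -> measurable_fun D v -> aeD w v ->
  grad w = grad v.
Proof.
move=> mw mv wv; rewrite /Defs.grad; congr (xget _ _); apply/seteqP; split => G /=.
  exact: weak_gradient_congr.
by apply: weak_gradient_congr => //; exact: aeD_sym.
Qed.

Lemma gradP w : H1 w -> weak_gradient om D w (grad w).
Proof. by move=> [_ [G wG]]; rewrite /Defs.grad; apply: xgetPex; exists G. Qed.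

Lemma grad_wL2 w i : H1 w -> wL2 (fun x => grad w x 0 i).
Proof. by move=> /gradP/weak_gradientP/(_ i)[]. Qed.

Lemma H1_wL2 w : H1 w -> wL2 w. Proof. by case. Qed.

Lemma H1_lin (a : R) w v : H1 w -> H1 v -> H1 (fun x => a * w x + v x).
Proof.
move=> hw hv; have Lw := H1_wL2 hw; have Lv := H1_wL2 hv.
split; first exact: wL2_lin.
exists (fun x => a *: grad w x + grad v x).
by apply: weak_gradient_lin => //; exact: gradP.
Qed.

Lemma grad_lin (a : R) w v i : H1 w -> H1 v ->
  aeD (fun x => grad (fun x => a * w x + v x) x 0 i)
      (fun x => a * grad w x 0 i + grad v x 0 i).
Proof.
move=> hw hv; have Lw := H1_wL2 hw; have Lv := H1_wL2 hv.
have h := weak_gradient_lin a Lw Lv (gradP hw) (gradP hv).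
have := weak_gradient_unique (gradP (H1_lin a hw hv)) h i.
by apply: filterS => x + Dx => /(_ Dx) ->; rewrite !mxE.
Qed.

Definition approx w (e : R) f := [/\ test_function U f, wL2 f,
  forall i, wL2 (fun x => 'D_(basis_vec i) f x), nrm (fun x => f x - w x) <= e &
  forall i, nrm (fun x => 'D_(basis_vec i) f x - grad w x 0 i) <= e].

Lemma test_measurable_on f : test_function U f -> measurable_fun D f.
Proof. by move=> tf; apply: measurable_funTS; exact: test_measurable tf. Qed.

Lemma wL2_sqB_le f w (e : R) : measurable_fun D f -> wL2 w ->
  (\int[mu]_(x in D) (om x * (f x - w x) ^+ 2)%:E <= e%:E)%E -> wL2 f.
Proof.
move=> mf Lw le; have L : wL2 (fun x => f x - w x).
  split; first by apply: measurable_funB => //; case: Lw.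
  by apply: le_lt_trans le _; rewrite ltry.
rewrite (_ : f = fun x => (f x - w x) + w x); first exact: wL2D.
by apply/funext => x; rewrite subrK.
Qed.

(** An epsilon condition on finite norms is easier to combine than limits of extended integrals.
    That the approximants and their derivatives are square integrable is not part of the definition;
    it follows from their finite distance to [w] and to its gradient. *)
Lemma H1_0P w : H1_0 w <-> H1 w /\ forall e : R, 0 < e -> exists f, approx w e f.
Proof.
split=> [[hw [f_ [tf fw fgw]]]|[hw aw]].
  split=> // e e0; have e2 : 0 < e ^+ 2 by rewrite exprn_gt0.
  have pos (g : 'rV[R]_n -> R) : (0 <= \int[mu]_(x in D) (om x * g x ^+ 2)%:E)%E.
    by apply: integral_ge0 => x Dx; rewrite lee_fin mulr_ge0 ?sqr_ge0 ?ltW ?om_gt0.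
  have /ge0_cvge0P - /(_ (fun k => pos _)) /(_ _ e2) h0 := fw.
  have hi i := (ge0_cvge0P (fun k => pos _)).1 (fgw i) _ e2.
  have : \forall k \near \oo, forall i : 'I_n, (\int[mu]_(x in D) (om x *
     ('D_(basis_vec i) (f_ k) x - grad w x 0 i) ^+ 2)%:E <= (e ^+ 2)%:E)%E.
    by apply: filter_forall => i; exact: hi.
  move=> hall; have [k [k0 kall]] := filter_ex (filterI h0 hall).
  have Lf : wL2 (f_ k) by apply: wL2_sqB_le k0; [exact: test_measurable_on|exact: H1_wL2].
  have Ldf i : wL2 (fun x => 'D_(basis_vec i) (f_ k) x).
    apply: wL2_sqB_le (kall i); last exact: grad_wL2.
    exact: test_measurable_on (test_derive _ (tf k)).
  exists (f_ k); split=> // [|i]; apply: nrm_le_EFin; rewrite ?(ltW e0)//.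
    by apply: wL2B => //; exact: H1_wL2.
  by apply: wL2B => //; exact: grad_wL2.
split=> //.
have /choice[f_ fP] : forall k : nat, exists f, approx w k.+1%:R^-1 f.
  by move=> k; apply: aw; rewrite invr_gt0.
have small (g : nat -> 'rV[R]_n -> R) : (forall k, wL2 (g k)) ->
    (forall k, nrm (g k) <= k.+1%:R^-1) ->
    ((fun k => \int[mu]_(x in D) (om x * (g k x) ^+ 2)%:E)%E @ \oo --> 0%E).
  move=> Lg gk; apply/ge0_cvge0P => [k|e e0].
    by apply: integral_ge0 => x Dx; rewrite lee_fin mulr_ge0 ?sqr_ge0 ?ltW ?om_gt0.
  exists (Num.truncn e^-1) => // k /= ek; rewrite nrm_EFin// lee_fin.
  have k1 : k.+1%:R^-1 <= e.
    rewrite -[leRHS]invrK lef_pV2 ?posrE ?invr_gt0//.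
    apply: ltW; apply: lt_le_trans (truncnS_gt _) _; by rewrite ler_nat ltnS.
  apply: le_trans k1; apply: le_trans (gk k).
  rewrite expr2 ler_piMr ?nrm_ge0// (le_trans (gk k))// invf_le1//.
  by rewrite ler1n.
exists f_; split=> [k|| i]; first by case: (fP k).
- apply: small => k; case: (fP k) => // _ Lf _ _ _.
  by apply: wL2B => //; exact: H1_wL2.
- apply: (small (fun k x => 'D_(basis_vec i) (f_ k) x - grad w x 0 i)) => k; case: (fP k) => //.
  by move=> _ _ Lf _ _; apply: wL2B => //; exact: grad_wL2.
Qed.

Lemma H1_0_H1 w : H1_0 w -> H1 w. Proof. by case. Qed.

Lemma H1_0_lin (a : R) w v : H1_0 w -> H1_0 v -> H1_0 (fun x => a * w x + v x).
Proof.
move=> /H1_0P[hw aw] /H1_0P[hv av]; apply/H1_0P; split; first exact: H1_lin.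
move=> e e0; pose c := `|a| + 1; have c0 : 0 < c by rewrite ltr_wpDl.
have [f [tf Lf Ldf fw dfw]] := aw (e / (2 * c)) (divr_gt0 e0 (mulr_gt0 (ltr0Sn _ 1) c0)).
have [g [tg Lg Ldg gv dgv]] := av (e / 2) (divr_gt0 e0 (ltr0Sn _ 1)).
have bound p q : wL2 p -> wL2 q -> nrm p <= e / (2 * c) -> nrm q <= e / 2 ->
    nrm (fun x => a * p x + q x) <= e.
  move=> Lp Lq pe qe; apply: le_trans (nrm_D mD mom om_gt0 (wL2Z mD mom om_gt0 a Lp) Lq) _.
  rewrite nrmZ// [leRHS](_ : _ = e / 2 + e / 2); last by field.
  apply: lerD => //; apply: (@le_trans _ _ (c * (e / (2 * c)))).
    by apply: ler_pM; rewrite ?nrm_ge0// lerDl.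
  by rewrite le_eqVlt; apply/orP; left; apply/eqP; field; rewrite gt_eqF.
exists (fun x => a * f x + g x); split.
- exact: test_lin.
- exact: wL2_lin.
- move=> i; under eq_fun do rewrite (test_derive_lin _ _ _ tf tg).
  exact: wL2_lin.
- under eq_fun do rewrite opprD addrACA -mulrBr.
  by apply: bound => //; apply: wL2B => //; exact: H1_wL2.
move=> i; under eq_fun do rewrite (test_derive_lin _ _ _ tf tg).
rewrite (@eq_nrm _ _ _ _ _ _ mD mom _
   (fun x => a * ('D_(basis_vec i) f x - grad w x 0 i) +
                 ('D_(basis_vec i) g x - grad v x 0 i))).
- by apply: bound => //; apply: wL2B => //; exact: grad_wL2.
- have [] := wL2B mD mom om_gt0 (wL2_lin mD mom om_gt0 a (Ldf i) (Ldg i))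
    (grad_wL2 i (H1_lin a hw hv)) => //.
- by have [] := wL2_lin mD mom om_gt0 a (wL2B mD mom om_gt0 (Ldf i) (grad_wL2 i hw))
    (wL2B mD mom om_gt0 (Ldg i) (grad_wL2 i hv)).
by apply: filterS (grad_lin a i hw hv) => x + Dx => /(_ Dx) ->; ring.
Qed.

Lemma H1_0_0 : H1_0 (fun=> 0).
Proof.
have h0 : weak_gradient om D (fun=> 0) (fun=> 0).
  apply/weak_gradientP => i; rewrite (_ : (fun x => _) = fun=> 0); last first.
    by apply/funext => x; rewrite mxE.
  by split=> [|f _]; [exact: wL2_0|rewrite !ip0l oppr0].
have H10 : H1 (fun=> 0) by split; [exact: wL2_0|exists (fun=> 0)].
have D0 (i : 'I_n) : (fun x => 'D_(basis_vec i) (fun _ : 'rV[R]_n => 0 : R) x) = fun=> 0.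
  by apply/funext => x; rewrite derive_cst.
apply/H1_0P; split=> // e e0; exists (fun=> 0); split.
- exact: test0.
- exact: wL2_0.
- by move=> i; rewrite D0; exact: wL2_0.
- by under eq_fun do rewrite subr0; rewrite nrm0 ltW.
move=> i; under eq_fun do rewrite derive_cst.
have m0 : measurable_fun D (fun x => 0 - grad (fun=> 0) x 0 i).
  by case: (wL2B mD mom om_gt0 (wL2_0 (leb n) D om) (grad_wL2 i H10)).
rewrite (@eq_nrm _ _ _ _ _ _ mD mom _ (fun=> 0) m0) ?nrm0 ?ltW//.
apply: filterS (weak_gradient_unique (gradP H10) h0 i) => x + Dx => /(_ Dx) ->.
by rewrite mxE subrr.
Qed.

(** Functions and gradient components converge separately in L^2. By Cauchy-Schwarz against a fixed
    test function the weak gradient identity passes to the limit, so the limit of the gradients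
    agrees with [grad w] almost everywhere. Test functions close to a late term are close to the
    limit. *)
Lemma H1_0_complete (w_ : nat -> 'rV[R]_n -> R) : (forall k, H1_0 (w_ k)) ->
  (forall e : R, 0 < e -> exists N, forall j k, (N <= j)%N -> (N <= k)%N ->
    nrm (fun x => w_ j x - w_ k x) <= e /\
    forall i, nrm (fun x => grad (w_ j) x 0 i - grad (w_ k) x 0 i) <= e) ->
  exists w, H1_0 w /\ forall e : R, 0 < e -> exists N, forall k, (N <= k)%N ->
    nrm (fun x => w_ k x - w x) <= e /\
    forall i, nrm (fun x => grad (w_ k) x 0 i - grad w x 0 i) <= e.
Proof.
move=> Hw cauchy.
have h1 k : H1 (w_ k) by apply: H1_0_H1.
have Lw k : wL2 (w_ k) by exact: H1_wL2.
have Lg k i : wL2 (fun x => grad (w_ k) x 0 i) by exact: grad_wL2.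
have [w [Lw0 cvw]] : exists w, wL2 w /\ forall e : R, 0 < e -> exists N,
    forall k, (N <= k)%N -> nrm (fun x => w_ k x - w x) <= e.
  apply: wL2_complete => // e /cauchy[N NP]; exists N => j k Nj Nk.
  by case: (NP j k Nj Nk).
have /choice[G GP] : forall i : 'I_n, exists g, wL2 g /\ forall e : R, 0 < e -> exists N,
    forall k, (N <= k)%N -> nrm (fun x => grad (w_ k) x 0 i - g x) <= e.
  move=> i; apply: (wL2_complete mD mom om_gt0 (f_ := fun k x => grad (w_ k) x 0 i)) => //.
  move=> e /cauchy[N NP]; exists N => j k Nj Nk.
  by case: (NP j k Nj Nk).
pose GG x : 'rV[R]_n := \row_i G i x.
have wgG : weak_gradient om D w GG.
  apply/weak_gradientP => i; have [LGi cvG] := GP i.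
  rewrite (_ : (fun x => GG x 0 i) = G i); last first.
    by apply/funext => x; rewrite mxE.
  split=> // f tf; have Lf := test_wL2 tf.
  have Ldf := test_wL2 (test_derive (basis_vec i) tf).
  set df := fun x => _ / _ in Ldf *; set f' := fun x => _ / _ in Lf *.
  apply/eqP; rewrite -subr_eq0 opprK -normr_le0.
  apply/ler_addgt0Pr => e e0; rewrite add0r.
  pose c := nrm df + nrm f' + 1.
  have c0 : 0 < c by rewrite ltr_wpDl// addr_ge0 ?nrm_ge0.
  have [N NP] := cvw _ (divr_gt0 e0 c0); have [M MP] := cvG _ (divr_gt0 e0 c0).
  pose k := maxn N M.
  have [_ eg] := (weak_gradientP _ _).1 (gradP (h1 k)) i.
  have -> : ip w df + ip (G i) f' =
      - ip (fun x => w_ k x - w x) df - ip (fun x => grad (w_ k) x 0 i - G i x) f'.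
    by rewrite !ipBl//; have := eg f tf; rewrite -/df -/f' => ->; ring.
  have b1 := ip_CS mD mom om_gt0 (wL2B mD mom om_gt0 (Lw k) Lw0) Ldf.
  have b2 := ip_CS mD mom om_gt0 (wL2B mD mom om_gt0 (Lg k i) LGi) Lf.
  have n1 := NP k (leq_maxl _ _); have n2 := MP k (leq_maxr _ _).
  apply: le_trans (ler_normB _ _) _; rewrite normrN.
  apply: (@le_trans _ _ (e / c * nrm df + e / c * nrm f')).
    apply: lerD; [apply: le_trans b1 _|apply: le_trans b2 _];
      by rewrite ler_wpM2r ?nrm_ge0.
  rewrite -mulrDr mulrAC ler_pdivrMr// ler_wpM2l ?(ltW e0)// lerDl ler01//.
have H1w : H1 w by split=> //; exists GG.
have gE i : aeD (fun x => grad w x 0 i) (G i).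
  apply: filterS (weak_gradient_unique (gradP H1w) wgG i) => x + Dx => /(_ Dx) ->.
  by rewrite mxE.
have cvg e : 0 < e -> exists N, forall k, (N <= k)%N ->
    nrm (fun x => w_ k x - w x) <= e /\
    forall i, nrm (fun x => grad (w_ k) x 0 i - grad w x 0 i) <= e.
  move=> e0; have [N NP] := cvw e e0.
  have /choice[M MP] : forall i : 'I_n, exists M, forall k, (M <= k)%N ->
      nrm (fun x => grad (w_ k) x 0 i - grad w x 0 i) <= e.
    move=> i; have [LGi /(_ e e0)[M MP]] := GP i; exists M => k Mk.
    rewrite (@eq_nrm _ _ _ _ _ _ mD mom _ (fun x => grad (w_ k) x 0 i - G i x)); first exact: MP.
    - by case: (wL2B mD mom om_gt0 (Lg k i) (grad_wL2 i H1w)).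
    - by case: (wL2B mD mom om_gt0 (Lg k i) LGi).
    by apply: filterS (gE i) => x + Dx => /(_ Dx) ->.
  exists (maxn N (\max_i M i)) => k; rewrite geq_max => /andP[Nk Mk]; split.
    exact: NP.
  by move=> i; apply: MP; apply: leq_trans Mk; exact: leq_bigmax.
exists w; split=> //; apply/H1_0P; split=> // e e0.
have e2 : 0 < e / 2 by rewrite divr_gt0.
have [N /(_ N (leqnn N))[n1 n2]] := cvg _ e2.
have [_ /(_ _ e2)[f [tf Lf Ldf fw dfw]]] := (H1_0P _).1 (Hw N).
have tri (p q r : 'rV[R]_n -> R) : wL2 p -> wL2 q -> wL2 r ->
    nrm (fun x => p x - q x) <= e / 2 -> nrm (fun x => q x - r x) <= e / 2 ->
    nrm (fun x => p x - r x) <= e.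
  move=> Lp Lq Lr pq qr.
  have -> : (fun x => p x - r x) = (fun x => (p x - q x) + (q x - r x)).
    by apply/funext => x; rewrite addrA subrK.
  apply: le_trans (nrm_D mD mom om_gt0 (wL2B mD mom om_gt0 Lp Lq) (wL2B mD mom om_gt0 Lq Lr)) _.
  by rewrite (le_trans (lerD pq qr))// -splitr.
exists f; split=> //; first exact: tri n1.
by move=> i; apply: tri (dfw i) (n2 i) => //; exact: grad_wL2.
Qed.

End sobolev.

(** * Poincare's inequality along one coordinate *)

Section poincare_1d.
Context {R : realType}.
Local Notation leb1 := (@lebesgue_measure R).

(* With c = u t / (t - a), expanding (u' - c)^2 >= 0 gives u'^2 >= (2 c u - c^2 id)',
   whose integral over [a, t] is (u t)^2 / (t - a). *)
Lemma poincare_pointwise (u u' : R -> R) (a b t : R) : continuous u' ->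
  (forall x, is_derive x (1 : R) u (u' x)) -> u a = 0 -> a <= t <= b ->
  ((u t ^+ 2)%:E <= (b - a)%:E * \int[leb1]_(x in `[a, b]) (u' x ^+ 2)%:E)%E.
Proof.
move=> cu' du ua /andP[at_ tb].
have int0 : (0 <= \int[leb1]_(x in `[a, b]) (u' x ^+ 2)%:E)%E.
  by apply: integral_ge0 => x _; rewrite lee_fin sqr_ge0.
have [<-|ta] := eqVneq a t.
  by rewrite ua expr0n mule_ge0// lee_fin subr_ge0 (le_trans at_ tb).
have {ta}at_ : a < t by rewrite lt_neqAle ta.
have L0 : 0 < t - a by rewrite subr_gt0.
pose c := u t / (t - a).
pose F x := 2 * c * u x - c ^+ 2 * x.
pose F' x := 2 * c * u' x - c ^+ 2.
have dF x : is_derive x (1 : R) F (F' x).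
  have hid : is_derive x (1 : R) (id : R -> R) 1 by exact: is_derive_id.
  have h := is_deriveB (is_deriveZ (2 * c) (du x)) (is_deriveZ (c ^+ 2) hid).
  by apply: (is_derive_eq h); rewrite /GRing.scale/= /F'; ring.
have cF x : {for x, continuous F}.
  by apply: differentiable_continuous; apply/derivable1_diffP; case: (dF x).
have cF' : continuous F'.
  apply: continuous_fD; last exact: continuous_fC.
  by apply: continuous_fM => //; exact: continuous_fC.
have FTC : (\int[leb1]_(x in `[a, t]) (F' x)%:E = (F t)%:E - (F a)%:E)%E.
  apply: continuous_FTC2 => //.
  - exact: continuous_subspaceT.
  - split.
    + by move=> x _; case: (dF x).
    + exact/cvg_at_right_filter/cF.
    + exact/cvg_at_left_filter/cF.
  - by move=> x _; rewrite derive1E; case: (dF x).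
have csq : continuous (fun x => u' x ^+ 2).
  by under [X in continuous X]eq_fun do rewrite expr2; exact: continuous_fM.
have mF' : measurable_fun setT F' by exact: continuous_measurable_fun.
have msq : measurable_fun setT (fun x => u' x ^+ 2) by exact: continuous_measurable_fun.
have i1 : leb1.-integrable `[a, t] (EFin \o F').
  apply: continuous_compact_integrable; first exact: segment_compact.
  exact: continuous_subspaceT.
have i2 : leb1.-integrable `[a, t] (EFin \o (fun x => u' x ^+ 2)).
  apply: continuous_compact_integrable; first exact: segment_compact.
  exact: continuous_subspaceT.
have le1 : (\int[leb1]_(x in `[a, t]) (F' x)%:E <=
            \int[leb1]_(x in `[a, t]) (u' x ^+ 2)%:E)%E.
  apply: le_integral => // x _; rewrite lee_fin /F'.
  by have := sqr_ge0 (u' x - c); rewrite sqrrB -mulr_natr; lra.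
have le2 : (\int[leb1]_(x in `[a, t]) (u' x ^+ 2)%:E <=
            \int[leb1]_(x in `[a, b]) (u' x ^+ 2)%:E)%E.
  apply: ge0_subset_integral => //.
  - by apply/measurable_EFinP; exact: measurable_funTS.
  - by move=> x _; rewrite lee_fin sqr_ge0.
  - by apply: subset_itvl; rewrite bnd_simp.
have FE : F t - F a = u t ^+ 2 / (t - a).
  rewrite /F ua /c; field; rewrite gt_eqF//.
have := le_trans le1 le2; rewrite FTC -EFinB FE => le.
apply: (@le_trans _ _ ((t - a)%:E * (u t ^+ 2 / (t - a))%:E)%E).
  by rewrite -EFinM lee_fin mulrC divfK// gt_eqF.
apply: lee_pmul => //; rewrite lee_fin.
- exact: ltW.
- by rewrite divr_ge0 ?sqr_ge0// ltW.
- by rewrite lerD2r.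
Qed.

(** One factor [2 * M] is the length [b - a] in the pointwise bound, the other comes from
    integrating that bound over the interval. *)
Lemma poincare_1d (u u' : R -> R) (M : R) : 0 < M -> continuous u' ->
  (forall x, is_derive x (1 : R) u (u' x)) -> (forall x, M <= `|x| -> u x = 0) ->
  (\int[leb1]_x (u x ^+ 2)%:E <=
   ((2 * M) ^+ 2)%:E * \int[leb1]_x (u' x ^+ 2)%:E)%E.
Proof.
move=> M0 cu' du u0.
have cu : continuous u.
  move=> x; apply: differentiable_continuous; apply/derivable1_diffP.
  by case: (du x).
have csq : continuous (fun x => u' x ^+ 2).
  by under [X in continuous X]eq_fun do rewrite expr2; exact: continuous_fM.
have msq : measurable_fun setT (fun x => u' x ^+ 2) by exact: continuous_measurable_fun.
have cu2 : continuous (fun x => u x ^+ 2).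
  by under [X in continuous X]eq_fun do rewrite expr2; exact: continuous_fM.
have mu2 : measurable_fun setT (fun x => u x ^+ 2) by exact: continuous_measurable_fun.
pose A := (\int[leb1]_(x in `[(- M)%R, M]) (u' x ^+ 2)%:E)%E.
have A0 : (0 <= A)%E by apply: integral_ge0 => x _; rewrite lee_fin sqr_ge0.
have MM : M - - M = 2 * M by ring.
have M20 : 0 <= 2 * M by rewrite mulr_ge0// ltW.
have -> : (\int[leb1]_x (u x ^+ 2)%:E =
    \int[leb1]_(x in `[(- M)%R, M]) (u x ^+ 2)%:E)%E.
  apply/esym/eq_integral_supp => // x _ /= /negP; rewrite in_itv/= -ler_norml -ltNge.
  by move=> /ltW/u0 ->; rewrite expr0n.
apply: (@le_trans _ _ (\int[leb1]_(x in `[(- M)%R, M]) (cst ((2 * M)%:E * A)%E x))%E).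
  apply: ge0_le_integral => //.
  - by move=> x _; rewrite lee_fin sqr_ge0.
  - by apply/measurable_EFinP; exact: measurable_funTS.
  - move=> x xM; rewrite /= /A -MM; apply: poincare_pointwise => //.
    by rewrite u0// normrN gtr0_norm.
rewrite integral_cst//.
have lM : leb1 `[(- M)%R, M]%classic = (2 * M)%:E.
  by rewrite lebesgue_measure_itv/= lte_fin gtrN// -EFinB MM.
rewrite [X in (_ * X <= _)%E](_ : _ = (2 * M)%:E); last exact: lM.
rewrite muleAC -EFinM -expr2; apply: lee_pmul => //; rewrite ?lee_fin ?sqr_ge0//.
apply: ge0_subset_integral => //; first exact/measurable_EFinP.
by move=> x _; rewrite lee_fin sqr_ge0.
Qed.

End poincare_1d.

Section slices.
Context {R : realType} (n : nat).
Local Notation leb1 := (@lebesgue_measure R).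
Local Notation e0 := (basis_vec (R:=R) (ord0 : 'I_n.+1)).

Lemma cons_rVD (h t : R) (v : 'rV[R]_n) :
  cons_rV (h + t, v) = h *: e0 + cons_rV (t, v) :> 'rV[R]_n.+1.
Proof.
apply/rowP => i; rewrite [RHS]mxE [X in _ = X + _]mxE /basis_vec.
rewrite [X in _ = _ * X + _]mxE; case: (unliftP ord0 i) => [j|] ->.
  by rewrite !cons_rVS/= mulr0 add0r.
by rewrite !cons_rV0/= mulr1.
Qed.

Lemma continuous_slice (f : 'rV[R]_n.+1 -> R) v : continuous f ->
  continuous (fun t : R => f (cons_rV (t, v))).
Proof.
move=> cf; rewrite (_ : (fun t => _) = f \o (fun t : R => t *: e0 + cons_rV (0, v))); last first.
  by apply/funext => t /=; rewrite -cons_rVD addr0.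
move=> t; apply: (@continuous_comp _ _ _ (fun t : R => t *: e0 + cons_rV (0, v)) f); last exact: cf.
by apply: (@continuousD _ _ _ (fun t : R => t *: e0)); [exact: scalel_continuous|exact: cvg_cst].
Qed.

Lemma is_derive_slice (f : 'rV[R]_n.+1 -> R) v (t df : R) :
  is_derive (cons_rV (t, v) : 'rV[R]_n.+1) e0 f df ->
  is_derive t (1 : R) (fun t : R => f (cons_rV (t, v))) df.
Proof.
have E : (fun h : R => h^-1 *: ((f \o shift (cons_rV (t, v))) (h *: e0) - f (cons_rV (t, v)))) =
  (fun h : R => h^-1 *: (((fun t : R => f (cons_rV (t, v))) \o shift t) (h *: 1) - f (cons_rV (t, v)))).
  by apply/funext => h /=; rewrite -cons_rVD /GRing.scale/= mulr1.
move=> [df1 df2]; apply: DeriveDef.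
  by move: df1; rewrite /derivable E.
by rewrite -df2 /derive E.
Qed.

(* The weight does not depend on the first coordinate, and the first coordinate
   is bounded on the support. *)
Lemma poincare_test (f : 'rV[R]_n.+1 -> R) (U : set 'rV[R]_n.+1)
    (om : 'rV[R]_n.+1 -> R) (M : R) : 0 < M -> test_function U f ->
  (forall x, U x -> `|x 0 ord0| < M) ->
  (forall t v, om (cons_rV (t, v)) = om (cons_rV (0, v))) ->
  measurable_fun setT om -> (forall x, 0 <= om x) ->
  (\int[leb n.+1]_x (om x * f x ^+ 2)%:E <=
   ((2 * M) ^+ 2)%:E * \int[leb n.+1]_x (om x * ('D_e0 f x) ^+ 2)%:E)%E.
Proof.
move=> M0 tf UM omt mom om0.
have mf := test_measurable tf; have mdf := test_measurable (test_derive e0 tf).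
have mg (g : 'rV[R]_n.+1 -> R) : measurable_fun setT g ->
    measurable_fun setT (fun x => (om x * g x ^+ 2)%:E).
  move=> mg; apply/measurable_EFinP; apply: measurable_funM => //.
  exact: measurable_funX.
have pos (g : 'rV[R]_n.+1 -> R) x : (0 <= (om x * g x ^+ 2)%:E)%E.
  by rewrite lee_fin mulr_ge0 ?sqr_ge0.
rewrite (leb_ge0_fubini (mg f mf) (pos f)) (leb_ge0_fubini (mg _ mdf) (pos _)).
have mslice (g : 'rV[R]_n.+1 -> R) : measurable_fun setT g ->
    measurable_fun setT (fun v => \int[leb1]_t (om (cons_rV (t, v)) *
      g (cons_rV (t, v)) ^+ 2)%:E)%E.
  move=> /mg mg'; have mc : measurable_fun setT
    ((fun x => (om x * g x ^+ 2)%:E) \o @cons_rV R n).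
    exact: measurableT_comp mg' (@measurable_cons_rV R n).
  exact: (@measurable_fun_fubini_tonelli_G _ _ _ _ _ leb1 _ mc (fun x => pos g _)).
have M20 : (0 <= ((2 * M) ^+ 2)%:E)%E by rewrite lee_fin sqr_ge0.
have int0 (g : 'rV[R]_n.+1 -> R) v : (0 <= \int[leb1]_t (om (cons_rV (t, v)) *
      g (cons_rV (t, v)) ^+ 2)%:E)%E by apply: integral_ge0.
rewrite -(ge0_integralZl _ measurableT (mslice _ mdf) (fun v _ => int0 _ v) M20).
apply: ge0_le_integral => //.
- exact: (mslice _ mf).
- by apply: measurable_funeM; exact: (mslice _ mdf).
move=> v _; pose c := om (cons_rV (0, v)).
have c0 : 0 <= c by exact: om0.
have slice (g : 'rV[R]_n.+1 -> R) : measurable_fun setT (fun t : R => g (cons_rV (t, v))) ->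
    (\int[leb1]_t (om (cons_rV (t, v)) * g (cons_rV (t, v)) ^+ 2)%:E =
     c%:E * \int[leb1]_t (g (cons_rV (t, v)) ^+ 2)%:E)%E.
  move=> mgv; rewrite -ge0_integralZl//.
  - by apply: eq_integral => t _; rewrite omt EFinM.
  - by apply/measurable_EFinP; exact: measurable_funX.
  - by move=> t _; rewrite lee_fin sqr_ge0.
have cu := continuous_slice (v := v) (test_continuous tf).
have cu' := continuous_slice (v := v) (test_continuous (test_derive e0 tf)).
have mfv : measurable_fun setT (fun t : R => f (cons_rV (t, v))).
  exact: continuous_measurable_fun.
have mdfv : measurable_fun setT (fun t : R => 'D_e0 f (cons_rV (t, v))).
  exact: continuous_measurable_fun.
rewrite (slice f mfv); have := slice ('D_e0 f) mdfv => /= ->.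
rewrite muleCA; apply: lee_pmul => //.
  by apply: integral_ge0 => t _; rewrite lee_fin sqr_ge0.
apply: poincare_1d => // [t|t Mt].
  by apply: is_derive_slice; exact: test_is_derive tf.
(* The support lies in [U], where the first coordinate is smaller than [M] in absolute value, so the
   slice vanishes from [M] on. *)
have [_ [K [cK KU Kf]]] := tf; apply: Kf => /KU/UM.
by rewrite cons_rV0/= ltNge Mt.
Qed.

End slices.

(** * Open sets, cylinders and Lipschitz functions *)

Section geometry.
Context {R : realType}.

Lemma dotvE n (u v : 'rV[R]_n) : dotv u v = \sum_(j < n) u 0 j * v 0 j.
Proof. by rewrite /dotv mxE; apply: eq_bigr => j _; rewrite mxE. Qed.

Lemma continuous_dotv n (a : 'rV[R]_n) : continuous (dotv a).
Proof.
rewrite (_ : dotv a = fun x => \sum_(j < n) a 0 j * x 0 j); last first.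
  by apply/funext => x; exact: dotvE.
elim: (index_enum _) => [|j r IH].
  by under [X in continuous X]eq_fun do rewrite big_nil; exact: continuous_fC.
under [X in continuous X]eq_fun do rewrite big_cons; apply: continuous_fD => //.
by apply: continuous_fM; [exact: continuous_fC|exact: coord_continuous].
Qed.

Lemma convex_polytope_open d (Omega : set 'rV[R]_d) : convex_polytope Omega -> open Omega.
Proof.
move=> [_ _ [N [a [b ->]]]]; rewrite openE => x h.
have near_i i : \forall y \near x, dotv (a i) y < b i.
  have /continuousP/(_ `]-oo, b i[%classic) := @continuous_dotv _ (a i).
  move=> /(_ (interval_open _ _)) o.
  have hx : (dotv (a i) @^-1` `]-oo, b i[%classic) x by rewrite /= in_itv /=.
  have nb := open_nbhs_nbhs (conj (o isT isT) hx).
  by apply: filterS nb => y /=; rewrite in_itv.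
have all_i : \forall y \near x, forall i, dotv (a i) y < b i.
  exact: (filter_forall (nbhs_filter x) near_i).
by rewrite /interior /=; apply: filterS all_i => y.
Qed.

Lemma coord_le_norm n (x : 'rV[R]_n) i : `|x 0 i| <= `|x|.
Proof.
rewrite [X in _ <= X]mx_normrE.
exact: (le_bigmax_cond 0 (fun j : 'I_1 * 'I_n => `|x j.1 j.2|) (j := (0, i))).
Qed.

Lemma bounded_set_coord d (Omega : set 'rV[R]_d) : bounded_set Omega ->
  exists2 M : R, 0 < M & forall x, Omega x -> forall i, `|x 0 i| < M.
Proof.
move=> [M [_ MP]]; exists (`|M| + 2); first by rewrite ltr_wpDl.
move=> x Ox i; apply: le_lt_trans (coord_le_norm x i) _.
have M1 : M < `|M| + 1 by rewrite (le_lt_trans (ler_norm M))// ltrDl.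
by apply: le_lt_trans (MP _ M1 _ Ox) _; rewrite ltrD2l ltr1n.
Qed.

Lemma ball_coord n (x y : 'rV[R]_n) (e : R) : ball x e y ->
  forall i, `|x 0 i - y 0 i| < e.
Proof. by move=> [_ h] i; exact: h. Qed.

Variable d : nat.
Variable Omega : set 'rV[R]_d.
Hypothesis oO : open Omega.

Lemma ypartE (x : 'rV[R]_(d + 1)) : ypart x = x 0 (rshift d 0).
Proof. by rewrite /ypart mxE. Qed.

Lemma continuous_ypart : continuous (@ypart R d).
Proof.
rewrite (_ : @ypart R d = fun x => x 0 (rshift d 0)); first exact: coord_continuous.
by apply/funext => x; exact: ypartE.
Qed.

Lemma open_full_cylinder : open (full_cylinder Omega).
Proof.
rewrite openE => x Ox; have /nbhs_ballP[e /= e0 eO] := open_nbhs_nbhs (conj oO Ox).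
apply/nbhs_ballP; exists e => //= y xy; apply: eO; apply: box_ball => // i.
by rewrite !xpartE; exact: ball_coord.
Qed.

Lemma open_cylinder : open (cylinder Omega).
Proof.
rewrite (_ : cylinder Omega = full_cylinder Omega `&` (@ypart R d @^-1` `]0, +oo[%classic)).
  apply: openI; first exact: open_full_cylinder.
  by move/continuousP: continuous_ypart; apply; exact: interval_open.
by apply/seteqP; split => y /=; rewrite in_itv/= andbT.
Qed.

Lemma lipschitz_measurable (D : set 'rV[R]_d) (f : 'rV[R]_d -> R) (M : R) : open D -> 0 < M ->
  (forall x y, D x -> D y -> `|f x - f y| <= M * `|x - y|) -> measurable_fun D f.
Proof.
move=> oD M0 fL; apply: (measurability _ (RGenOInfty.measurableE R)) => _ [_ [a ->] <-].
apply: open_measurable_rV; rewrite openE => x [Dx]; rewrite /= in_itv/= andbT => afx.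
have /nbhs_ballP[e /= e0 eD] := open_nbhs_nbhs (conj oD Dx).
have d0 : 0 < (f x - a) / M by rewrite divr_gt0// subr_gt0.
apply/nbhs_ballP; exists (Num.min e ((f x - a) / M)); first by rewrite /= lt_min e0.
move=> y; rewrite -ball_normE /= lt_min => /andP[xye xyd].
have Dy : D y by apply: eD; rewrite -ball_normE.
split=> //=; rewrite in_itv/= andbT.
have := fL x y Dx Dy; rewrite ler_norml => /andP[_]; move: xyd.
rewrite ltr_pdivlMr// mulrC; lra.
Qed.

End geometry.

(** * The weight y^alpha *)

Section weight.
Context {R : realType} (d : nat) (s : R).
Local Notation om := (@yweight R d s).

Lemma measurable_ypart : measurable_fun setT (@ypart R d).
Proof. by apply: continuous_measurable_rV; exact: continuous_ypart. Qed.

Lemma measurable_yweight : measurable_fun setT om.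
Proof. exact: measurableT_comp (measurable_powR _) measurable_ypart. Qed.

Lemma measurable_yweightV : measurable_fun setT (fun x => (om x)^-1).
Proof.
under eq_fun do rewrite /yweight -powRN.
exact: measurableT_comp (measurable_powR _) measurable_ypart.
Qed.

Lemma yweight_gt0 (Omega : set 'rV[R]_d) x : cylinder Omega x -> 0 < om x.
Proof. by move=> [_ y0]; exact: powR_gt0. Qed.

(** Whatever the sign of the exponent, the inverse of the weight is continuous for [y > 0], hence
    bounded above on a compact subset of the cylinder. The maximum with 1 makes the bound
    invertible. *)
Lemma yweight_lower_bound (Omega : set 'rV[R]_d) (K : set 'rV[R]_(d + 1)) : compact K ->
  K `<=` cylinder Omega -> exists2 c : R, 0 < c & forall x, K x -> c <= om x.
Proof.
move=> cK KD.
have cV : {within K, continuous (fun x : 'rV[R]_(d + 1) => (om x)^-1)}.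
  apply: continuous_in_subspaceT => x /[!inE] Kx.
  have [_ y0] := KD _ Kx; rewrite /yweight.
  have -> : (fun x : 'rV[R]_(d + 1) => (ypart x `^ (1 - 2 * s))^-1) =
      (fun y => y `^ (- (1 - 2 * s))) \o (@ypart R d).
    by apply/funext => z /=; rewrite powRN.
  apply: (@continuous_comp _ _ _ (@ypart R d)); first exact: continuous_ypart.
  apply: differentiable_continuous; apply/derivable1_diffP.
  by case: (is_derive1_powR (- (1 - 2 * s)) y0).
have [M MP] := compact_continuous_bounded cK cV.
exists (Num.max M 1)^-1; first by rewrite invr_gt0 lt_max ltr01 orbT.
move=> x Kx; have ox := yweight_gt0 (KD _ Kx).
rewrite -[leRHS]invrK lef_pV2 ?posrE ?invr_gt0 ?lt_max ?ltr01 ?orbT//.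
by rewrite le_max MP.
Qed.

End weight.

(** * Essentially bounded functions and their lift to the cylinder *)

Section Linf.
Context {R : realType} (d : nat) (Omega : set 'rV[R]_d).
Hypothesis mO : measurable Omega.
Implicit Types h : 'rV[R]_d -> R.

Lemma Linf_enorm_leP h (c : R) : 0 <= c -> 
  (Linf_enorm Omega h <= c%:E)%E <-> {ae leb d, forall x, Omega x -> `|h x| <= c}.
Proof.
move=> c0; rewrite /Linf_enorm unlock.
(* The norm with exponent [+oo] is 0 by convention on a space of measure 0; there both sides of the
   equivalence hold. *)
have [mu0|/negP mu0] := boolP (0 < leb d [set: 'rV[R]_d])%E; last first.
  split=> _; last by rewrite lee_fin.
  exists setT; split=> //; apply/eqP; rewrite -measure_le0.
  by move/negP: mu0; rewrite -leNgt.
split=> [/ess_supP|h0].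
  by apply: filterS => x /= + Ox; rewrite lee_fin indicE mem_set// mul1r.
apply/ess_supP; apply: filterS h0 => x h1; rewrite /=; rewrite lee_fin indicE; have [Ox|nOx] := pselect (Omega x).
  by rewrite mem_set// mul1r h1.
by rewrite memNset// mul0r normr0.
Qed.

Lemma Linf_enorm_ge0 h : (0 <= Linf_enorm Omega h)%E. Proof. exact: Lnorm_ge0. Qed.

Lemma Linf_norm_ge0 h : 0 <= Linf_norm Omega h.
Proof. by rewrite fine_ge0// Linf_enorm_ge0. Qed.

Lemma Linf_ae h : Linf Omega h ->
  {ae leb d, forall x, Omega x -> `|h x| <= Linf_norm Omega h}.
Proof.
move=> [_ fin]; apply/Linf_enorm_leP; first exact: Linf_norm_ge0.
by rewrite /Linf_norm fineK// ge0_fin_numE// Linf_enorm_ge0.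
Qed.

Lemma Linf_of_ae h (c : R) : 0 <= c -> measurable_fun Omega h ->
  {ae leb d, forall x, Omega x -> `|h x| <= c} -> Linf Omega h /\ Linf_norm Omega h <= c.
Proof.
move=> c0 mh /(Linf_enorm_leP h c0) le.
have fin : Linf_enorm Omega h \is a fin_num.
  by rewrite ge0_fin_numE ?Linf_enorm_ge0// (le_lt_trans le)// ltry.
by split; [split=> //; rewrite (le_lt_trans le)// ltry|rewrite -lee_fin fineK].
Qed.

Lemma Linf_lin (a : R) h k : Linf Omega h -> Linf Omega k ->
  Linf Omega (fun x => a * h x + k x) /\
  Linf_norm Omega (fun x => a * h x + k x) <= `|a| * Linf_norm Omega h + Linf_norm Omega k.
Proof.
move=> Lh Lk; apply: Linf_of_ae.
- by rewrite addr_ge0 ?mulr_ge0 ?Linf_norm_ge0.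
- by apply: measurable_funD; [apply: measurable_funM => //; case: Lh|case: Lk].
apply: filterS2 (Linf_ae Lh) (Linf_ae Lk) => x hx kx Ox.
rewrite (le_trans (ler_normD _ _))// lerD ?kx// normrM ler_wpM2l// hx//.
Qed.

Lemma ae_xpart (P : 'rV[R]_d -> Prop) : {ae leb d, forall x, P x} ->
  {ae leb (d + 1), forall x : 'rV[R]_(d + 1), P (xpart x)}.
Proof.
move=> [N [mN N0 PN]]; exists (@xpart R d @^-1` N); split.
- by have := @measurable_xpart R d measurableT N mN; rewrite setTI.
- exact: leb_null_cylinder.
- by move=> x nP; apply: PN.
Qed.

Lemma measurable_comp_xpart h : measurable_fun Omega h ->
  measurable_fun (cylinder Omega) (fun x => h (xpart x)).
Proof.
move=> mh; have mE : measurable_fun setT (h \_ Omega) by exact/(measurable_restrictT _ mO).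
have : measurable_fun setT ((h \_ Omega) \o @xpart R d).
  exact: measurableT_comp mE (@measurable_xpart R d).
move=> /(measurable_funTS (D := cylinder Omega)).
by apply: eq_measurable_fun => x /[!inE] -[Ox _] /=; rewrite patchE mem_set.
Qed.

End Linf.

(** * The energy space on the cylinder *)

Section HL.
Context {R : realType} (d : nat).
Variables (Omega : set 'rV[R]_d.+1) (s M : R).
Hypotheses (oO : open Omega) (M0 : 0 < M)
  (OM : forall x, Omega x -> forall i, `|x 0 i| < M).
Local Notation n := (d.+1 + 1)%N.
Local Notation D := (cylinder Omega).
Local Notation U := (full_cylinder Omega).
Local Notation om := (@yweight R d.+1 s).
Local Notation wL2 := (wL2 (leb n) D om).
Local Notation ip := (ip (leb n) D om).
Local Notation nrm := (nrm (leb n) D om).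
Local Notation aeD := (aeD (leb n) D).
Local Notation HL := (HL Omega s).
Local Notation gr := (HL_grad Omega s).
Local Notation N := (HL_norm Omega s).
Implicit Types w v : 'rV[R]_n -> R.

Lemma measurable_cylinder : measurable D.
Proof. by apply: open_measurable_rV; exact: open_cylinder. Qed.

Let mD := measurable_cylinder.
Let mom : measurable_fun D om := measurable_funTS (@measurable_yweight R d.+1 s).
Let mVom : measurable_fun D (fun x => (om x)^-1) :=
  measurable_funTS (@measurable_yweightV R d.+1 s).
Let om_gt0 := @yweight_gt0 R d.+1 s Omega.
Let om_loc := @yweight_lower_bound R d.+1 s Omega.
Let oD := open_cylinder oO.

Lemma HL_lin a w v : HL w -> HL v -> HL (fun x => a * w x + v x).
Proof. exact: (H1_0_lin oD mom mVom om_gt0 om_loc). Qed.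

Lemma HL_0 : HL (fun=> 0).
Proof. exact: (H1_0_0 U oD mom mVom om_gt0 om_loc). Qed.

Lemma HL_sub w v : HL w -> HL v -> HL (fun x => w x - v x).
Proof.
move=> hw hv; rewrite (_ : (fun x => _) = fun x => -1 * v x + w x); first exact: HL_lin.
by apply/funext => x; ring.
Qed.

Lemma HL_wL2 w : HL w -> wL2 w. Proof. by move=> [[]]. Qed.

Lemma HL_H1 w : HL w -> weighted_H1 om D w. Proof. by case. Qed.

Lemma HL_grad_wL2 w i : HL w -> wL2 (fun x => gr w x 0 i).
Proof. by move=> /HL_H1; exact: (grad_wL2 om_gt0). Qed.

Lemma HL_grad_lin a w v i : HL w -> HL v ->
  aeD (fun x => gr (fun x => a * w x + v x) x 0 i) (fun x => a * gr w x 0 i + gr v x 0 i).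
Proof.
move=> hw hv; exact: (grad_lin oD mom mVom om_gt0 om_loc a i (HL_H1 hw) (HL_H1 hv)).
Qed.

Lemma HL_grad_congr w v : HL w -> HL v -> aeD w v -> gr w = gr v.
Proof.
move=> /HL_wL2[mw _] /HL_wL2[mv _] wv.
exact: (grad_congr oD mom mVom om_gt0 om_loc mw mv wv).
Qed.

Definition grad_ip w v := \sum_(i < n) ip (fun x => gr w x 0 i) (fun x => gr v x 0 i).

Lemma HL_normE w : HL w -> N w = Num.sqrt (grad_ip w w).
Proof.
move=> hw; rewrite /HL_norm /grad_norm; congr Num.sqrt.
have L i := HL_grad_wL2 i hw.
rewrite /grad_ip -(Rintegral_wsum mD mom om_gt0 L L).
by apply: eq_Rintegral => x _; rewrite dotvE.
Qed.

Lemma ip_grad_lin a w v i (f : 'rV[R]_n -> R) : HL w -> HL v -> wL2 f ->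
  ip (fun x => gr (fun x => a * w x + v x) x 0 i) f =
  a * ip (fun x => gr w x 0 i) f + ip (fun x => gr v x 0 i) f.
Proof.
move=> hw hv Lf; have Lw := HL_grad_wL2 i hw; have Lv := HL_grad_wL2 i hv.
rewrite -(ip_lin mD mom om_gt0)//; apply: (eq_ip mD mom).
- by case: (HL_grad_wL2 i (HL_lin a hw hv)).
- by case: (wL2_lin mD mom om_gt0 a Lw Lv).
- by case: Lf.
- exact: HL_grad_lin.
Qed.

Lemma grad_ip_lin a w v z : HL w -> HL v -> HL z ->
  grad_ip (fun x => a * w x + v x) z = a * grad_ip w z + grad_ip v z.
Proof.
move=> hw hv hz; rewrite /grad_ip mulr_sumr -big_split; apply: eq_bigr => i _.
by rewrite ip_grad_lin//; exact: HL_grad_wL2.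
Qed.

Lemma grad_ip_sym w v : grad_ip w v = grad_ip v w.
Proof. by apply: eq_bigr => i _; rewrite ipC. Qed.

Lemma grad_ip_ge0 w : 0 <= grad_ip w w.
Proof. by apply: sumr_ge0 => i _; exact: (ip_ge0 _ om_gt0). Qed.

Lemma HL_norm_ge0 w : 0 <= N w. Proof. exact: sqrtr_ge0. Qed.

Lemma HL_norm_sq w : HL w -> N w ^+ 2 = grad_ip w w.
Proof. by move=> hw; rewrite HL_normE// sqr_sqrtr// grad_ip_ge0. Qed.

Lemma HL_norm_lin a w v : HL w -> HL v ->
  N (fun x => a * w x + v x) <= `|a| * N w + N v.
Proof.
move=> hw hv; rewrite (HL_normE hw) (HL_normE hv) (HL_normE (HL_lin a hw hv)).
exact: (@form_triangle R _ HL grad_ip HL_lin grad_ip_lin (fun w v _ _ => grad_ip_sym w v)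
  (fun w _ => grad_ip_ge0 w)).
Qed.

Lemma nrm_grad_le w i : HL w -> nrm (fun x => gr w x 0 i) <= N w.
Proof.
move=> hw; rewrite HL_normE// ler_wsqrtr// /grad_ip (bigD1 i)//= lerDl.
by apply: sumr_ge0 => j _; exact: (ip_ge0 _ om_gt0).
Qed.

Lemma HL_norm_le_sum w : HL w -> N w <= \sum_(i < n) nrm (fun x => gr w x 0 i).
Proof.
move=> hw; have S0 : 0 <= \sum_(i < n) nrm (fun x => gr w x 0 i).
  by apply: sumr_ge0 => i _; exact: nrm_ge0.
rewrite -(@ler_pXn2r _ 2)// ?nnegrE ?HL_norm_ge0// HL_norm_sq// /grad_ip.
have -> : \sum_(i < n) ip (fun x => gr w x 0 i) (fun x => gr w x 0 i) =
    \sum_(i < n) nrm (fun x => gr w x 0 i) ^+ 2.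
  by apply: eq_bigr => i _; rewrite (sqr_nrm _ om_gt0).
have [] : 0 <= \sum_(i < n) nrm (fun x => gr w x 0 i) /\
    \sum_(i < n) nrm (fun x => gr w x 0 i) ^+ 2 <=
    (\sum_(i < n) nrm (fun x => gr w x 0 i)) ^+ 2; last by [].
elim/big_rec2: _ => [|i x y _ [x0 yx]]; first by rewrite expr0n.
have ni := nrm_ge0 (leb n) D om (fun x => gr w x 0 i).
split; first exact: addr_ge0.
rewrite sqrrD -addrA lerD2l (le_trans yx)// lerDr mulrn_wge0// mulr_ge0//.
Qed.

Lemma HL_norm_congr w v : HL w -> HL v -> aeD w v -> N w = N v.
Proof.
move=> hw hv wv; rewrite (HL_normE hw) (HL_normE hv) /grad_ip.
by rewrite (HL_grad_congr hw hv wv).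
Qed.

Let e0 : 'I_n := ord0.

Lemma ypart_cons (t : R) (v : 'rV[R]_(d + 1)) :
  ypart (cons_rV (t, v) : 'rV[R]_(d.+1 + 1)) = ypart v.
Proof.
rewrite !ypartE -(cons_rVS (t, v)); congr (_ _ _); exact/val_inj.
Qed.

(** The integral over the cylinder becomes one over the whole space by extending the weight by 0 to
    [y <= 0]: outside the base the test function vanishes already. The extended weight [om'] still
    does not depend on the first coordinate. *)
Lemma test_poincare f : test_function U f -> wL2 f ->
  wL2 (fun x => 'D_(basis_vec e0) f x) ->
  nrm f <= 2 * M * nrm (fun x => 'D_(basis_vec e0) f x).
Proof.
move=> tf Lf Ldf; pose om' x := \1_[set x | 0 < @ypart R d.+1 x] x * om x.
have mY : measurable [set x | 0 < @ypart R d.+1 x].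
  rewrite (_ : [set _ | _] = @ypart R d.+1 @^-1` `]0, +oo[%classic).
    by rewrite -[X in measurable X]setTI; exact: measurable_ypart.
  by apply/seteqP; split=> x /=; rewrite in_itv/= andbT.
have mom' : measurable_fun setT om'.
  have mI : measurable_fun setT (\1_[set x | 0 < @ypart R d.+1 x] : _ -> R).
    exact: measurable_indic.
  exact: (measurable_funM mI (@measurable_yweight R d.+1 s)).
have supp (g : 'rV[R]_n -> R) : test_function U g ->
    (\int[leb n]_(x in D) (om x * g x ^+ 2)%:E = \int[leb n]_x (om' x * g x ^+ 2)%:E)%E.
  move=> [_ [K [_ KU Kg]]]; apply: eq_integral_supp => // x.
    by move=> [_ y0]; rewrite /om' indicE mem_set// mul1r.
  move=> _ nDx; have [y0|y0] := pselect (0 < ypart x); last first.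
    by rewrite /om' indicE memNset// !mul0r.
  rewrite Kg ?expr0n ?mulr0// => /KU Ux; exact: nDx.
have tdf := test_derive (basis_vec e0) tf.
apply: (nrm_le_EFin mD mom om_gt0 _ Lf).
  by rewrite mulr_ge0 ?nrm_ge0// mulr_ge0// ltW.
rewrite exprMn EFinM -(nrm_EFin mD mom om_gt0 Ldf) !supp//.
have h1 (x : 'rV[R]_n) : U x -> `|x 0 ord0| < M.
  move=> Ux; have -> : x 0 ord0 = xpart x 0 ord0.
    by rewrite xpartE; congr (_ _ _); exact/val_inj.
  exact: OM Ux ord0.
have h2 (t : R) (v : 'rV[R]_(d + 1)) : om' (cons_rV (t, v)) = om' (cons_rV (0, v)).
  rewrite /om' /yweight !indicE.
  have E : (cons_rV (t, v) \in [set x | 0 < @ypart R d.+1 x]) =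
           (cons_rV (0, v) \in [set x | 0 < @ypart R d.+1 x]).
    by apply/idP/idP; rewrite !inE /= !ypart_cons.
  by rewrite E !ypart_cons.
have h3 x : 0 <= om' x by rewrite mulr_ge0// powR_ge0.
exact: (@poincare_test R (d + 1) f U om' M M0 tf h1 h2 mom' h3).
Qed.

(** The inequality passes from test functions to their limits. An approximation within [e / c] costs
    [e / c] on the left and [2 M e / c] on the right, whence [c = 1 + 2 M]. *)
Lemma HL_poincare w : HL w -> nrm w <= 2 * M * N w.
Proof.
move=> hw; have Lw := HL_wL2 hw; have Lg := HL_grad_wL2 e0 hw.
apply: (@le_trans _ _ (2 * M * nrm (fun x => gr w x 0 e0))); last first.
  by rewrite ler_wpM2l ?nrm_grad_le// mulr_ge0// ltW.
apply/ler_addgt0Pr => e epos; pose c := 1 + 2 * M.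
have c0 : 0 < c by rewrite addr_gt0// mulr_gt0.
have ec : 0 < e / c by rewrite divr_gt0.
have [_ /(_ _ ec)[f [tf Lf Ldf fw dfw]]] := (H1_0P U oD mom om_gt0 w).1 hw.
have Ldf0 := Ldf e0.
have t1 : nrm w <= nrm f + e / c.
  apply: le_trans (lerD (lexx _) fw); rewrite (nrmB _ _ _ f w).
  have := nrm_D mD mom om_gt0 Lf (wL2B mD mom om_gt0 Lw Lf).
  by under eq_fun do rewrite addrC subrK.
have t2 : nrm (fun x => 'D_(basis_vec e0) f x) <= nrm (fun x => gr w x 0 e0) + e / c.
  apply: le_trans (lerD (lexx _) (dfw e0)).
  have := nrm_D mD mom om_gt0 Lg (wL2B mD mom om_gt0 Ldf0 Lg).
  by under eq_fun do rewrite addrC subrK.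
have p := test_poincare tf Lf Ldf0.
have M2 : 0 <= 2 * M by rewrite mulr_ge0// ltW.
have t3 := ler_wpM2l M2 t2.
have E : 2 * M * (e / c) + e / c = e.
  by move: c0; rewrite /c => c0; field; rewrite gt_eqF.
rewrite -[X in _ <= _ + X]E; apply: le_trans t1 _; apply: (@le_trans _ _ (_ + e / c)).
  by rewrite lerD2r; exact: p.
by rewrite addrA lerD2r -mulrDr.
Qed.

Lemma HL_norm_eq0 w : HL w -> N w <= 0 -> aeD w (fun=> 0).
Proof.
move=> hw N0; apply: (nrm_eq0 mD mom om_gt0 (HL_wL2 hw)).
apply/eqP; rewrite eq_le nrm_ge0 andbT; apply: le_trans (HL_poincare hw) _.
by rewrite mulr_ge0_le0// mulr_ge0// ltW.
Qed.

Lemma nrm_grad_sub w v i : HL w -> HL v ->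
  nrm (fun x => gr w x 0 i - gr v x 0 i) = nrm (fun x => gr (fun x => w x - v x) x 0 i).
Proof.
move=> hw hv; apply: (eq_nrm mD mom).
- by case: (wL2B mD mom om_gt0 (HL_grad_wL2 i hw) (HL_grad_wL2 i hv)).
- by case: (HL_grad_wL2 i (HL_sub hw hv)).
rewrite (_ : (fun x => w x - v x) = fun x => -1 * v x + w x); last first.
  by apply/funext => x; ring.
by apply: filterS (HL_grad_lin (-1) i hv hw) => x + Dx => /(_ Dx) ->; ring.
Qed.

Lemma HL_complete (w_ : nat -> 'rV[R]_n -> R) : (forall k, HL (w_ k)) ->
  (forall e : R, 0 < e -> exists m, forall j k, (m <= j)%N -> (m <= k)%N ->
    N (fun x => w_ j x - w_ k x) <= e) ->
  exists w, HL w /\ forall e : R, 0 < e -> exists m, forall k, (m <= k)%N ->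
    N (fun x => w_ k x - w x) <= e.
Proof.
move=> Hw cauchy.
have [w [hw cvw]] : exists w, HL w /\ forall e : R, 0 < e -> exists m, forall k,
    (m <= k)%N -> nrm (fun x => w_ k x - w x) <= e /\
    forall i, nrm (fun x => gr (w_ k) x 0 i - gr w x 0 i) <= e.
  apply: (H1_0_complete oD mom mVom om_gt0 om_loc) => // e e1.
  (* Energy distances below [e / (1 + 2 M)] bound the gradient distances by [e] and, through
     Poincare's inequality, the L^2 distances by [2 M e / (1 + 2 M) <= e]. *)
  have c0 : 0 < 1 + 2 * M by rewrite addr_gt0// mulr_gt0.
  have [m mP] := cauchy _ (divr_gt0 e1 c0); exists m => j k mj mk.
  have le := mP j k mj mk; have hs := HL_sub (Hw j) (Hw k).
  have ec : e / (1 + 2 * M) <= e by rewrite ler_pdivrMr// ler_peMr ?ltW// ltrDl mulr_gt0.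
  split.
    apply: le_trans (HL_poincare hs) _; apply: (@le_trans _ _ (2 * M * (e / (1 + 2 * M)))).
      by rewrite ler_wpM2l// mulr_ge0// ltW.
    rewrite mulrA ler_pdivrMr// mulrC ler_wpM2l ?(ltW e1)// lerDr//.
  move=> i; rewrite (nrm_grad_sub i (Hw j) (Hw k)); apply: le_trans (nrm_grad_le i hs) _.
  exact: le_trans le ec.
exists w; split=> // e e1.
have n0 : 0 < n%:R :> R by rewrite ltr0n addn1.
have [m mP] := cvw _ (divr_gt0 e1 n0); exists m => k mk.
have [_ gk] := mP k mk; apply: le_trans (HL_norm_le_sum (HL_sub (Hw k) hw)) _.
apply: (@le_trans _ _ (\sum_(i < n) (e / n%:R))).
  by apply: ler_sum => i _; rewrite -(nrm_grad_sub i (Hw k) hw).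
by rewrite sumr_const card_ord -[leLHS]mulr_natr divfK// gt_eqF.
Qed.

End HL.

(** * Block matrices and bounds for the diffusion coefficient *)

Section matrix_facts.
Context {R : realType}.

Lemma dotv_sym n (S : 'M[R]_n) (u v : 'rV[R]_n) : S^T = S ->
  dotv (u *m S) v = dotv (v *m S) u.
Proof.
move=> SS; rewrite /dotv -{1}[u *m S *m v^T]trmxK mxE.
by rewrite !trmx_mul trmxK SS mulmxA.
Qed.

Lemma dotv_block d (B : 'M[R]_d) (g : 'rV[R]_(d + 1)) :
  dotv (g *m (block_mx B 0 0 1%:M)^T) g =
  dotv (lsubmx g *m B^T) (lsubmx g) + dotv (rsubmx g) (rsubmx g).
Proof.
rewrite /dotv -{1 2}[g]hsubmxK tr_block_mx !trmx0 trmx1 mul_row_block !mulmx0.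
by rewrite addr0 add0r mulmx1 tr_row_mx mul_row_col mxE.
Qed.

Lemma dotv_split d (g : 'rV[R]_(d + 1)) :
  dotv g g = dotv (lsubmx g) (lsubmx g) + dotv (rsubmx g) (rsubmx g).
Proof. by rewrite /dotv -{1 2}[g]hsubmxK tr_row_mx mul_row_col mxE. Qed.

Lemma dotv_ge0 n (u : 'rV[R]_n) : 0 <= dotv u u.
Proof. by rewrite dotvE sumr_ge0// => i _; rewrite -expr2 sqr_ge0. Qed.

Lemma mx_entry_le_norm m n (B : 'M[R]_(m, n)) i j : `|B i j| <= `|B|.
Proof.
rewrite [X in _ <= X]mx_normrE.
exact: (le_bigmax_cond 0 (fun k : 'I_m * 'I_n => `|B k.1 k.2|) (j := (i, j))).
Qed.

End matrix_facts.

Section coefficient.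
Context {R : realType} (d : nat).
Variables (Omega : set 'rV[R]_d) (A : 'rV[R]_d -> 'M[R]_d) (M : R).
Hypotheses (oO : open Omega) (M0 : 0 < M)
  (OM : forall x, Omega x -> forall i, `|x 0 i| < M)
  (hA : diffusion_coefficient Omega A).

Lemma coefficient_lipschitz : exists2 K : R, 0 < K &
  forall x y, Omega x -> Omega y -> `|A x - A y| <= K * `|x - y|.
Proof.
have [[L [_ LP]] _ _] := hA.
exists (`|L| + 1); first by rewrite ltr_wpDl.
move=> x y Ox Oy; apply: (LP (`|L| + 1) _ (x, y)) => //.
by rewrite (le_lt_trans (ler_norm L))// ltrDl.
Qed.

Lemma coefficient_entry_measurable i j : measurable_fun Omega (fun x => A x i j).
Proof.
have [K K0 KP] := coefficient_lipschitz.
apply: (lipschitz_measurable oO K0) => x y Ox Oy; apply: le_trans (KP x y Ox Oy).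
by have := mx_entry_le_norm (A x - A y) i j; rewrite !mxE.
Qed.

(** A Lipschitz function on a set of diameter at most [2 M] is bounded. Requiring [1 <= K] lets the
    same constant bound the entry 1 in the block matrix of the extended problem. *)
Lemma coefficient_bounded : exists2 K : R, 1 <= K &
  forall x, Omega x -> forall i j, `|A x i j| <= K.
Proof.
have [K K0 KP] := coefficient_lipschitz.
have [->|/set0P[x0 Ox0]] := eqVneq Omega set0; first by exists 1.
exists (`|A x0| + K * (2 * M) + 1); first by rewrite lerDr addr_ge0// !mulr_ge0// ltW.
move=> x Ox i j; apply: le_trans (mx_entry_le_norm _ i j) _.
have -> : A x = A x0 + (A x - A x0) by rewrite addrC subrK.
apply: le_trans (ler_normD _ _) _; rewrite -addrA lerD2l.
apply: le_trans (KP x x0 Ox Ox0) _; apply: (@le_trans _ _ (K * (2 * M))); last first.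
  by rewrite lerDl.
rewrite ler_wpM2l ?(ltW K0)// [X in X <= _]mx_normrE.
apply/bigmax_leP; split=> [|[k l] _]; first by rewrite mulr_ge0// ltW.
rewrite /= !mxE (ord1 k); have := OM Ox l; have := OM Ox0 l.
rewrite !ltr_norml ler_norml; lra.
Qed.

End coefficient.

(** * Principal and potential parts of the form *)

Section form.
Context {R : realType} (d : nat).
Variables (Omega : set 'rV[R]_d.+1) (A : 'rV[R]_d.+1 -> 'M[R]_d.+1) (s M : R).
Hypotheses (oO : open Omega) (M0 : 0 < M)
  (OM : forall x, Omega x -> forall i, `|x 0 i| < M)
  (hA : diffusion_coefficient Omega A).
Local Notation n := (d.+1 + 1)%N.
Local Notation D := (cylinder Omega).
Local Notation om := (@yweight R d.+1 s).
Local Notation wL2 := (wL2 (leb n) D om).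
Local Notation ip := (ip (leb n) D om).
Local Notation nrm := (nrm (leb n) D om).
Local Notation aeD := (aeD (leb n) D).
Local Notation HL := (HL Omega s).
Local Notation gr := (HL_grad Omega s).
Local Notation N := (HL_norm Omega s).
Local Notation Linf := (Linf Omega).
Local Notation Lnrm := (Linf_norm Omega).
Implicit Types (w v : 'rV[R]_n -> R) (q h : 'rV[R]_d.+1 -> R).

Let mO : measurable Omega. Proof. exact: open_measurable_rV. Qed.
Let oD := open_cylinder oO.
Let mD := measurable_cylinder oO.
Let mom : measurable_fun D om := measurable_funTS (@measurable_yweight R d.+1 s).
Let om_gt0 := @yweight_gt0 R d.+1 s Omega.

Definition potential_form h w v : R := ip (fun x => h (xpart x) * w x) v.

Lemma Linf_cyl h : Linf h -> measurable_fun D (fun x => h (xpart x)) /\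
  {ae leb n, forall x, D x -> `|h (xpart x)| <= Lnrm h}.
Proof.
move=> Lh; split; first by apply: measurable_comp_xpart => //; case: Lh.
by apply: filterS (ae_xpart (Linf_ae Lh)) => x hx [Ox _]; exact: hx.
Qed.

Lemma Linf_wL2 h w : Linf h -> wL2 w -> wL2 (fun x => h (xpart x) * w x) /\
  nrm (fun x => h (xpart x) * w x) <= Lnrm h * nrm w.
Proof.
move=> Lh Lw; have [mh hh] := Linf_cyl Lh.
have [L le] := wL2_bdM mD mom om_gt0 mh hh Lw; split=> //.
by move: le; rewrite ger0_norm// Linf_norm_ge0.
Qed.

(** Cauchy-Schwarz leaves two weighted L^2 norms, and Poincare's inequality for each of them yields
    one factor [2 M]. *)
Lemma potential_form_bound h w v : Linf h -> HL w -> HL v ->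
  `|potential_form h w v| <= (2 * M) ^+ 2 * Lnrm h * N w * N v.
Proof.
move=> Lh hw hv; have [L le] := Linf_wL2 Lh (HL_wL2 hw).
apply: le_trans (ip_CS mD mom om_gt0 L (HL_wL2 hv)) _.
have pw := HL_poincare oO M0 OM hw; have pv := HL_poincare oO M0 OM hv.
have l0 := Linf_norm_ge0 Omega h.
apply: (@le_trans _ _ ((Lnrm h * (2 * M * N w)) * (2 * M * N v))).
  apply: (ler_pM (nrm_ge0 _ _ _ _) (nrm_ge0 _ _ _ _)); last exact: pv.
  by apply: le_trans le _; exact: (ler_wpM2l l0 pw).
move: (Lnrm h) (N w) (N v) => l a c.
by rewrite le_eqVlt; apply/orP; left; apply/eqP; ring.
Qed.

Lemma potential_form_lin1 h a w v z : Linf h -> HL w -> HL v -> HL z ->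
  potential_form h (fun x => a * w x + v x) z = a * potential_form h w z + potential_form h v z.
Proof.
move=> Lh /HL_wL2 hw /HL_wL2 hv /HL_wL2 hz.
have [Lw _] := Linf_wL2 Lh hw; have [Lv _] := Linf_wL2 Lh hv.
rewrite /potential_form -(ip_lin mD mom om_gt0 a Lw Lv hz); congr (ip _ _).
by apply/funext => x; ring.
Qed.

Lemma potential_form_lin0 h k a w z : Linf h -> Linf k -> HL w -> HL z ->
  potential_form (fun x => a * h x + k x) w z = a * potential_form h w z + potential_form k w z.
Proof.
move=> Lh Lk /HL_wL2 hw /HL_wL2 hz.
have [Lw _] := Linf_wL2 Lh hw; have [Lv _] := Linf_wL2 Lk hw.
rewrite /potential_form -(ip_lin mD mom om_gt0 a Lw Lv hz); congr (ip _ _).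
by apply/funext => x; ring.
Qed.

Definition ext_coefficient (x : 'rV[R]_n) : 'M[R]_n := block_mx (A (xpart x)) 0 0 1%:M.

Lemma ext_coefficient_entry : exists2 K : R, 0 <= K & forall i j,
  measurable_fun D (fun x => ext_coefficient x i j) /\ forall x, D x -> `|ext_coefficient x i j| <= K.
Proof.
have [K K1 KP] := coefficient_bounded M0 OM hA.
have K0 : 0 <= K by exact: le_trans K1.
exists K => // i j; rewrite /ext_coefficient.
case: (split_ordP i) => i' ->; case: (split_ordP j) => j' ->.
- under eq_fun do rewrite block_mxEul; split.
    apply: (@measurable_comp_xpart _ _ Omega mO (fun x => A x i' j')).
    exact: coefficient_entry_measurable.
  by move=> x [Ox _]; rewrite block_mxEul KP.
- under eq_fun do rewrite block_mxEur mxE; split=> // x _.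
  by rewrite block_mxEur mxE normr0.
- under eq_fun do rewrite block_mxEdl mxE; split=> // x _.
  by rewrite block_mxEdl mxE normr0.
under eq_fun do rewrite block_mxEdr mxE; split=> // x _.
rewrite block_mxEdr mxE; case: (_ == _); rewrite ?normr0// normr1//.
Qed.

(** A component of the extended coefficient applied to the gradient. With it the principal form is a
    finite sum of weighted inner products, so linearity and bounds are obtained component by
    component. *)
Definition flux w i (x : 'rV[R]_n) := \sum_(j < n) ext_coefficient x i j * gr w x 0 j.

Lemma fluxE w i x : (gr w x *m (ext_coefficient x)^T) 0 i = flux w i x.
Proof. by rewrite mxE; apply: eq_bigr => j _; rewrite mxE mulrC. Qed.

Lemma flux_wL2 w i : HL w -> wL2 (flux w i).
Proof.
move=> hw; have [K K0 KP] := ext_coefficient_entry.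
apply: (wL2_sum mD mom om_gt0 (F := fun j x => ext_coefficient x i j * gr w x 0 j)) => j.
have [mc cK] := KP i j.
by have [] := wL2_bdM mD mom om_gt0 mc (aeW _ cK) (HL_grad_wL2 j hw).
Qed.

Lemma flux_bound : exists2 C : R, 0 <= C & forall w, HL w -> forall i,
  nrm (flux w i) <= C * N w.
Proof.
have [K K0 KP] := ext_coefficient_entry.
exists (n%:R * K) => [|w hw i]; first by rewrite mulr_ge0.
pose F j x := ext_coefficient x i j * gr w x 0 j.
have FP j : wL2 (F j) /\ nrm (F j) <= K * N w.
  have [mc cK] := KP i j.
  have [L le] := wL2_bdM mD mom om_gt0 mc (aeW _ cK) (HL_grad_wL2 j hw).
  split=> //; apply: le_trans le _; rewrite ger0_norm// ler_wpM2l//.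
  exact: nrm_grad_le.
have sum_le (r : seq 'I_n) : wL2 (fun x => \sum_(j <- r) F j x) /\
    nrm (fun x => \sum_(j <- r) F j x) <= \sum_(j <- r) (K * N w).
  elim: r => [|j r [Lr le]].
    rewrite big_nil; under eq_fun do rewrite big_nil.
    by split; [exact: wL2_0|rewrite nrm0].
  rewrite big_cons; under eq_fun do rewrite big_cons.
  have [Fj lej] := FP j; split; first exact: (wL2D mD mom om_gt0).
  by apply: le_trans (nrm_D mD mom om_gt0 Fj Lr) _; exact: lerD.
have [_] := sum_le (index_enum 'I_n); move=> /le_trans; apply.
by rewrite sumr_const card_ord -[leLHS]mulr_natl mulrA.
Qed.

Definition principal_form w v : R := \sum_(i < n) ip (flux w i) (fun x => gr v x 0 i).

Lemma principal_formE w v : HL w -> HL v ->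
  principal_form w v = \int[leb n]_(x in D) (om x * \sum_(i < n) flux w i x * gr v x 0 i).
Proof.
move=> hw hv; exact: (esym (Rintegral_wsum mD mom om_gt0 (fun i => flux_wL2 i hw)
  (fun i => HL_grad_wL2 i hv))).
Qed.

Lemma form_C_split q w v : Linf q -> HL w -> HL v ->
  form_C Omega A s q w v = principal_form w v + potential_form q w v.
Proof.
move=> Lq hw hv; have [Lqw _] := Linf_wL2 Lq (HL_wL2 hw).
have Lf i := flux_wL2 i hw; have Lg i := HL_grad_wL2 i hv.
rewrite (principal_formE hw hv) -RintegralD//; last first.
- exact: (ip_integrable mD mom om_gt0 Lqw (HL_wL2 hv)).
- exact: (wsum_integrable mD mom om_gt0 Lf Lg).
apply: eq_Rintegral => x _; rewrite dotvE -mulrDr; congr (_ * (_ + _)).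
by apply: eq_bigr => i _; rewrite fluxE.
Qed.

Lemma principal_form_lin a w v z : HL w -> HL v -> HL z ->
  principal_form (fun x => a * w x + v x) z = a * principal_form w z + principal_form v z.
Proof.
move=> hw hv hz; rewrite /principal_form mulr_sumr -big_split; apply: eq_bigr => i _ /=.
have Lz := HL_grad_wL2 i hz.
have Lw := flux_wL2 i hw; have Lv := flux_wL2 i hv.
have hl := HL_lin oO a hw hv; have Lwv := flux_wL2 i hl.
rewrite -(ip_lin mD mom om_gt0 a Lw Lv Lz); apply: (eq_ip mD mom).
- by case: Lwv.
- by case: (wL2_lin mD mom om_gt0 a Lw Lv).
- by case: Lz.
have : {ae leb n, forall x, forall j : 'I_n, D x ->
    gr (fun x => a * w x + v x) x 0 j = a * gr w x 0 j + gr v x 0 j}.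
  by apply: filter_forall => j; exact: (HL_grad_lin oO a j hw hv).
apply: filterS => x h Dx; rewrite /flux mulr_sumr -big_split; apply: eq_bigr => j _ /=.
by rewrite h//; ring.
Qed.

Lemma principal_form_sym w v : HL w -> HL v -> principal_form w v = principal_form v w.
Proof.
move=> hw hv.
rewrite (principal_formE hw hv) (principal_formE hv hw).
apply: eq_Rintegral => x /[!inE] -[Ox _]; congr (_ * _).
have E w' v' : \sum_(i < n) flux w' i x * gr v' x 0 i = dotv (gr w' x *m (ext_coefficient x)^T) (gr v' x).
  by rewrite dotvE; apply: eq_bigr => i _; rewrite fluxE.
rewrite !E; apply: dotv_sym; rewrite trmxK /ext_coefficient tr_block_mx !trmx0 trmx1.
by have [_ /(_ _ Ox)[_ ->]] := hA.
Qed.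

Lemma principal_form_bound : exists2 C : R, 0 <= C & forall w v, HL w -> HL v ->
  `|principal_form w v| <= C * N w * N v.
Proof.
have [C C0 CP] := flux_bound; exists (n%:R * C) => [|w v hw hv].
  by rewrite mulr_ge0.
apply: le_trans (ler_norm_sum _ _ _) _.
apply: (@le_trans _ _ (\sum_(i < n) (C * N w * N v))).
  apply: ler_sum => i _.
  apply: le_trans (ip_CS mD mom om_gt0 (flux_wL2 i hw) (HL_grad_wL2 i hv)) _.
  apply: (ler_pM (nrm_ge0 _ _ _ _) (nrm_ge0 _ _ _ _)); first exact: CP.
  exact: nrm_grad_le.
by rewrite sumr_const card_ord -[leLHS]mulr_natl !mulrA.
Qed.

Lemma principal_form_coercive : exists2 c : R, 0 < c & forall w, HL w ->
  c * N w ^+ 2 <= principal_form w w.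
Proof.
(* [a0] serves for the derivatives along the base; 1 is the coefficient of the derivative in [y]. *)
have [_ _ [a0 a0pos aP]] := hA; pose c := Num.min a0 1.
have c0 : 0 < c by rewrite lt_min a0pos ltr01.
exists c => // w hw; rewrite HL_norm_sq// /grad_ip.
have Lg i := HL_grad_wL2 i hw; have Lf i := flux_wL2 i hw.
rewrite (principal_formE hw hw) -(Rintegral_wsum mD mom om_gt0 Lg Lg).
have Ig := wsum_integrable mD mom om_gt0 Lg Lg.
rewrite -RintegralZl//; apply: le_Rintegral => //.
- by have := integrableZl mD c Ig.
- exact: (wsum_integrable mD mom om_gt0 Lf Lg).
move=> x Dx; have ox := om_gt0 Dx; case: (Dx) => Ox _.
rewrite mulrCA ler_wpM2l ?(ltW ox)//.
have -> : \sum_(i < n) flux w i x * gr w x 0 i = dotv (gr w x *m (ext_coefficient x)^T) (gr w x).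
  by rewrite dotvE; apply: eq_bigr => i _; rewrite fluxE.
rewrite -dotvE dotv_block dotv_split mulrDr; apply: lerD.
  apply: le_trans (aP _ _ Ox); rewrite ler_wpM2r ?dotv_ge0// ge_min lexx//.
by rewrite ler_piMl ?dotv_ge0// ge_min lexx orbT.
Qed.

End form.

(** * Tuples of directions *)

Section directions.
Context {R : realType} (d : nat).
Local Notation X := ('rV[R]_d -> R).

Lemma cons_dir_drop m (h : 'I_m.+1 -> X) :
  h = cons_dir (h ord0) (fun j => h (lift ord0 j)).
Proof.
by apply/funext => i; rewrite /cons_dir; case: (unliftP ord0 i) => [j|] ->.
Qed.

Lemma cons_dir0 m h0 (k : 'I_m -> X) : cons_dir h0 k ord0 = h0.
Proof. by rewrite /cons_dir unlift_none. Qed.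

Lemma cons_dirS m h0 (k : 'I_m -> X) j : cons_dir h0 k (lift ord0 j) = k j.
Proof. by rewrite /cons_dir liftK. Qed.

Lemma drop_cons_dir0 m h0 (k : 'I_m -> X) : drop_dir (cons_dir h0 k) ord0 = k.
Proof. by apply/funext => j; exact: cons_dirS. Qed.

(** In the equation for the direction [(h0, k)], the summand that removes an entry of [k] keeps [h0]
    in front. It is therefore again a derivative in the direction [h0], which is what an induction
    on the order needs. *)
Lemma drop_cons_dirS m h0 (k : 'I_m.+1 -> X) i :
  drop_dir (cons_dir h0 k) (lift ord0 i) = cons_dir h0 (drop_dir k i).
Proof.
apply/funext => j; rewrite /drop_dir.
case: (unliftP ord0 (j : 'I_m.+1)) => [j' ->|->].
  rewrite cons_dirS (_ : lift (lift ord0 i) (lift ord0 j') = lift ord0 (lift i j')).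
    by rewrite cons_dirS.
  by apply/val_inj; rewrite /= /bump /= !add1n ltnS addnS.
by rewrite (_ : lift (lift ord0 i) ord0 = ord0) ?cons_dir0//; exact/val_inj.
Qed.

Lemma drop_set_nth_same m (h : 'I_m -> X) i v :
  drop_dir (set_nth_dir h i v) i = drop_dir h i.
Proof. by apply/funext => j; rewrite /drop_dir /set_nth_dir eq_sym (negbTE (neq_lift _ _)). Qed.

Lemma drop_set_nth_lift m (h : 'I_m.+1 -> X) (j : 'I_m.+1) (i : 'I_m) v :
  drop_dir (set_nth_dir h (lift j i) v) j = set_nth_dir (drop_dir h j) i v.
Proof.
by apply/funext => l; rewrite /drop_dir /set_nth_dir (inj_eq lift_inj).
Qed.

Lemma set_cons_dir0 m a b (k : 'I_m -> X) :
  set_nth_dir (cons_dir a k) ord0 b = cons_dir b k.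
Proof.
apply/funext => i; rewrite /set_nth_dir; case: (unliftP ord0 i) => [j|] ->.
  by rewrite eq_sym (negbTE (neq_lift _ _)) !cons_dirS.
by rewrite eqxx cons_dir0.
Qed.

End directions.

(** * Differentiability of solution maps in abstract spaces *)

Section frechet.
Context {R : realType} (d n : nat).
Local Notation X := ('rV[R]_d -> R).
Local Notation Y := ('rV[R]_n -> R).
(** [P] stands for the principal form and [b h] for the potential form of [h]; [LI] and [Ln] are
    L^oo and its norm. The set [adm] enters through coercivity and through [dir_split], which writes
    each direction as a difference of two directions along which one may move inside [adm]. *)
Variables (HL : Y -> Prop) (N : Y -> R) (ae : Y -> Y -> Prop) (LI : X -> Prop)
  (Ln : X -> R) (adm : X -> Prop) (P : Y -> Y -> R) (b : X -> Y -> Y -> R).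
Variables (c Cb CP : R).
Hypotheses (H_0 : HL (fun=> 0))
  (H_lin : forall a w v, HL w -> HL v -> HL (fun x => a * w x + v x))
  (N_ge0 : forall w, 0 <= N w)
  (N_lin : forall a w v, HL w -> HL v -> N (fun x => a * w x + v x) <= `|a| * N w + N v)
  (aeP : forall w v, HL w -> HL v -> ae w v <-> N (fun x => w x - v x) <= 0)
  (P_lin : forall a w v z, HL w -> HL v -> HL z ->
    P (fun x => a * w x + v x) z = a * P w z + P v z)
  (P_sym : forall w v, HL w -> HL v -> P w v = P v w)
  (P_bound : forall w v, HL w -> HL v -> `|P w v| <= CP * N w * N v)
  (b_lin1 : forall h a w v z, LI h -> HL w -> HL v -> HL z ->
    b h (fun x => a * w x + v x) z = a * b h w z + b h v z)
  (b_lin0 : forall h k a w z, LI h -> LI k -> HL w -> HL z ->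
    b (fun x => a * h x + k x) w z = a * b h w z + b k w z)
  (b_sym : forall h w v, LI h -> HL w -> HL v -> b h w v = b h v w)
  (b_bound : forall h w v, LI h -> HL w -> HL v -> `|b h w v| <= Cb * Ln h * N w * N v)
  (c_gt0 : 0 < c) (Cb_ge0 : 0 <= Cb) (CP_ge0 : 0 <= CP)
  (coercive : forall q w, adm q -> HL w -> c * N w ^+ 2 <= P w w + b q w w)
  (complete : forall w_ : nat -> Y, (forall k, HL (w_ k)) ->
    (forall e : R, 0 < e -> exists m, forall j k, (m <= j)%N -> (m <= k)%N ->
      N (fun x => w_ j x - w_ k x) <= e) ->
    exists w, HL w /\ forall e : R, 0 < e -> exists m, forall k, (m <= k)%N ->
      N (fun x => w_ k x - w x) <= e)
  (Ln_ge0 : forall h, 0 <= Ln h)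
  (admLI : forall q, adm q -> LI q)
  (LI_lin : forall a h k, LI h -> LI k -> LI (fun x => a * h x + k x))
  (LnZ : forall a h, LI h -> LI (fun x => a * h x) /\ Ln (fun x => a * h x) <= `|a| * Ln h)
  (dir_split : forall q h, adm q -> LI h -> exists a1 a2 : X,
    [/\ LI a1, LI a2, h = (fun x => -1 * a2 x + a1 x) & exists2 t0 : R, 0 < t0 &
      forall t, 0 < t <= t0 -> adm (q \+ (fun x => t * a1 x)) /\
                               adm (q \+ (fun x => t * a2 x))]).

Definition full_form q w v : R := P w v + b q w v.

Let H_sub w v : HL w -> HL v -> HL (fun x => w x - v x).
Proof.
move=> hw hv; rewrite (_ : (fun x => _) = fun x => -1 * v x + w x); first exact: H_lin.
by apply/funext => x; ring.
Qed.

Let N_sub w v : HL w -> HL v -> N (fun x => w x - v x) <= N w + N v.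
Proof.
move=> hw hv; rewrite (_ : (fun x => _) = fun x => -1 * v x + w x).
  by apply: le_trans (N_lin _ hv hw) _; rewrite normrN normr1 mul1r addrC.
by apply/funext => x; ring.
Qed.

Let N_add w v : HL w -> HL v -> N (fun x => w x + v x) <= N w + N v.
Proof.
move=> hw hv; rewrite (_ : (fun x => _) = fun x => 1 * w x + v x).
  by apply: le_trans (N_lin _ hw hv) _; rewrite normr1 mul1r.
by apply/funext => x; ring.
Qed.

Lemma full_form_lin q a w v z : adm q -> HL w -> HL v -> HL z ->
  full_form q (fun x => a * w x + v x) z = a * full_form q w z + full_form q v z.
Proof.
move=> /admLI Lq hw hv hz; rewrite /full_form (P_lin a hw hv hz) (b_lin1 a Lq hw hv hz); ring.
Qed.

Lemma full_form_sub q w v z : adm q -> HL w -> HL v -> HL z ->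
  full_form q (fun x => w x - v x) z = full_form q w z - full_form q v z.
Proof.
move=> aq hw hv hz; rewrite (_ : (fun x => _) = fun x => -1 * v x + w x).
  by rewrite (full_form_lin _ aq hv hw hz); ring.
by apply/funext => x; ring.
Qed.

Lemma b_sub h w v z : LI h -> HL w -> HL v -> HL z ->
  b h (fun x => w x - v x) z = b h w z - b h v z.
Proof.
move=> Lh hw hv hz; rewrite (_ : (fun x => _) = fun x => -1 * v x + w x).
  by rewrite (b_lin1 _ Lh hv hw hz); ring.
by apply/funext => x; ring.
Qed.

Lemma full_form_bound q w v : adm q -> HL w -> HL v ->
  `|full_form q w v| <= (CP + Cb * Ln q) * N w * N v.
Proof.
move=> /admLI Lq hw hv; apply: le_trans (ler_normD _ _) _.
by rewrite !mulrDl; apply: lerD; [exact: P_bound|exact: b_bound].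
Qed.

Lemma full_form_ge0 q w : adm q -> HL w -> 0 <= full_form q w w.
Proof.
move=> aq hw; apply: le_trans (coercive aq hw).
by rewrite mulr_ge0 ?sqr_ge0// ltW.
Qed.

(** Testing with [u] itself and dividing by [N u] gives the bound, with [N u = 0] treated apart.
    With [K = 0] it is the uniqueness statement. *)
Lemma energy_bound q u (K : R) : adm q -> HL u -> 0 <= K ->
  (forall v, HL v -> `|full_form q u v| <= K * N v) -> N u <= K / c.
Proof.
move=> aq hu K0 le; have [u0|u0] := eqVneq (N u) 0; first by rewrite u0 divr_ge0// ltW.
have up : 0 < N u by rewrite lt_def u0 N_ge0.
rewrite ler_pdivlMr// -(ler_pM2r up) mulrAC -expr2 mulrC.
by apply: le_trans (coercive aq hu) (le_trans (ler_norm _) (le _ hu)).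
Qed.

(** The form at [q] is symmetric, so Riesz' theorem applies to it directly. Coercivity and
    boundedness make it equivalent to the square of [N], which transfers completeness. *)
Lemma solve q (L : Y -> R) (C : R) : adm q ->
  (forall a w v, HL w -> HL v -> L (fun x => a * w x + v x) = a * L w + L v) ->
  (forall v, HL v -> `|L v| <= C * N v) ->
  exists u, HL u /\ forall v, HL v -> full_form q u v = L v.
Proof.
move=> aq Ll Lb.
have sqrt_c w : HL w -> N w <= Num.sqrt (full_form q w w) / Num.sqrt c.
  move=> hw; rewrite ler_pdivlMr ?sqrtr_gt0// mulrC.
  have -> : Num.sqrt c * N w = Num.sqrt (c * N w ^+ 2).
    by rewrite sqrtrM ?ltW// sqrtr_sqr ger0_norm.
  by rewrite ler_wsqrtr// coercive.
apply: (@riesz_representation R _ HL (full_form q)) => //.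
- by move=> a w v z; exact: full_form_lin.
- by move=> w v hw hv; rewrite /full_form (P_sym hw hv) (b_sym (admLI aq) hw hv).
- by move=> w hw; exact: full_form_ge0.
- exists (`|C| / Num.sqrt c) => v hv; apply: le_trans (Lb v hv) _.
  apply: (@le_trans _ _ (`|C| * N v)); first by rewrite ler_wpM2r// ler_norm.
  by rewrite mulrAC -mulrA ler_wpM2l//; exact: sqrt_c.
move=> w_ hw cauchy; pose C' := CP + Cb * Ln q.
have C'0 : 0 <= C' by rewrite addr_ge0// mulr_ge0.
have [w [hw' cvw]] : exists w, HL w /\ forall e : R, 0 < e -> exists m, forall k,
    (m <= k)%N -> N (fun x => w_ k x - w x) <= e.
  apply: complete => // e e0; have ce : 0 < c * e ^+ 2 by rewrite mulr_gt0// exprn_gt0.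
  have [m mP] := cauchy _ ce; exists m => j k mj mk.
  rewrite -(@ler_pXn2r _ 2)// ?nnegrE ?(ltW e0)// -(ler_pM2l c_gt0).
  exact: le_trans (coercive aq (H_sub (hw j) (hw k))) (mP j k mj mk).
exists w; split=> // e e0.
(* The form is at most [C' t^2] with [t] the distance. The bound [t <= 1] reduces this to [C' t],
   and the second bound makes that at most [e]. *)
have e1 : 0 < Num.min 1 (e / (C' + 1)) by rewrite lt_min ltr01 divr_gt0// ltr_wpDl.
have [m mP] := cvw _ e1; exists m => k mk.
have hs := H_sub (hw k) hw'; have := mP k mk; set t := N _ => tle.
have t0 : 0 <= t by exact: N_ge0.
have t1 : t <= 1 by apply: le_trans tle _; rewrite ge_min lexx.
have t2 : t <= e / (C' + 1) by apply: le_trans tle _; rewrite ge_min lexx orbT.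
apply: le_trans (ler_norm _) _; apply: le_trans (full_form_bound aq hs hs) _; rewrite -/C' -/t.
apply: (@le_trans _ _ (C' * t)); first by rewrite ler_piMr// mulr_ge0.
apply: (@le_trans _ _ ((C' + 1) * (e / (C' + 1)))).
  by rewrite ler_pM// lerDl.
by rewrite mulrC divfK// gt_eqF// ltr_wpDl.
Qed.

Lemma ae_full_form q u u' : adm q -> HL u -> HL u' ->
  (forall v, HL v -> full_form q u v = full_form q u' v) -> ae u u'.
Proof.
move=> aq hu hu' e; apply/(aeP hu hu').
have := @energy_bound q (fun x => u x - u' x) 0 aq (H_sub hu hu') (lexx _).
rewrite mul0r; apply => v hv.
by rewrite (full_form_sub aq hu hu' hv) e// subrr normr0 mul0r.
Qed.

Lemma ae_full_formE q u u' v : adm q -> HL u -> HL u' -> HL v -> ae u u' ->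
  full_form q u v = full_form q u' v.
Proof.
move=> aq hu hu' hv /(aeP hu hu') n0; apply/eqP.
rewrite -subr_eq0 -(full_form_sub aq hu hu' hv) -normr_le0.
apply: le_trans (full_form_bound aq (H_sub hu hu') hv) _.
rewrite mulr_le0_ge0// mulr_ge0_le0// addr_ge0// mulr_ge0//.
Qed.

Lemma ae_bE h u u' v : LI h -> HL u -> HL u' -> HL v -> ae u u' ->
  b h u v = b h u' v.
Proof.
move=> Lh hu hu' hv /(aeP hu hu') n0; apply/eqP.
rewrite -subr_eq0 -(b_sub Lh hu hu' hv) -normr_le0.
apply: le_trans (b_bound Lh (H_sub hu hu') hv) _.
by rewrite mulr_le0_ge0// mulr_ge0_le0// mulr_ge0.
Qed.

Lemma ae_N0 w v : HL w -> HL v -> ae w v -> N (fun x => w x - v x) = 0.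
Proof.
by move=> hw hv /(aeP hw hv) n0; apply/eqP; rewrite eq_le n0 N_ge0.
Qed.

Lemma ae_triN w w' v v' : HL w -> HL w' -> HL v -> HL v' -> ae w w' -> ae v v' ->
  N (fun x => w x - v x) <= N (fun x => w' x - v' x).
Proof.
move=> hw hw' hv hv' /(ae_N0 hw hw') e1 /(ae_N0 hv hv') e2.
have := N_sub (H_sub hw hw') (H_sub hv hv'); rewrite e1 e2 addr0 => e3.
have := N_add (H_sub (H_sub hw hw') (H_sub hv hv')) (H_sub hw' hv').
rewrite (_ : (fun x => _) = fun x => w x - v x); last by apply/funext => x; ring.
by move=> h; apply: le_trans h _; rewrite gerDr.
Qed.

Variables (E : X -> Y) (F : Y -> R) (CF : R).
Hypotheses (CF_ge0 : 0 <= CF)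
  (HE : forall q, adm q -> HL (E q))
  (EF : forall q v, adm q -> HL v -> full_form q (E q) v = F v)
  (F_bound : forall v, HL v -> `|F v| <= CF * N v).

Local Notation deriv := (forall m, X -> ('I_m -> X) -> Y).
Local Notation LIs h := (forall i, LI (h i)).
Local Notation prodL h := (\prod_i Ln (h i)).

(** The recursive equations alone, with no mention of limits. Bounds, multilinearity and remainder
    estimates follow from them; conversely every family of derivatives satisfies them. *)
Record hierarchy (D : deriv) : Prop := Hierarchy {
  hierarchy_HL : forall m q (h : 'I_m -> X), adm q -> LIs h -> HL (D m q h);
  hierarchy0 : forall q h, adm q -> ae (D 0%N q h) (E q);
  hierarchyS : forall m q (h : 'I_m.+1 -> X) v, adm q -> LIs h -> HL v ->
    full_form q (D m.+1 q h) v = - \sum_(i < m.+1) b (h i) (D m q (drop_dir h i)) v }.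

Lemma prodL_ge0 m (h : 'I_m -> X) : 0 <= prodL h.
Proof. by apply: prodr_ge0 => i _. Qed.

Lemma prodL_drop m (h : 'I_m.+1 -> X) i : Ln (h i) * prodL (drop_dir h i) = prodL h.
Proof. by rewrite [RHS](bigD1_ord i). Qed.

(** In closed form [m! Cb^m / c^(m+1)]: the equation of order [m] has [m] summands, each costing a
    factor [Cb], and solving it costs [1 / c]. *)
Fixpoint bound_const m : R := if m is m'.+1 then (m%:R * Cb * bound_const m') / c else c^-1.

Lemma bound_const_ge0 m : 0 <= bound_const m.
Proof.
elim: m => [|m IH]; first by rewrite invr_ge0 ltW.
by rewrite /= divr_ge0 ?(ltW c_gt0)// !mulr_ge0.
Qed.

Section hierarchy_theory.
Variable D : deriv.
Arguments D : clear implicits.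
Hypothesis hD : hierarchy D.

Let DHL := hierarchy_HL hD.
Let LIdrop m (h : 'I_m.+1 -> X) i : LIs h -> forall j, LI (drop_dir h i j).
Proof. by move=> Lh j; exact: Lh. Qed.

Lemma hierarchy0E q h v : adm q -> HL v -> full_form q (D 0%N q h) v = F v.
Proof.
move=> aq hv; have h0 : HL (D 0%N q h) by apply: DHL => // -[].
by rewrite (ae_full_formE aq h0 (HE aq) hv (hierarchy0 hD h aq)) EF.
Qed.

Lemma sum_b_le m (h : 'I_m.+1 -> X) (w : 'I_m.+1 -> Y) (K : R) v : LIs h ->
  (forall i, HL (w i)) -> HL v -> (forall i, N (w i) <= K * prodL (drop_dir h i)) ->
  `|\sum_(i < m.+1) b (h i) (w i) v| <= m.+1%:R * Cb * K * prodL h * N v.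
Proof.
move=> Lh hw hv le; apply: le_trans (ler_norm_sum _ _ _) _.
apply: (@le_trans _ _ (\sum_(i < m.+1) Cb * K * prodL h * N v)).
  apply: ler_sum => i _; apply: le_trans (b_bound (Lh i) (hw i) hv) _.
  rewrite ler_wpM2r// -(prodL_drop h i).
  have -> : Cb * K * (Ln (h i) * prodL (drop_dir h i)) =
            Cb * Ln (h i) * (K * prodL (drop_dir h i)) by ring.
  by rewrite ler_wpM2l// mulr_ge0.
by rewrite sumr_const card_ord -[leLHS]mulr_natl !mulrA.
Qed.

Lemma hierarchy_bound m q (h : 'I_m -> X) : adm q -> LIs h ->
  N (D m q h) <= bound_const m * CF * prodL h.
Proof.
move=> aq; elim: m h => [|m IH] h Lh.
  rewrite big_ord0 mulr1 /= mulrC; apply: (energy_bound aq) => //; first exact: DHL.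
  by move=> v hv; rewrite hierarchy0E// F_bound.
have K0 : 0 <= m.+1%:R * Cb * (bound_const m * CF) * prodL h.
  by rewrite !mulr_ge0// ?bound_const_ge0// prodL_ge0.
have -> : bound_const m.+1 * CF * prodL h = m.+1%:R * Cb * (bound_const m * CF) * prodL h / c.
  by rewrite /=; ring.
apply: (energy_bound aq) => //; first exact: DHL.
move=> v hv; rewrite (hierarchyS hD aq Lh hv) normrN; apply: sum_b_le => // i.
  by apply: DHL => //; exact: LIdrop.
by apply: IH; exact: LIdrop.
Qed.

(** Two elements with the same form against all test elements agree. In the summand that removes
    slot [i] the linear dependence is in the potential of [b]; in every other summand it is in the
    derivative of lower order, where the induction hypothesis applies. *)
Lemma hierarchy_multilinear m q (h : 'I_m -> X) i a v w : adm q -> LIs h -> LI v -> LI w ->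
  ae (D m q (set_nth_dir h i (fun x => a * v x + w x)))
     (fun x => a * D m q (set_nth_dir h i v) x + D m q (set_nth_dir h i w) x).
Proof.
move=> aq; elim: m h i => [h []//|m IH] h i Lh Lv Lw.
have Lvw := LI_lin a Lv Lw.
have Lset k : LI k -> forall j, LI (set_nth_dir h i k j).
  by move=> Lk j; rewrite /set_nth_dir; case: eqP.
have hset k (Lk : LI k) := DHL aq (Lset k Lk).
apply: (ae_full_form aq); [exact: hset|by apply: H_lin; exact: hset|].
move=> z hz; rewrite (full_form_lin a aq (hset v Lv) (hset w Lw) hz).
rewrite !(hierarchyS hD aq _ hz); try exact: Lset.
rewrite mulrN -opprD mulr_sumr -big_split; congr (- _); apply: eq_bigr => j _ /=.
case: (unliftP j i) => [i' ei|ei].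
  have hj x : set_nth_dir h i x j = h j.
    by rewrite /set_nth_dir ei (negbTE (neq_lift _ _)).
  rewrite !hj ei !drop_set_nth_lift.
  have Ld k : LI k -> forall l, LI (set_nth_dir (drop_dir h j) i' k l).
    by move=> Lk l; rewrite /set_nth_dir; case: eqP => // _; exact: LIdrop.
  have hd k (Lk : LI k) := DHL aq (Ld k Lk).
  rewrite (ae_bE (Lh j) (hd _ Lvw) (H_lin a (hd v Lv) (hd w Lw)) hz).
    by rewrite (b_lin1 a (Lh j) (hd v Lv) (hd w Lw) hz).
  by apply: IH => // l; exact: LIdrop.
rewrite -ei !drop_set_nth_same /set_nth_dir eqxx.
by rewrite (b_lin0 a Lv Lw (DHL aq (LIdrop i Lh)) hz).
Qed.

(** The two recursions mirror the equations for differences and for remainders: [m] summands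
    inherited from the order below and one term [b h (.)] produced by the change of potential, all
    divided by [c]. None of them involves [q]. *)
Fixpoint diff_const m : R :=
  if m is m'.+1 then (m%:R * Cb * diff_const m' + Cb * bound_const m) / c else Cb * bound_const 0 / c.

Fixpoint remainder_const m : R :=
  if m is m'.+1 then (m%:R * Cb * remainder_const m' + Cb * diff_const m) / c else Cb * diff_const 0 / c.

Lemma diff_const_ge0 m : 0 <= diff_const m.
Proof.
elim: m => [|m IH]; first by rewrite /= divr_ge0 ?mulr_ge0 ?invr_ge0// ltW.
rewrite [diff_const _]/= -/(bound_const m.+1) divr_ge0 ?(ltW c_gt0)// addr_ge0// mulr_ge0 ?bound_const_ge0//.
by rewrite mulr_ge0.
Qed.

Lemma remainder_const_ge0 m : 0 <= remainder_const m.
Proof.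
elim: m => [|m IH]; first by rewrite [remainder_const _]/= divr_ge0 ?(ltW c_gt0)// mulr_ge0//; exact: (diff_const_ge0 0).
rewrite [remainder_const _]/= -/(diff_const m.+1) divr_ge0 ?(ltW c_gt0)// addr_ge0// mulr_ge0 ?diff_const_ge0//.
by rewrite mulr_ge0.
Qed.

Lemma full_form_shift q h w v : adm q -> LI h -> HL w -> HL v ->
  full_form (q \+ h) w v = full_form q w v + b h w v.
Proof.
move=> /admLI Lq Lh hw hv; rewrite /full_form -addrA; congr (_ + _).
rewrite (_ : q \+ h = fun x => 1 * q x + h x); first by rewrite b_lin0// mul1r.
by apply/funext => x /=; ring.
Qed.

(** The equation at [q + h] becomes one at [q] once [b h (D m (q + h) k) v] is moved to the right.
    The difference then solves an equation at [q] whose data are that term, of size [Ln h], and the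
    differences of the order below. *)
Lemma hierarchy_diff m q h (k : 'I_m -> X) : adm q -> LI h -> adm (q \+ h) -> LIs k ->
  N (fun x => D m (q \+ h) k x - D m q k x) <= diff_const m * CF * Ln h * prodL k.
Proof.
move=> aq Lh aqh; elim: m k => [|m IH] k Lk.
  have hu := DHL aq Lk; have hu' := DHL aqh Lk.
  have -> : diff_const 0 * CF * Ln h * prodL k = Cb * Ln h * (bound_const 0 * CF * prodL k) / c.
    by rewrite /=; ring.
  apply: (energy_bound aq); first exact: H_sub.
    by rewrite !mulr_ge0// ?prodL_ge0// invr_ge0 ltW.
  move=> v hv; rewrite (full_form_sub aq hu' hu hv) hierarchy0E//.
  have := full_form_shift aq Lh hu' hv; rewrite hierarchy0E// => ->.
  rewrite opprD addrA subrr sub0r normrN.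
  apply: le_trans (b_bound Lh hu' hv) _; rewrite ler_wpM2r//.
  by rewrite ler_wpM2l ?mulr_ge0// hierarchy_bound.
have hu := DHL aq Lk; have hu' := DHL aqh Lk.
have hui i := DHL aq (LIdrop i Lk); have hui' i := DHL aqh (LIdrop i Lk).
have -> : diff_const m.+1 * CF * Ln h * prodL k =
    (m.+1%:R * Cb * (diff_const m * CF * Ln h) * prodL k +
     Cb * Ln h * (bound_const m.+1 * CF * prodL k)) / c by rewrite [diff_const m.+1]/= -/(bound_const m.+1); ring.
apply: (energy_bound aq); first exact: H_sub.
  have := bound_const_ge0 m.+1; have := diff_const_ge0 m; have := prodL_ge0 k.
  by move: (bound_const m.+1) (diff_const m) (prodL k) => x y z x0 y0 z0; rewrite addr_ge0 ?mulr_ge0.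
move=> v hv; rewrite (full_form_sub aq hu' hu hv).
have e : full_form q (D m.+1 (q \+ h) k) v =
    full_form (q \+ h) (D m.+1 (q \+ h) k) v - b h (D m.+1 (q \+ h) k) v.
  by rewrite (full_form_shift aq Lh hu' hv) addrK.
rewrite e (hierarchyS hD aqh Lk hv) (hierarchyS hD aq Lk hv).
have -> : - (\sum_(i < m.+1) b (k i) (D m (q \+ h) (drop_dir k i)) v) -
    b h (D m.+1 (q \+ h) k) v - - (\sum_(i < m.+1) b (k i) (D m q (drop_dir k i)) v) =
  - (\sum_(i < m.+1) b (k i) (fun x => D m (q \+ h) (drop_dir k i) x - D m q (drop_dir k i) x) v)
  - b h (D m.+1 (q \+ h) k) v.
  rewrite opprK addrAC; congr (_ - _).
  rewrite -[X in - X + _]opprK opprK addrC -sumrB -sumrN; apply: eq_bigr => i _.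
  by rewrite (b_sub (Lk i) (hui' i) (hui i) hv) opprB.
apply: le_trans (ler_normB _ _) _; rewrite normrN mulrDl; apply: lerD.
  apply: sum_b_le => // i; first exact: H_sub.
  by apply: IH; exact: LIdrop.
apply: le_trans (b_bound Lh hu' hv) _; rewrite ler_wpM2r//.
by rewrite ler_wpM2l ?mulr_ge0//; exact: hierarchy_bound.
Qed.

Let LIcons m h (k : 'I_m -> X) : LI h -> LIs k -> LIs (cons_dir h k).
Proof.
move=> Lh Lk i; case: (unliftP ord0 i) => [j|] ->; first by rewrite cons_dirS.
by rewrite cons_dir0.
Qed.

(** The term [b h (D m (q + h) k)] from the change of potential meets the summand [b h (D m q k)]
    that the derivative in direction [(h, k)] contributes by removing [h]. Only [b h] of the
    difference is left, which is quadratic in [h]; the other summands are remainders of the order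
    below. *)
Lemma hierarchy_remainder m q h (k : 'I_m -> X) : adm q -> LI h -> adm (q \+ h) -> LIs k ->
  N (fun x => D m (q \+ h) k x - D m q k x - D m.+1 q (cons_dir h k) x) <=
  remainder_const m * CF * Ln h ^+ 2 * prodL k.
Proof.
move=> aq Lh aqh; elim: m k => [|m IH] k Lk.
  have hu := DHL aq Lk; have hu' := DHL aqh Lk; have hd := DHL aq (LIcons Lh Lk).
  have hs := H_sub hu' hu.
  have -> : remainder_const 0 * CF * Ln h ^+ 2 * prodL k = Cb * Ln h * (diff_const 0 * CF * Ln h * prodL k) / c.
    by rewrite [remainder_const 0]/= -/(diff_const 0); ring.
  apply: (energy_bound aq); first exact: (H_sub hs hd).
    have := diff_const_ge0 0; have := prodL_ge0 k.
    by move: (diff_const 0) (prodL k) => x y x0 y0; rewrite !mulr_ge0.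
  move=> v hv; rewrite (full_form_sub aq hs hd hv) (full_form_sub aq hu' hu hv).
  rewrite (hierarchyS hD aq (LIcons Lh Lk) hv) big_ord1 cons_dir0 drop_cons_dir0 opprK.
  have := full_form_shift aq Lh hu' hv; rewrite !hierarchy0E// => e.
  have -> : full_form q (D 0%N (q \+ h) k) v - F v + b h (D 0%N q k) v =
      - b h (fun x => D 0%N (q \+ h) k x - D 0%N q k x) v.
    by rewrite (b_sub Lh hu' hu hv) {1}e; ring.
  rewrite normrN; apply: le_trans (b_bound Lh hs hv) _; rewrite ler_wpM2r//.
  by rewrite ler_wpM2l ?mulr_ge0//; exact: hierarchy_diff.
have hu := DHL aq Lk; have hu' := DHL aqh Lk; have hd := DHL aq (LIcons Lh Lk).
have hs := H_sub hu' hu.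
have Ld i := LIdrop i Lk.
have hui i := DHL aq (Ld i); have hui' i := DHL aqh (Ld i).
have hdi i := DHL aq (LIcons Lh (Ld i)).
have hsi i := H_sub (hui' i) (hui i).
have -> : remainder_const m.+1 * CF * Ln h ^+ 2 * prodL k =
    (m.+1%:R * Cb * (remainder_const m * CF * Ln h ^+ 2) * prodL k +
     Cb * Ln h * (diff_const m.+1 * CF * Ln h * prodL k)) / c.
  by rewrite [remainder_const m.+1]/= -/(diff_const m.+1); ring.
apply: (energy_bound aq); first exact: (H_sub hs hd).
  have := diff_const_ge0 m.+1; have := remainder_const_ge0 m; have := prodL_ge0 k.
  move: (diff_const m.+1) (remainder_const m) (prodL k) => x y z x0 y0 z0.
  by rewrite addr_ge0 ?mulr_ge0 ?sqr_ge0.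
move=> v hv; rewrite (full_form_sub aq hs hd hv) (full_form_sub aq hu' hu hv).
have e : full_form q (D m.+1 (q \+ h) k) v =
    full_form (q \+ h) (D m.+1 (q \+ h) k) v - b h (D m.+1 (q \+ h) k) v.
  by rewrite (full_form_shift aq Lh hu' hv) addrK.
rewrite e (hierarchyS hD aqh Lk hv) (hierarchyS hD aq Lk hv).
have eD := hierarchyS hD aq (LIcons Lh Lk) hv.
rewrite big_ord_recl cons_dir0 drop_cons_dir0 in eD; rewrite {}eD.
(* The remainder of order [m] in the directions without [k i], to which the induction hypothesis
   applies. *)
pose r i x := D m (q \+ h) (drop_dir k i) x - D m q (drop_dir k i) x -
  D m.+1 q (cons_dir h (drop_dir k i)) x.
have hr i : HL (r i) by exact: (H_sub (hsi i) (hdi i)).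
have -> : \sum_(i < m.+1) b (cons_dir h k (lift ord0 i))
      (D m.+1 q (drop_dir (cons_dir h k) (lift ord0 i))) v =
    \sum_(i < m.+1) b (k i) (D m (q \+ h) (drop_dir k i)) v -
    \sum_(i < m.+1) b (k i) (D m q (drop_dir k i)) v - \sum_(i < m.+1) b (k i) (r i) v.
  rewrite -!sumrB; apply: eq_bigr => i _; rewrite cons_dirS drop_cons_dirS.
  rewrite (b_sub (Lk i) (hsi i) (hdi i) hv) (b_sub (Lk i) (hui' i) (hui i) hv); ring.
set S1 := \sum_(i < m.+1) b (k i) (D m (q \+ h) _) v.
set S2 := \sum_(i < m.+1) b (k i) (D m q _) v.
set S3 := \sum_(i < m.+1) b (k i) (r i) v.
have -> : - S1 - b h (D m.+1 (q \+ h) k) v - - S2 -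
    - (b h (D m.+1 q k) v + (S1 - S2 - S3)) =
    - S3 - b h (fun x => D m.+1 (q \+ h) k x - D m.+1 q k x) v.
  by rewrite (b_sub Lh hu' hu hv); ring.
apply: le_trans (ler_normB _ _) _; rewrite normrN mulrDl; apply: lerD.
  by apply: sum_b_le => // i; exact: IH.
apply: le_trans (b_bound Lh hs hv) _; rewrite ler_wpM2r//.
by rewrite ler_wpM2l ?mulr_ge0//; exact: hierarchy_diff.
Qed.

End hierarchy_theory.

Definition deriv_sol m (D : X -> ('I_m -> X) -> Y) q (h : 'I_m.+1 -> X) : Y :=
  xget (fun=> 0) [set u | HL u /\ forall v, HL v ->
    full_form q u v = - \sum_(i < m.+1) b (h i) (D q (drop_dir h i)) v].

Fixpoint sol_deriv m : X -> ('I_m -> X) -> Y :=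
  match m with
  | 0%N => fun q _ => E q
  | m'.+1 => fun q h => deriv_sol (@sol_deriv m') q h
  end.

(** Each order is obtained from the one below by [solve]. The right-hand side is linear in the test
    element because each [b h] is symmetric and linear in its first argument. *)
Lemma sol_hierarchy : hierarchy sol_deriv.
Proof.
have key m (D : X -> ('I_m -> X) -> Y) q (h : 'I_m.+1 -> X) : adm q -> LIs h ->
    (forall k, LIs k -> HL (D q k)) -> HL (deriv_sol D q h) /\ forall v, HL v ->
    full_form q (deriv_sol D q h) v = - \sum_(i < m.+1) b (h i) (D q (drop_dir h i)) v.
  move=> aq Lh hD.
  have hDi i : HL (D q (drop_dir h i)) by apply: hD => j; exact: Lh.
  suff [u uP] : exists u, HL u /\ forall v, HL v ->
      full_form q u v = - \sum_(i < m.+1) b (h i) (D q (drop_dir h i)) v.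
    exact: (@xgetPex _ (fun=> 0) [set u | HL u /\ forall v, HL v ->
      full_form q u v = - \sum_(i < m.+1) b (h i) (D q (drop_dir h i)) v] (ex_intro _ u uP)).
  apply: (@solve q (fun v => - \sum_(i < m.+1) b (h i) (D q (drop_dir h i)) v)
    (\sum_(i < m.+1) Cb * Ln (h i) * N (D q (drop_dir h i)))) => //.
    move=> a w v hw hv; rewrite mulrN -opprD mulr_sumr -big_split; congr (- _).
    apply: eq_bigr => i _ /=; rewrite (b_sym (Lh i) (hDi i) (H_lin a hw hv)).
    by rewrite (b_lin1 a (Lh i) hw hv (hDi i)) !(b_sym (Lh i) (hDi i)).
  move=> v hv; rewrite normrN mulr_suml; apply: le_trans (ler_norm_sum _ _ _) _.
  by apply: ler_sum => i _; exact: b_bound.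
have hHL m q (h : 'I_m -> X) : adm q -> LIs h -> HL (sol_deriv q h).
  move=> aq; elim: m h => [|m IH] h Lh; first exact: HE.
  by have [] := key m _ q h aq Lh IH.
split=> //.
  move=> q h aq; apply/aeP; try exact: HE.
  by apply: (@le_trans _ _ (0 / c)); [apply: (energy_bound aq) => //;
     [exact: (H_sub (HE aq) (HE aq))|move=> v hv; rewrite (full_form_sub aq (HE aq) (HE aq) hv) subrr normr0 mul0r]
    |rewrite mul0r].
move=> m q h v aq Lh hv; have [_] := key m _ q h aq Lh (fun k Lk => hHL m q k aq Lk).
exact.
Qed.

(** The abstract counterpart of [frechet_derivatives], with the same shape so that the two are
    convertible once the concrete spaces are substituted. *)
Definition frechet (D : deriv) : Prop :=
  [/\ forall q h, adm q -> ae (D 0%N q h) (E q),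
      forall m q, adm q ->
        [/\ forall h, LIs h -> HL (D m q h),
            forall h i (a : R) v w, LIs h -> LI v -> LI w ->
              ae (D m q (set_nth_dir h i (fun x => a * v x + w x)))
                (fun x => a * D m q (set_nth_dir h i v) x + D m q (set_nth_dir h i w) x) &
            exists M : R, forall h, LIs h -> N (D m q h) <= M * \prod_(i < m) Ln (h i)] &
      forall m q, adm q -> forall e : R, 0 < e -> exists2 delta : R, 0 < delta &
        forall h, LI h -> adm (q \+ h) -> Ln h <= delta ->
        forall k : 'I_m -> X, LIs k ->
          N (fun x => D m (q \+ h) k x - D m q k x - D m.+1 q (cons_dir h k) x)
          <= e * Ln h * \prod_(i < m) Ln (k i)].

Lemma hierarchy_frechet D : hierarchy D -> frechet D.
Proof.
move=> hD; split; first exact: hierarchy0 hD.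
  move=> m q aq; split; first by move=> h; exact: (hierarchy_HL hD aq).
    by move=> h i a v w Lh Lv Lw; exact: (hierarchy_multilinear hD).
  by exists (bound_const m * CF) => h Lh; exact: (hierarchy_bound hD).
move=> m q aq e e0; pose C := remainder_const m * CF + 1.
have C0 : 0 < C by rewrite ltr_wpDl// mulr_ge0// remainder_const_ge0.
exists (e / C); first by rewrite divr_gt0.
move=> h Lh aqh le k Lk; apply: le_trans (hierarchy_remainder hD aq Lh aqh Lk) _.
rewrite ler_wpM2r ?prodL_ge0// expr2 mulrA ler_wpM2r//.
apply: (@le_trans _ _ (C * (e / C))); last by rewrite mulrC divfK// gt_eqF.
by rewrite ler_pM// ?mulr_ge0 ?remainder_const_ge0// lerDl.
Qed.

(** Agreement at order [m] holds at every admissible potential, in particular at [q + t a]. So both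
    candidates of order [m + 1] in direction [t a] approximate the same increment up to an error of
    order [e t], and division by [t] lets [e] be arbitrary. This needs [q + t a] admissible for
    small [t]; multilinearity then covers all directions. *)
Lemma frechet_unique D D' : frechet D -> frechet D' -> forall m q (h : 'I_m -> X),
  adm q -> LIs h -> ae (D m q h) (D' m q h).
Proof.
move=> [D0 Dml Dlim] [D0' Dml' Dlim'].
have DH m q (h : 'I_m -> X) : adm q -> LIs h -> HL (D m q h).
  by move=> aq; case: (Dml m q aq) => + _ _; exact.
have DH' m q (h : 'I_m -> X) : adm q -> LIs h -> HL (D' m q h).
  by move=> aq; case: (Dml' m q aq) => + _ _; exact.
elim=> [|m IH] q h aq Lh.
  have h1 := DH _ _ h aq Lh; have h2 := DH' _ _ h aq Lh; have hE := HE aq.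
  apply/(aeP h1 h2); have nE : N (fun x => E q x - E q x) <= 0.
    apply: (@le_trans _ _ (0 / c)); last by rewrite mul0r.
    apply: (energy_bound aq) => //; first exact: (H_sub hE hE).
    by move=> v hv; rewrite (full_form_sub aq hE hE hv) subrr normr0 mul0r.
  exact: le_trans (ae_triN h1 hE h2 hE (D0 q h aq) (D0' q h aq)) nE.
pose k j := h (lift ord0 j); have Lk j : LI (k j) by exact: Lh.
have LC a : LI a -> LIs (cons_dir a k).
  move=> La i; case: (unliftP ord0 i) => [j|] ->; first by rewrite cons_dirS.
  by rewrite cons_dir0.
have lin (G : deriv) (GH : forall m q (h : 'I_m -> X), adm q -> LIs h -> HL (G m q h))
    (Gml : forall h i (a : R) v w, LIs h -> LI v -> LI w ->
      ae (G m.+1 q (set_nth_dir h i (fun x => a * v x + w x)))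
        (fun x => a * G m.+1 q (set_nth_dir h i v) x + G m.+1 q (set_nth_dir h i w) x))
    a v w : LI v -> LI w -> ae (G m.+1 q (cons_dir (fun x => a * v x + w x) k))
      (fun x => a * G m.+1 q (cons_dir v k) x + G m.+1 q (cons_dir w k) x).
  move=> Lv Lw; have := Gml (cons_dir v k) ord0 a v w (LC v Lv) Lv Lw.
  by rewrite !set_cons_dir0.
have linD := lin D DH (let: And3 _ x _ := Dml m.+1 q aq in x).
have linD' := lin D' DH' (let: And3 _ x _ := Dml' m.+1 q aq in x).
have key a t0 : LI a -> 0 < t0 -> (forall t, 0 < t <= t0 -> adm (q \+ (fun x => t * a x))) ->
    ae (D m.+1 q (cons_dir a k)) (D' m.+1 q (cons_dir a k)).
  move=> La t00 admt; have h1 := DH _ _ _ aq (LC a La); have h2 := DH' _ _ _ aq (LC a La).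
  (* The factor 2 counts the two remainders; with tolerance [e / B] their sum, divided by [t], is at
     most [e]. The summand 1 keeps [B] positive. *)
  apply/(aeP h1 h2); pose B := 2 * (Ln a * prodL k) + 1.
  have B0 : 0 < B by rewrite ltr_wpDl// mulr_ge0// mulr_ge0// prodL_ge0.
  apply/ler_addgt0Pr => e e0; rewrite add0r.
  have eB : 0 < e / B by rewrite divr_gt0.
  have [d1 d10 P1] := Dlim m q aq _ eB; have [d2 d20 P2] := Dlim' m q aq _ eB.
  (* Small enough for [q + t a] to be admissible and for [t a] to be within the radii of both
     differentiability conditions. *)
  pose t := Num.min t0 (Num.min d1 d2 / (Ln a + 1)).
  have a1 : 0 < Ln a + 1 by rewrite ltr_wpDl.
  have tpos : 0 < t by rewrite lt_min t00 divr_gt0// lt_min d10.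
  have [Lta lta] := LnZ t La; rewrite ger0_norm ?(ltW tpos)// in lta.
  have small : Ln (fun x => t * a x) <= Num.min d1 d2.
    apply: le_trans lta _; apply: (@le_trans _ _ (t * (Ln a + 1))).
      by rewrite ler_wpM2l ?(ltW tpos)// lerDl.
    by rewrite -ler_pdivlMr// ge_min lexx orbT.
  have at_ : adm (q \+ (fun x => t * a x)) by apply: admt; rewrite tpos ge_min lexx.
  have [s1 s2] : Ln (fun x => t * a x) <= d1 /\ Ln (fun x => t * a x) <= d2.
    by move: small; rewrite le_min => /andP[].
  have {}P1 := P1 _ Lta at_ s1 k Lk; have {}P2 := P2 _ Lta at_ s2 k Lk.
  (* Multilinearity is available for combinations [a v + w] only; this writing yields homogeneity
     without the value at the zero direction. *)
  have ta : (fun x => t * a x) = (fun x => (t - 1) * a x + a x).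
    by apply/funext => x; ring.
  have g1 := DH _ _ k aq Lk; have g2 := DH' _ _ k aq Lk.
  have f1 := DH _ _ k at_ Lk; have f2 := DH' _ _ k at_ Lk.
  have z1 := DH _ _ _ aq (LC _ Lta); have z2 := DH' _ _ _ aq (LC _ Lta).
  have n0g := ae_N0 g1 g2 (IH q k aq Lk); have n0f := ae_N0 f1 f2 (IH _ k at_ Lk).
  (* By the induction hypothesis the increments of [D m] and [D' m] agree, so this difference is a
     difference of two remainders. *)
  have nz : N (fun x => D m.+1 q (cons_dir (fun x => t * a x) k) x -
      D' m.+1 q (cons_dir (fun x => t * a x) k) x) <= 2 * (e / B * (t * Ln a) * prodL k).
    have := N_sub (H_sub (H_sub f2 g2) z2) (H_sub (H_sub f1 g1) z1).
    set r := (fun x => _ - _) => nr.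
    have hr : HL r by exact: (H_sub (H_sub (H_sub f2 g2) z2) (H_sub (H_sub f1 g1) z1)).
    have := N_sub (H_sub f1 f2) (H_sub g1 g2); rewrite n0g n0f addr0.
    set r' := (fun x => _ - _) => nr'.
    have hr' : HL r' by exact: (H_sub (H_sub f1 f2) (H_sub g1 g2)).
    have := N_add hr hr'; rewrite (_ : (fun x => r x + r' x) = (fun x =>
       D m.+1 q (cons_dir (fun x => t * a x) k) x -
      D' m.+1 q (cons_dir (fun x => t * a x) k) x)); last first.
      by apply/funext => x; rewrite /r /r'; ring.
    move=> /le_trans; apply.
    have le3 : e / B * Ln (fun x => t * a x) * prodL k <= e / B * (t * Ln a) * prodL k.
      by rewrite ler_wpM2r ?prodL_ge0// ler_wpM2l// ltW.
    have := le_trans P1 le3; have := le_trans P2 le3; move: nr nr'.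
    set X1 := N _; set X2 := N _; set X3 := N _; set X4 := N _; lra.
  have hl1 := H_lin (t - 1) h1 h1; have hl2 := H_lin (t - 1) h2 h2.
  have e1 : ae (D m.+1 q (cons_dir (fun x => t * a x) k))
      (fun x => (t - 1) * D m.+1 q (cons_dir a k) x + D m.+1 q (cons_dir a k) x).
    by rewrite {1}ta; exact: linD.
  have e2 : ae (D' m.+1 q (cons_dir (fun x => t * a x) k))
      (fun x => (t - 1) * D' m.+1 q (cons_dir a k) x + D' m.+1 q (cons_dir a k) x).
    by rewrite {1}ta; exact: linD'.
  have n1 := ae_N0 z1 hl1 e1; have n2 := ae_N0 z2 hl2 e2.
  pose dif x := D m.+1 q (cons_dir a k) x - D' m.+1 q (cons_dir a k) x.
  have hdif : HL dif by exact: (H_sub h1 h2).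
  have ntd : N (fun x => t * dif x) <= 2 * (e / B * (t * Ln a) * prodL k).
    have := N_sub (H_sub z1 hl1) (H_sub z2 hl2); rewrite n1 n2 addr0.
    set r := (fun x => _ - _) => nr.
    have hr : HL r by exact: (H_sub (H_sub z1 hl1) (H_sub z2 hl2)).
    have := N_sub (H_sub z1 z2) hr.
    rewrite (_ : (fun x => _ - r x) = fun x => t * dif x); last first.
      by apply/funext => x; rewrite /r /dif; ring.
    by move=> /le_trans; apply; move: nr nz; set X1 := N _; set X2 := N _; lra.
  (* Homogeneity of [N] is recovered from [N_lin] with 0 as second argument, where [N] of 0 is at
     most 0 by the energy bound. *)
  have nd : N dif <= t^-1 * N (fun x => t * dif x).
    have htd : HL (fun x => t * dif x + 0) by exact: H_lin.
    have N00 : N (fun=> 0) <= 0.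
      apply: (@le_trans _ _ (0 / c)); last by rewrite mul0r.
      apply: (energy_bound aq) => // v hv.
      have := full_form_sub aq H_0 H_0 hv; rewrite (_ : (fun x => 0 - 0) = fun=> 0).
        by rewrite subrr => ->; rewrite normr0 mul0r.
      by apply/funext => x; rewrite subrr.
    have := N_lin t^-1 htd H_0; rewrite (_ : (fun x => _ * _ + 0) = dif); last first.
      by apply/funext => x; field; rewrite gt_eqF.
    rewrite (_ : (fun x => t * dif x + 0) = fun x => t * dif x); last first.
      by apply/funext => x; rewrite addr0.
    rewrite gtr0_norm ?invr_gt0// => /le_trans; apply.
    by rewrite gerDl.
  apply: le_trans nd _; rewrite ler_pdivrMl//; apply: le_trans ntd _.
  have -> : 2 * (e / B * (t * Ln a) * prodL k) = t * (e / B * (2 * (Ln a * prodL k))) by ring.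
  rewrite ler_wpM2l ?(ltW tpos)//; apply: (@le_trans _ _ (e / B * B)).
    by rewrite ler_wpM2l ?(ltW eB)// lerDl.
  by rewrite divfK// gt_eqF.
have [a1 [a2 [La1 La2 ea [t0 t00 admt]]]] := dir_split aq (Lh ord0).
have k1 := key a1 t0 La1 t00 (fun t ht => (admt t ht).1).
have k2 := key a2 t0 La2 t00 (fun t ht => (admt t ht).2).
have u1 := DH _ _ _ aq (LC a1 La1); have u2 := DH _ _ _ aq (LC a2 La2).
have u1' := DH' _ _ _ aq (LC a1 La1); have u2' := DH' _ _ _ aq (LC a2 La2).
have Eh : h = cons_dir (fun x => -1 * a2 x + a1 x) k.
  by rewrite {1}[h]cons_dir_drop {1}ea.
have hh := DH _ _ _ aq Lh; have hh' := DH' _ _ _ aq Lh.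
have l1 : ae (D m.+1 q h) (fun x => -1 * D m.+1 q (cons_dir a2 k) x + D m.+1 q (cons_dir a1 k) x).
  by rewrite {1}Eh; exact: linD.
have l2 : ae (D' m.+1 q h) (fun x => -1 * D' m.+1 q (cons_dir a2 k) x + D' m.+1 q (cons_dir a1 k) x).
  by rewrite {1}Eh; exact: linD'.
have s1 := H_lin (-1) u2 u1; have s2 := H_lin (-1) u2' u1'.
apply/(aeP hh hh'); apply: le_trans (ae_triN hh s1 hh' s2 l1 l2) _.
have := N_lin (-1) (H_sub u2 u2') (H_sub u1 u1').
rewrite (ae_N0 u1 u1' k1) (ae_N0 u2 u2' k2) mulr0 addr0.
rewrite (_ : (fun x => _) = fun x =>
  (-1 * D m.+1 q (cons_dir a2 k) x + D m.+1 q (cons_dir a1 k) x) -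
  (-1 * D' m.+1 q (cons_dir a2 k) x + D' m.+1 q (cons_dir a1 k) x))//.
by apply/funext => x; ring.
Qed.

(** Nothing is differentiated here: [D] agrees almost everywhere with the constructed family, and
    both sides of the equations are insensitive to null changes. *)
Lemma frechet_hierarchy D : frechet D -> hierarchy D.
Proof.
move=> fD; have hS := sol_hierarchy; have fS := hierarchy_frechet hS.
have u m q (h : 'I_m -> X) : adm q -> LIs h -> ae (D m q h) (sol_deriv q h).
  exact: (frechet_unique fD fS).
case: (fD) => D0 Dml _.
have DH m q (h : 'I_m -> X) : adm q -> LIs h -> HL (D m q h).
  by move=> aq; case: (Dml m q aq) => + _ _; exact.
have SH := hierarchy_HL hS.
split=> // m q h v aq Lh hv.
rewrite (ae_full_formE aq (DH _ _ _ aq Lh) (SH _ _ _ aq Lh) hv (u _ _ _ aq Lh)).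
rewrite (hierarchyS hS aq Lh hv); congr (- _); apply: eq_bigr => i _.
have Ld j : LI (drop_dir h i j) by exact: Lh.
by rewrite (ae_bE (Lh i) (DH _ _ _ aq Ld) (SH _ _ _ aq Ld) hv (u _ _ _ aq Ld)).
Qed.

Lemma hierarchy_unique D m q (h : 'I_m.+1 -> X) psi : hierarchy D -> adm q -> LIs h ->
  HL psi -> (forall v, HL v ->
    full_form q psi v = - \sum_(i < m.+1) b (h i) (D m q (drop_dir h i)) v) ->
  ae psi (D m.+1 q h).
Proof.
move=> hD aq Lh hpsi e; apply: (ae_full_form aq hpsi (hierarchy_HL hD aq Lh)) => v hv.
by rewrite e// (hierarchyS hD aq Lh hv).
Qed.

Lemma frechet_smooth : (exists D, frechet D) /\ forall D, frechet D ->
  forall m q (h : 'I_m.+1 -> X), adm q -> LIs h ->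
  [/\ HL (D m.+1 q h),
      forall v, HL v -> full_form q (D m.+1 q h) v = - \sum_(i < m.+1) b (h i) (D m q (drop_dir h i)) v,
      forall psi, HL psi -> (forall v, HL v ->
        full_form q psi v = - \sum_(i < m.+1) b (h i) (D m q (drop_dir h i)) v) ->
        ae psi (D m.+1 q h) &
      N (D m.+1 q h) <= bound_const m.+1 * CF * prodL h].
Proof.
split; first by exists (@sol_deriv); exact: hierarchy_frechet sol_hierarchy.
move=> D /frechet_hierarchy hD m q h aq Lh; split.
- exact: (hierarchy_HL hD).
- by move=> v; exact: (hierarchyS hD).
- by move=> psi; exact: hierarchy_unique.
- exact: hierarchy_bound.
Qed.

End frechet.

(** * Directions pointing into the admissible set *)

Section admissible_directions.
Context {R : realType} (d : nat) (Omega : set 'rV[R]_d) (qbar : R).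
Hypotheses (mO : measurable Omega) (qbar0 : 0 < qbar).
Implicit Types q h : 'rV[R]_d -> R.
Local Notation Linf := (Linf Omega).
Local Notation Ln := (Linf_norm Omega).
Local Notation adm := (admissible Omega qbar).

Lemma admissible0 : adm (fun=> 0).
Proof.
split; last by apply: aeW => x _; rewrite lexx ltW.
by have [] := @Linf_of_ae R d Omega (fun=> 0) 0 (lexx _) (measurable_cst _)
  (aeW _ (fun x _ => eq_ind_r (fun y => y <= 0) (lexx _) (normr0 R))).
Qed.

Lemma LinfZ (a : R) h : Linf h -> Linf (fun x => a * h x) /\ Ln (fun x => a * h x) <= `|a| * Ln h.
Proof.
move=> Lh; apply: Linf_of_ae; first by rewrite mulr_ge0 ?Linf_norm_ge0.
  by apply: measurable_funM => //; case: Lh.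
by apply: filterS (Linf_ae Lh) => x hx Ox; rewrite normrM ler_wpM2l// hx.
Qed.

(* The one-sided part of [h] in which an admissible potential has room
   [qbar / 2] to move. *)
Definition inward q h : 'rV[R]_d -> R :=
  fun x => if q x <= qbar / 2 then Num.max (h x) 0 else Num.min (h x) 0.

(** The branch depends on [q] alone, so both terms use the same one, and [- max (- h) 0 = min h 0]
    makes positive and negative parts recombine to [h]. *)
Lemma inward_split q h x : h x = -1 * inward q (fun y => -1 * h y) x + inward q h x.
Proof.
rewrite /inward; case: ifP => _; rewrite ?/Num.max ?/Num.min;
  do 2 case: ifP; rewrite ?mulN1r ?oppr_lt0 ?oppr_gt0; lra.
Qed.

(** The range of [t] comes from [|t h| <= qbar / 2] almost everywhere; the summand 1 avoids a
    division by 0 when [h] vanishes. *)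
Lemma inward_admissible q h : adm q -> Linf h -> Linf (inward q h) /\
  forall t, 0 < t <= qbar / 2 / (Ln h + 1) -> adm (q \+ (fun x => t * inward q h x)).
Proof.
move=> [Lq q01] Lh; have [mq _] := Lq; have [mh _] := Lh.
have l1 : 0 < Ln h + 1 by rewrite ltr_wpDl// Linf_norm_ge0.
have Li : Linf (inward q h).
  apply: (proj1 (B := Ln (inward q h) <= Ln h)).
  apply: Linf_of_ae; first exact: Linf_norm_ge0.
    apply: measurable_fun_if => //.
    - by apply: measurable_fun_ler => //; exact: measurable_cst.
    - apply: (measurable_funS mO (@subIsetl _ _ _)).
      by have := measurable_maxr mh (measurable_cst (0 : R)).
    - apply: (measurable_funS mO (@subIsetl _ _ _)).
      by have := measurable_minr mh (measurable_cst (0 : R)).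
  apply: filterS (Linf_ae Lh) => x hx Ox; apply: le_trans (hx Ox).
  rewrite /inward; case: ifP => _; rewrite ?/Num.max ?/Num.min; case: ifP => _ //;
    by rewrite normr0.
split=> // t /andP[t0 tle]; split.
  have [+ _] := Linf_lin t Li Lq; rewrite (_ : (fun x => _) = q \+ (fun x => t * inward q h x))//.
  by apply/funext => x; rewrite addrC.
apply: filterS2 q01 (Linf_ae Lh) => x qx hx Ox /=.
have {}qx := qx Ox; have {}hx := hx Ox.
have {tle} th : `|t * h x| <= qbar / 2.
  rewrite normrM (gtr0_norm t0); apply: (@le_trans _ _ (t * (Ln h + 1))).
    by rewrite ler_wpM2l ?(ltW t0)// (le_trans hx)// lerDl.
  by rewrite -ler_pdivlMr.
move: th; rewrite ler_norml => /andP[th1 th2]; move: qx => /andP[qx1 qx2].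
rewrite /inward; case: ifPn; rewrite -?ltNge => qh; rewrite ?/Num.max ?/Num.min;
  case: ifPn; rewrite -?leNgt ?mulr0 ?addr0 ?qx1 ?qx2// => hs.
- have u0 : 0 <= t * h x by rewrite mulr_ge0// ltW.
  by apply/andP; split; lra.
- have u0 : 0 <= - (t * h x) by rewrite -mulrN mulr_ge0// ?oppr_ge0 ltW.
  by apply/andP; split; lra.
Qed.

Lemma admissible_split q h : adm q -> Linf h -> exists a1 a2 : 'rV[R]_d -> R,
  [/\ Linf a1, Linf a2, h = (fun x => -1 * a2 x + a1 x) & exists2 t0 : R, 0 < t0 &
    forall t, 0 < t <= t0 -> adm (q \+ (fun x => t * a1 x)) /\
                             adm (q \+ (fun x => t * a2 x))].
Proof.
move=> aq Lh; have [Lh' _] := LinfZ (-1) Lh.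
have [L1 P1] := inward_admissible aq Lh; have [L2 P2] := inward_admissible aq Lh'.
exists (inward q h), (inward q (fun x => -1 * h x)); split=> //.
  by apply/funext => x; exact: inward_split.
have pos k : 0 < qbar / 2 / (Ln k + 1).
  by rewrite !divr_gt0// ltr_wpDl// Linf_norm_ge0.
exists (Num.min (qbar / 2 / (Ln h + 1)) (qbar / 2 / (Ln (fun x => -1 * h x) + 1))).
  by rewrite lt_min !pos.
by move=> t /andP[t0]; rewrite le_min => /andP[t1 t2]; split;
  [apply: P1; rewrite t0|apply: P2; rewrite t0].
Qed.

End admissible_directions.

(** * Duality in the spectral spaces *)

Section spectral_duality.
Context {R : realType} (d : nat) (Omega : set 'rV[R]_d).
Variables (lam : nat -> R) (phi : nat -> 'rV[R]_d -> R) (r : R).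
Hypotheses (mO : measurable Omega) (Lphi : forall k, weighted_L2 (cst 1) Omega (phi k)).
Local Notation Hr := (Hr Omega lam phi r).
Local Notation Hr_norm := (Hr_norm Omega lam phi r).
Local Notation spectral_sum := (spectral_sum Omega lam phi r).

Lemma L2dotZl (a : R) w k : weighted_L2 (cst 1) Omega w ->
  L2dot Omega (fun x => a * w x) (phi k) = a * L2dot Omega w (phi k).
Proof.
move=> Lw; have := ip_integrable mO (measurable_cst _) (fun _ _ => ltr01) Lw (Lphi k).
rewrite (_ : _ \o _ = EFin \o (fun x => w x * phi k x)); last first.
  by apply/funext => x /=; rewrite mul1r.
move=> int; rewrite /L2dot -RintegralZl//.
by apply: eq_Rintegral => x _; rewrite mulrA.
Qed.

Lemma spectral_sum_ge0 w : (0 <= spectral_sum w)%E.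
Proof. by apply: nneseries_ge0 => k _ _; rewrite lee_fin mulr_ge0 ?powR_ge0 ?sqr_ge0. Qed.

Lemma spectral_sumZ (a : R) w : weighted_L2 (cst 1) Omega w ->
  spectral_sum (fun x => a * w x) = ((a ^+ 2)%:E * spectral_sum w)%E.
Proof.
move=> Lw; rewrite /spectral_sum -nneseriesZl; last first.
  by move=> k _; rewrite lee_fin mulr_ge0 ?powR_ge0 ?sqr_ge0.
apply: eq_eseriesr => k _; rewrite L2dotZl// -EFinM; congr (_%:E); ring.
Qed.

Lemma Hr_scale (a : R) w : Hr w -> Hr (fun x => a * w x) /\
  Hr_norm (fun x => a * w x) = `|a| * Hr_norm w.
Proof.
move=> [Lw fin]; have sE := spectral_sumZ a Lw.
have fn : spectral_sum w \is a fin_num by rewrite ge0_fin_numE// spectral_sum_ge0.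
split; last first.
  by rewrite /Hr_norm sE fineM// sqrtrM ?sqr_ge0// sqrtr_sqr.
split; first exact: (wL2Z mO (measurable_cst _) (fun _ _ => ltr01) a Lw).
by rewrite sE -(fineK fn) -EFinM ltry.
Qed.

Variable f : ('rV[R]_d -> R) -> R.
Hypothesis hf : Hr_dual Omega lam phi r f.

Lemma Hr_dualZ (a : R) w : Hr w -> f (fun x => a * w x) = a * f w.
Proof.
move=> hw; have [flin _] := hf.
rewrite (_ : (fun x => a * w x) = fun x => (a - 1) * w x + w x); last first.
  by apply/funext => x; ring.
by rewrite flin//; ring.
Qed.

Lemma Hr_dual_norm_ub w : Hr w -> Hr_norm w <= 1 ->
  `|f w| <= Hr_dual_norm Omega lam phi r f.
Proof.
move=> hw w1; have [_ [M fM]] := hf; apply: ub_le_sup; last by exists w.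
exists `|M| => _ [v [hv v1] <-]; apply: le_trans (fM v hv) _.
apply: (@le_trans _ _ (`|M| * Hr_norm v)); first by rewrite ler_wpM2r ?ler_norm ?sqrtr_ge0.
by rewrite ler_piMr.
Qed.

Lemma Hr_dual_norm_ge0 : 0 <= Hr_dual_norm Omega lam phi r f.
Proof.
rewrite /Hr_dual_norm; set S := (X in sup X).
(* The supremum of the empty set is 0 by convention. *)
have [->|/set0P[_ [w [hw w1] _]]] := eqVneq S set0; first by rewrite sup0.
exact: le_trans (normr_ge0 (f w)) (Hr_dual_norm_ub hw w1).
Qed.

(** Rescaling to the unit ball fails when the norm of [w] is 0; there the boundedness of [f] already
    forces [f w = 0]. *)
Lemma Hr_dual_bound w : Hr w -> `|f w| <= Hr_dual_norm Omega lam phi r f * Hr_norm w.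
Proof.
move=> hw; have [_ [M fM]] := hf; have [w0|w0] := eqVneq (Hr_norm w) 0.
  by have := fM w hw; rewrite w0 !mulr0.
have wp : 0 < Hr_norm w by rewrite lt_def w0 sqrtr_ge0.
have [hw' nw'] := Hr_scale (Hr_norm w)^-1 hw.
have w1 : Hr_norm (fun x => (Hr_norm w)^-1 * w x) <= 1.
  by rewrite nw' gtr0_norm ?invr_gt0// mulVf.
have := Hr_dual_norm_ub hw' w1; rewrite (Hr_dualZ _ hw) normrM gtr0_norm ?invr_gt0//.
by rewrite mulrC ler_pdivrMr.
Qed.

End spectral_duality.

(** * The extension problem as an instance *)

Section extension_problem.
Context {R : realType} (d : nat).
Variables (Omega : set 'rV[R]_d.+1) (A : 'rV[R]_d.+1 -> 'M[R]_d.+1) (s M qbar : R).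
Hypotheses (oO : open Omega) (M0 : 0 < M)
  (OM : forall x, Omega x -> forall i, `|x 0 i| < M)
  (hA : diffusion_coefficient Omega A) (qbar0 : 0 < qbar).
Local Notation n := (d.+1 + 1)%N.
Local Notation D := (cylinder Omega).
Local Notation HL := (HL Omega s).
Local Notation N := (HL_norm Omega s).
Local Notation adm := (admissible Omega qbar).
Local Notation principal_form := (principal_form Omega A s).
Local Notation potential_form := (potential_form Omega s).
Implicit Types (w v : 'rV[R]_n -> R) (q h : 'rV[R]_d.+1 -> R).

Let mO : measurable Omega. Proof. exact: open_measurable_rV. Qed.

Lemma potential_form_sym h w v : potential_form h w v = potential_form h v w.
Proof. by apply: eq_Rintegral => x _; ring. Qed.

Lemma HL_norm0 : N (fun=> 0) = 0.
Proof.
have h0 := HL_0 s oO; have := grad_ip_lin oO 1 h0 h0 h0; rewrite (HL_normE oO h0).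
rewrite (_ : (fun x => 1 * 0 + 0) = fun=> 0); last first.
  by apply/funext => x; rewrite mulr0 addr0.
by move: (grad_ip _ _ _ _) => g e; rewrite (_ : g = 0) ?sqrtr0//; lra.
Qed.

(** The bridge to the abstract setting: a null change does not affect the energy norm, and
    conversely Poincare's inequality makes an element of zero energy vanish almost everywhere. *)
Lemma ae_HLP w v : HL w -> HL v -> ae_eq_on D w v <-> N (fun x => w x - v x) <= 0.
Proof.
move=> hw hv; have hs := HL_sub oO hw hv; split=> [wv|/(HL_norm_eq0 oO M0 OM hs)].
  rewrite (HL_norm_congr oO hs (HL_0 s oO)) ?HL_norm0//.
  by apply: filterS wv => x + Dx => /(_ Dx) ->; rewrite subrr.
by apply: filterS => x + Dx => /(_ Dx) /eqP; rewrite subr_eq0 => /eqP.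
Qed.

Lemma potential_form_ge0 q w : adm q -> HL w -> 0 <= potential_form q w w.
Proof.
move=> [Lq q01] hw; have [mq _] := Linf_cyl oO Lq.
apply: (ip_weight_ge0 (measurable_cylinder oO) (measurable_funTS (@measurable_yweight R d.+1 s))
  (@yweight_gt0 R d.+1 s Omega) mq (HL_wL2 hw)).
by apply: filterS (ae_xpart q01) => x h [Ox _]; have /andP[] := h Ox.
Qed.

Variables (c : R) (E : ('rV[R]_d.+1 -> R) -> 'rV[R]_n -> R) (F : ('rV[R]_n -> R) -> R) (CF : R).
Hypotheses (c_gt0 : 0 < c) (coercive : forall w, HL w -> c * N w ^+ 2 <= principal_form w w)
  (CF_ge0 : 0 <= CF) (F_bound : forall v, HL v -> `|F v| <= CF * N v)
  (HE : forall q, adm q -> HL (E q) /\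
    forall v, HL v -> form_C Omega A s q (E q) v = F v).

(** The functional [F] stays abstract here, so the trace and the dual norm enter only through the
    constant [CF]. All orders from 1 on are covered. *)
Lemma solution_smooth : (exists D', frechet_derivatives Omega qbar s E D') /\
  forall D', frechet_derivatives Omega qbar s E D' ->
  forall m q (h : 'I_m.+1 -> 'rV[R]_d.+1 -> R), adm q -> (forall i, Linf Omega (h i)) ->
  [/\ HL (D' m.+1 q h),
      @derivative_equation R d.+1 Omega A s m.+1 q (D' m q) h (D' m.+1 q h),
      forall psi, HL psi -> @derivative_equation R d.+1 Omega A s m.+1 q (D' m q) h psi ->
        ae_eq_on D psi (D' m.+1 q h) &
      N (D' m.+1 q h) <=
        bound_const c ((2 * M) ^+ 2) m.+1 * CF * \prod_(i < m.+1) Linf_norm Omega (h i)].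
Proof.
have [CP CP_ge0 CPP] := principal_form_bound s oO M0 OM hA.
have [] := @frechet_smooth R d.+1 n HL N (ae_eq_on D) (Linf Omega) (Linf_norm Omega)
  adm principal_form potential_form c ((2 * M) ^+ 2) CP (HL_0 s oO) _ _ _ ae_HLP _ _ CPP _ _ _ _ c_gt0 _ CP_ge0
  _ _ _ _ _ _ _ E F CF CF_ge0 _ _ F_bound.
- by move=> a w v hw hv; exact: (HL_lin oO a hw hv).
- exact: (HL_norm_ge0 Omega s).
- by move=> a w v hw hv; exact: (HL_norm_lin oO a hw hv).
- by move=> a w v z hw hv hz; exact: (principal_form_lin oO M0 OM hA a hw hv hz).
- by move=> w v hw hv; exact: (principal_form_sym oO M0 OM hA hw hv).
- by move=> h a w v z Lh hw hv hz; exact: (potential_form_lin1 oO a Lh hw hv hz).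
- by move=> h k a w z Lh Lk hw hz; exact: (potential_form_lin0 oO a Lh Lk hw hz).
- by move=> h w v _ _ _; exact: potential_form_sym.
- by move=> h w v Lh hw hv; exact: (potential_form_bound oO M0 OM Lh hw hv).
- exact: sqr_ge0.
- move=> q w aq hw; apply: le_trans (coercive hw) _.
  by rewrite lerDl; exact: (potential_form_ge0 aq hw).
- by move=> w_ hw cauchy; exact: (HL_complete oO M0 OM hw cauchy).
- exact: (Linf_norm_ge0 Omega).
- by move=> q [].
- by move=> a h k Lh Lk; have [] := Linf_lin a Lh Lk.
- by move=> a h Lh; exact: (LinfZ a Lh).
- by move=> q h aq Lh; exact: (admissible_split mO qbar0 aq Lh).
- by move=> q /HE[].
- by move=> q v aq hv; have [hE e] := HE aq; rewrite -(e v hv) (form_C_split oO M0 OM hA aq.1 hE hv).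
move=> ex sol; split; first exact: ex.
move=> D' fD m q h aq Lh; have [hD e uni bd] := sol D' fD m q h aq Lh.
have rhsE v : \sum_(i < m.+1) \int[leb n]_(x in D)
    (yweight s x * h i (xpart x) * D' m q (drop_dir h i) x * v x) =
    \sum_(i < m.+1) potential_form (h i) (D' m q (drop_dir h i)) v.
  by apply: eq_bigr => i _; apply: eq_Rintegral => x _; ring.
split=> //.
  by move=> v hv; rewrite (form_C_split oO M0 OM hA aq.1 hD hv) [RHS](congr1 -%R (rhsE v)); exact: e.
move=> psi hpsi epsi; apply: uni => // v hv.
by have := epsi v hv; rewrite (form_C_split oO M0 OM hA aq.1 hpsi hv) => e2; rewrite /full_form e2; exact: (congr1 -%R (rhsE v)).
Qed.

End extension_problem.

Theorem lemma3p12 (R : realType) (d : nat) (Omega : set 'rV[R]_d)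
    (A : 'rV[R]_d -> 'M[R]_d) (qbar s : R)
    (lam : ('rV[R]_d -> R) -> nat -> R)
    (phi : ('rV[R]_d -> R) -> nat -> 'rV[R]_d -> R)
    (tr : ('rV[R]_(d + 1) -> R) -> 'rV[R]_d -> R)
    (hd : d = 2%N \/ d = 3%N)
    (hOmega : convex_polytope Omega)
    (hA : diffusion_coefficient Omega A)
    (hqbar : 0 < qbar)
    (hs : 0 < s < 1)
    (hphi : forall q, admissible Omega qbar q ->
      eigensystem Omega A q (lam q) (phi q))
    (hHr : uniformly_equivalent_Hr Omega qbar lam phi)
    (htr : trace_operator Omega qbar s lam phi tr) :
  (forall q0 f E, admissible Omega qbar q0 ->
     Hr_dual Omega (lam q0) (phi q0) s f ->
     solution_map Omega A qbar s tr f E ->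
     (exists D, frechet_derivatives Omega qbar s E D) /\
     (forall D, frechet_derivatives Omega qbar s E D ->
      forall m q (h : 'I_m -> 'rV[R]_d -> R), (2 <= m)%N ->
        admissible Omega qbar q -> (forall i, Linf Omega (h i)) ->
        [/\ HL Omega s (D m q h),
            derivative_equation Omega A s q (D m.-1 q) h (D m q h) &
            forall psi, HL Omega s psi ->
              derivative_equation Omega A s q (D m.-1 q) h psi ->
              ae_eq_on (cylinder Omega) psi (D m q h)])) /\
  (forall m, (2 <= m)%N -> exists C : R,
     forall q0 f E D, admissible Omega qbar q0 ->
       Hr_dual Omega (lam q0) (phi q0) s f ->
       solution_map Omega A qbar s tr f E ->
       frechet_derivatives Omega qbar s E D ->
     forall q (h : 'I_m -> 'rV[R]_d -> R),
       admissible Omega qbar q -> (forall i, Linf Omega (h i)) ->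
       HL_norm Omega s (D m q h) <=
         C * Hr_dual_norm Omega (lam q0) (phi q0) s f *
         \prod_(i < m) Linf_norm Omega (h i)).
Proof.
(* Poincare's inequality uses a first coordinate of the base, so the dimension must be a
   successor. *)
have [d' ed] : exists d', d = d'.+1 by case: hd => ->; [exists 1%N|exists 2%N].
subst d; rename d' into d.
have oO := convex_polytope_open hOmega; have mO := open_measurable_rV oO.
have [M M0 OM] : exists2 M : R, 0 < M & forall x, Omega x -> forall i, `|x 0 i| < M.
  by case: hOmega => _ bO _; exact: bounded_set_coord bO.
have [c c0 coercive] := principal_form_coercive s oO M0 OM hA.
have a0 : admissible Omega qbar (fun=> 0) by exact: admissible0.
have [_ /(_ _ a0)[T TP] _] := htr.
have [K KP] : exists K : R, forall q q', admissible Omega qbar q ->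
    admissible Omega qbar q' -> forall w, Hr Omega (lam q) (phi q) s w ->
    Hr Omega (lam q') (phi q') s w /\
    Hr_norm Omega (lam q') (phi q') s w <= K * Hr_norm Omega (lam q) (phi q) s w.
  by apply: hHr; case/andP: hs => s0 s1; rewrite !ltW.
(* [T] is the trace constant at the zero potential and [K] compares the norms of H^s. Both come from
   bare existence statements with no sign, hence the absolute values. *)
pose B : R := `|d_const s| * (`|K| * `|T|).
have B0 : 0 <= B by rewrite !mulr_ge0.
have Lphi q : admissible Omega qbar q -> forall k, weighted_L2 (cst 1) Omega (phi q k).
  by move=> /hphi[+ _ _ _] k => /(_ k)[[]].
have F_bound q0 f : admissible Omega qbar q0 -> Hr_dual Omega (lam q0) (phi q0) s f ->
    0 <= B * Hr_dual_norm Omega (lam q0) (phi q0) s f /\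
    forall v, HL Omega s v -> `|d_const s * f (tr v)| <=
      B * Hr_dual_norm Omega (lam q0) (phi q0) s f * HL_norm Omega s v.
  move=> aq0 hf; have f0 := Hr_dual_norm_ge0 hf.
  split=> [|v hv]; first exact: mulr_ge0.
  have [t0 tle] := TP v hv; have [t1 tle1] := KP _ _ a0 aq0 _ t0.
  have := Hr_dual_bound mO (Lphi q0 aq0) hf t1.
  have nv := HL_norm_ge0 Omega s v; have n0 : 0 <= Hr_norm Omega (lam (fun=> 0)) (phi (fun=> 0)) s (tr v) by exact: sqrtr_ge0.
  move: f0 tle tle1 nv n0; rewrite normrM /B.
  move: (Hr_norm _ (lam q0) _ _ _) => e; move: (Hr_norm _ _ _ _ _) => b.
  move: (Hr_dual_norm _ _ _ _ _) (HL_norm _ _ _) => a g.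
  move=> a_ge0 be eb g0 b0 fle.
  rewrite -!mulrA ler_wpM2l//; apply: le_trans fle _.
  apply: (@le_trans _ _ (a * (`|K| * (`|T| * g)))); last first.
    by rewrite le_eqVlt; apply/orP; left; apply/eqP; ring.
  rewrite ler_wpM2l//; apply: le_trans eb _.
  apply: (@le_trans _ _ (`|K| * b)); first by rewrite ler_wpM2r// ler_norm.
  rewrite ler_wpM2l//; apply: le_trans be _.
  by rewrite ler_wpM2r// ler_norm.
have key q0 f E : admissible Omega qbar q0 -> Hr_dual Omega (lam q0) (phi q0) s f ->
    solution_map Omega A qbar s tr f E -> _ :=
  fun aq0 hf hE => @solution_smooth R d Omega A s M qbar oO M0 OM hA hqbar c E
    (fun v => d_const s * f (tr v)) _ c0 coercive (F_bound q0 f aq0 hf).1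
    (F_bound q0 f aq0 hf).2 hE.
split=> [q0 f E aq0 hf hE|].
  have [ex sol] := key q0 f E aq0 hf hE; split; first exact: ex.
  move=> D fD [//|m] q h _ aq Lh; have [hD e uni _] := sol D fD m q h aq Lh.
  by split.
(* The constant is fixed before [q0], [f], [E] and [D]; the dependence on [f] is entirely in its
   dual norm. *)
case=> [//|m] _; exists (bound_const c ((2 * M) ^+ 2) m.+1 * B) => q0 f E D aq0 hf hE fD q h aq Lh.
have [_ sol] := key q0 f E aq0 hf hE; have [_ _ _ bd] := sol D fD m q h aq Lh.
by rewrite -(mulrA _ B).
Qed.
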